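(* Consider the deep linear ResNet setting described in the context, and assume: (i) for every $N\ge1$ and $n\in\{1,\dots,N\}$, $\sqrt{\ell^N(0)}<\frac{m}{4\sqrt{2Me^3}}$ and $\|\theta_n^N(0)\|\le\frac14$; (ii) there is $C_0>0$ with $\|\theta_{n+1}^N(0)-\theta_n^N(0)\|\le\frac{C_0}{N}$ for all $N$ and $n$; (iii) there is a function $\psi_{\mathrm{init}}:[0,1]\to\mathbb{R}^{d\times d}$ such that $\sup_{s\in[0,1]}\|\psi_N(s,0)-\psi_{\mathrm{init}}(s)\|=O(\frac1N)$ as $N\to\infty$. Then the sequence $(\psi_N)_{N\ge1}$ converges uniformly on $[0,1]\times\mathbb{R}_+$ to a limit $\psi:[0,1]\times\mathbb{R}_+\to\mathbb{R}^{d\times d}$ which is Lipschitz continuous in $(s,t)$, with $\sup_{(s,t)\in[0,1]\times\mathbb{R}_+}\|\psi(s,t)-\psi_N(s,t)\|=O(\frac1N)$. Furthermore, $\Pi^N(t)$ converges as $N\to\infty$, uniformly in $t\in\mathbb{R}_+$, to the linear map $x_0\mapsto x(1)$, where $x$ solves the Neural ODE $\frac{dx}{ds}(s)=\psi(s,t)x(s)$ on $[0,1]$ with $x(0)=x_0$.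
   Context: Let $d\ge1$, $\Sigma\in\mathbb{R}^{d\times d}$ symmetric positive definite with largest eigenvalue $M>0$ and smallest eigenvalue $m>0$, and $B\in\mathbb{R}^{d\times d}$. For $A\in\mathbb{R}^{d\times d}$ put $\|A\|_\Sigma^2=\mathrm{Tr}(A\Sigma A^\top)$. For each integer $N\ge1$ and parameters $\theta_1^N,\dots,\theta_N^N\in\mathbb{R}^{d\times d}$, let $\Pi^N=(I_d+\frac{\theta_N^N}{N})\cdots(I_d+\frac{\theta_1^N}{N})$ and $L(\theta_1^N,\dots,\theta_N^N)=\|\Pi^N-B\|_\Sigma^2$. The parameters evolve by the rescaled gradient flow $\frac{d\theta_n^N}{dt}(t)=-N\nabla_{\theta_n^N}L(\theta_1^N(t),\dots,\theta_N^N(t))$ for $t\ge0$, and $\ell^N(t)=L(\theta_1^N(t),\dots,\theta_N^N(t))$, $\Pi^N(t)$ is $\Pi^N$ evaluated at $\theta^N(t)$. For $s\in[0,1]$, $t\ge0$, $\psi_N(s,t)=\theta^N_{\lfloor Ns\rfloor}(t)$ (with the convention $\theta_0^N:=\theta_1^N$). $\|\cdot\|$ denotes the spectral (operator) norm of matrices. *)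

(* Defs.v *)
From HB Require Import structures.
From mathcomp Require Import all_boot all_order all_algebra.
From mathcomp Require Import all_classical all_reals all_analysis.
Set Implicit Arguments. Unset Strict Implicit. Unset Printing Implicit Defensive.
Import Order.TTheory GRing.Theory Num.Theory.
Import numFieldNormedType.Exports.
Local Open Scope classical_set_scope.
Local Open Scope ring_scope.

Section DeepResNet.
Context {R : realType} {d : nat}.

Definition vnorm (v : 'cV[R]_d) : R := Num.sqrt (\sum_(i < d) v i 0 ^+ 2).

Definition spec_norm (A : 'M[R]_d) : R :=
  sup [set vnorm (A *m v) | v in [set v : 'cV[R]_d | vnorm v = 1]].

Definition sigma_norm2 (Sigma A : 'M[R]_d) : R := \tr (A *m Sigma *m A^T).

Fixpoint piprod (N : nat) (th : nat -> 'M[R]_d) (k : nat) : 'M[R]_d :=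
  match k with
  | 0 => 1%:M
  | k'.+1 => (1%:M + (N%:R)^-1 *: th k'.+1) *m piprod N th k'
  end.

(* Pi^N = (I + th_N/N) ... (I + th_1/N); only th 1, ..., th N are used *)
Definition PiN (N : nat) (th : nat -> 'M[R]_d) : 'M[R]_d := piprod N th N.

Definition lossN (Sigma B : 'M[R]_d) (N : nat) (th : nat -> 'M[R]_d) : R :=
  sigma_norm2 Sigma (PiN N th - B).

Definition update (th : nat -> 'M[R]_d) (n : nat) (E : 'M[R]_d) : nat -> 'M[R]_d :=
  fun k => if k == n then th k + E else th k.

(* (i,j) entry of the gradient of L w.r.t. th_n, i.e. the partial derivative
   of L w.r.t. the (i,j) entry of th_n (L is polynomial, so this exists) *)
Definition grad_entry (Sigma B : 'M[R]_d) (N : nat) (th : nat -> 'M[R]_d)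
  (n : nat) (i j : 'I_d) : R :=
  derive1 (fun e : R => lossN Sigma B N (update th n (e *: delta_mx i j))) 0.

Definition is_rescaled_grad_flow (Sigma B : 'M[R]_d) (N : nat)
  (theta : nat -> R -> 'M[R]_d) : Prop :=
  (forall n, (1 <= n <= N)%N -> forall i j : 'I_d,
     {within [set t : R | 0 <= t], continuous (fun t => theta n t i j)}) /\
  (forall t : R, 0 < t -> forall n, (1 <= n <= N)%N -> forall i j : 'I_d,
     is_derive t (1 : R) (fun u => theta n u i j)
       (- (N%:R) * grad_entry Sigma B N (fun k => theta k t) n i j)).

Definition psiN (theta : nat -> nat -> R -> 'M[R]_d) (N : nat) (s t : R) : 'M[R]_d :=
  let k := Num.truncn (N%:R * s) in theta N (if k == 0%N then 1%N else k) t.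

Definition solves_linear_ode (A : R -> 'M[R]_d) (x0 : 'cV[R]_d) (x : R -> 'cV[R]_d) : Prop :=
  x 0 = x0 /\
  (forall i : 'I_d, {within `[0, 1], continuous (fun s => x s i 0)}) /\
  (forall s : R, 0 < s < 1 -> forall i : 'I_d,
     is_derive s (1 : R) (fun u => x u i 0) ((A s *m x s) i 0)).

End DeepResNet.

(* Main.v *)
(* The rescaled flow is theta_(i+1)' = - 2 P_i^T (Pi - B) Sigma Q_i^T, where Q_i is the
   product of the first i layers and P_i that of the layers after i + 1.

   As long as all layers have norm at most 1/2, the products P_i and Q_i are uniformly
   well conditioned, so the loss decays at rate 4 m / e and the total drift of every layer
   is less than 1/4; a continuity argument makes both facts global in time.  The
   derivatives of two neighbouring layers differ by O(1/N) times an integrable function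
   of t, so neighbours stay O(1/N)-close.

   To get a rate uniform in t, depth N is compared with depth N k.  Let E be the mean
   squared distance of the layers and xi the difference of the two residuals Pi - B.
   The difference Pi^(N k) - Pi^N is not multiplied by anything small in the layer
   equation, but xi obeys an equation whose linear part is coercive for the Sigma-norm,
   with a source O((sqrt E + 1/N) e^(- mu t)); hence E + e^(mu t) |xi|^2 + 1/N^2 satisfies
   a Gronwall inequality with integrable rate and stays O(1/N^2).  Comparing N and N' with
   N N' shows that psi_N is Cauchy with rate 1/N.

   The same comparison shows that the partial products of floor(N s) factors converge to
   some q(s, t), and their expansion passes to the limit as
   |q(s') - q(s) - (s' - s) psi(s) q(s)| <= C (s' - s)^2.  So q(., t) x0 solves the neural
   ODE, and Gronwall gives uniqueness. *)

(* A depth [N] is refined to a multiple [N * k] because each coarse layer then faces exactly [k]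
   fine ones, fine index [j] against [j %/ k], without fractional overlaps. The energy is a mean of
   squared Frobenius norms for two reasons: it is differentiable in time, unlike a maximum or a
   spectral norm, and a product feels its layers only through a mean, each factor having weight one
   over the depth. A bound for every single layer is recovered afterwards by integrating its
   velocity difference. The lower bounds on the products serve twice. They make the operator that
   drives the residual coercive, and they allow division by a head product, which reduces the
   comparison of tails to that of heads. Layers and products are measured in spectral norm,
   residuals and energies in Frobenius norm; passing from one to the other costs at most [sqrt d],
   which does not depend on the depth. *)
Require Import Defs.
From HB Require Import structures.
From mathcomp Require Import all_boot all_order all_algebra.
From mathcomp Require Import all_classical all_reals all_analysis.
From mathcomp Require Import ring lra zify.
Import Order.TTheory GRing.Theory Num.Theory.
Import numFieldNormedType.Exports.
Set Implicit Arguments. Unset Strict Implicit. Unset Printing Implicit Defensive.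
Local Open Scope classical_set_scope.
Local Open Scope ring_scope.

(** * Frobenius and weighted inner products of matrices *)

Section MatrixNorms.
Context {R : realType}.

(** One form covers both the loss ([S = Sigma]) and the Frobenius product ([S = 1%:M]), so that
    Cauchy-Schwarz is proved once, for a semidefinite [S]. *)
Definition sdot n p (S : 'M[R]_n) (A B : 'M[R]_(p, n)) : R := \tr (A *m S *m B^T).

Definition fdot n p (A B : 'M[R]_(p, n)) : R := \tr (A *m B^T).

Definition fro n p (A : 'M[R]_(p, n)) : R := Num.sqrt (fdot A A).

Lemma fdotE n p (A B : 'M[R]_(p, n)) : fdot A B = sdot 1%:M A B.
Proof. by rewrite /fdot /sdot mulmx1. Qed.

Lemma fdot_sum n p (A B : 'M[R]_(p, n)) : fdot A B = \sum_i \sum_j A i j * B i j.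
Proof.
apply: eq_bigr => i _; rewrite mxE; apply: eq_bigr => j _; by rewrite mxE.
Qed.

Section Form.
Variables (n p : nat) (S : 'M[R]_n).
Implicit Types A B : 'M[R]_(p, n).

Lemma sdotDl A A' B : sdot S (A + A') B = sdot S A B + sdot S A' B.
Proof. by rewrite /sdot !mulmxDl raddfD. Qed.

Lemma sdotDr A B B' : sdot S A (B + B') = sdot S A B + sdot S A B'.
Proof. by rewrite /sdot linearD /= mulmxDr raddfD. Qed.

Lemma sdotZl a A B : sdot S (a *: A) B = a * sdot S A B.
Proof. by rewrite /sdot -!scalemxAl linearZ. Qed.

Lemma sdotZr a A B : sdot S A (a *: B) = a * sdot S A B.
Proof. by rewrite /sdot linearZ /= -scalemxAr linearZ. Qed.

Hypothesis Ssym : S^T = S.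

Lemma sdotC A B : sdot S A B = sdot S B A.
Proof. by rewrite /sdot -mxtrace_tr !trmx_mul trmxK Ssym mulmxA. Qed.

Lemma sdot_rows A : sdot S A A = \sum_i (row i A *m S *m (row i A)^T) 0 0.
Proof.
apply: eq_bigr => i _; rewrite -row_mul !mxE; apply: eq_bigr => j _.
by rewrite !mxE.
Qed.

Hypothesis Spsd : forall v : 'rV[R]_n, 0 <= (v *m S *m v^T) 0 0.

Lemma sdot_ge0 A : 0 <= sdot S A A.
Proof. by rewrite sdot_rows; apply: sumr_ge0. Qed.

Lemma sdot_CS A B : sdot S A B ^+ 2 <= sdot S A A * sdot S B B.
Proof.
have q x : 0 <= sdot S A A + 2 * x * sdot S A B + x ^+ 2 * sdot S B B.
  have := sdot_ge0 (A + x *: B).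
  rewrite !(sdotDl, sdotDr, sdotZl, sdotZr) (sdotC B A) => h.
  suff -> : sdot S A A + 2 * x * sdot S A B + x ^+ 2 * sdot S B B =
     sdot S A A + x * sdot S A B + (x * sdot S A B + x * (x * sdot S B B)) by [].
  by ring.
move: (sdot S A A) (sdot S A B) (sdot S B B) (sdot_ge0 A) (sdot_ge0 B) q.
move=> a b c a0 c0 q.
have [c_eq0|cN0] := eqVneq c 0.
  have [->|b0] := eqVneq b 0; first by rewrite expr0n mulr_ge0.
  (* With [c = 0] the quadratic is affine in [x], and this [x] makes it equal to -1, against [q]. *)
  have := q (- (a + 1) / (2 * b)); rewrite c_eq0.
  have -> : a + 2 * (- (a + 1) / (2 * b)) * b + (- (a + 1) / (2 * b)) ^+ 2 * 0 = -1.
    by field.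
  by rewrite lerNr oppr0 ler10.
have c_gt0 : 0 < c by rewrite lt_def cN0.
(* This [x] minimises the quadratic. *)
have := q (- b / c).
have -> : a + 2 * (- b / c) * b + (- b / c) ^+ 2 * c = (a * c - b ^+ 2) / c by field.
by rewrite pmulr_lge0 ?invr_gt0 // subr_ge0.
Qed.

End Form.

Lemma id_psd n (v : 'rV[R]_n) : 0 <= (v *m 1%:M *m v^T) 0 0.
Proof.
rewrite mulmx1 mxE; apply: sumr_ge0 => i _; by rewrite mxE -expr2 sqr_ge0.
Qed.

Lemma fdotC n p (A B : 'M[R]_(p, n)) : fdot A B = fdot B A.
Proof. by rewrite !fdotE sdotC // trmx1. Qed.

Lemma fdotDl n p (A A' B : 'M[R]_(p, n)) : fdot (A + A') B = fdot A B + fdot A' B.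
Proof. by rewrite !fdotE sdotDl. Qed.

Lemma fdotZl n p a (A B : 'M[R]_(p, n)) : fdot (a *: A) B = a * fdot A B.
Proof. by rewrite !fdotE sdotZl. Qed.

Lemma fdotZr n p a (A B : 'M[R]_(p, n)) : fdot A (a *: B) = a * fdot A B.
Proof. by rewrite !fdotE sdotZr. Qed.

Lemma fdotDr n p (A B B' : 'M[R]_(p, n)) : fdot A (B + B') = fdot A B + fdot A B'.
Proof. by rewrite !fdotE sdotDr. Qed.

Lemma fdot_ge0 n p (A : 'M[R]_(p, n)) : 0 <= fdot A A.
Proof. by rewrite fdotE sdot_ge0 ?trmx1 //; exact: id_psd. Qed.

Lemma fro_ge0 n p (A : 'M[R]_(p, n)) : 0 <= fro A.
Proof. exact: sqrtr_ge0. Qed.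

Lemma fro_sqr n p (A : 'M[R]_(p, n)) : fro A ^+ 2 = fdot A A.
Proof. by rewrite sqr_sqrtr ?fdot_ge0. Qed.

Lemma fdot_CS n p (A B : 'M[R]_(p, n)) : `|fdot A B| <= fro A * fro B.
Proof.
rewrite -(@ler_pXn2r _ 2) ?nnegrE ?mulr_ge0 ?fro_ge0 //.
rewrite exprMn !fro_sqr real_normK ?num_real //.
by rewrite !fdotE sdot_CS ?trmx1 //; exact: id_psd.
Qed.

Lemma fdot_le n p (A B : 'M[R]_(p, n)) : fdot A B <= fro A * fro B.
Proof. exact: le_trans (ler_norm _) (fdot_CS _ _). Qed.

Lemma fro_le_sqr n p (A : 'M[R]_(p, n)) (c : R) :
  0 <= c -> fdot A A <= c ^+ 2 -> fro A <= c.
Proof. by move=> c0; rewrite -fro_sqr ler_pXn2r ?nnegrE ?fro_ge0. Qed.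

Lemma froD n p (A B : 'M[R]_(p, n)) : fro (A + B) <= fro A + fro B.
Proof.
apply: fro_le_sqr; first by rewrite addr_ge0 ?fro_ge0.
rewrite !fdotDl !fdotDr (fdotC B A) sqrrD !fro_sqr.
have := fdot_le A B; lra.
Qed.

Lemma froZ n p a (A : 'M[R]_(p, n)) : fro (a *: A) = `|a| * fro A.
Proof.
by rewrite /fro fdotZl fdotZr mulrA -expr2 sqrtrM ?sqr_ge0 // sqrtr_sqr.
Qed.

Lemma fro_tr n p (A : 'M[R]_(p, n)) : fro A^T = fro A.
Proof.
rewrite /fro !fdot_sum exchange_big /=; congr Num.sqrt.
by apply: eq_bigr => i _; apply: eq_bigr => j _; rewrite !mxE.
Qed.

Lemma fdot_entry n p (A : 'M[R]_(p, n)) i j : A i j ^+ 2 <= fdot A A.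
Proof.
have sq0 k l : 0 <= A k l * A k l by rewrite -expr2 sqr_ge0.
rewrite fdot_sum (bigD1 i) //= (bigD1 j) //= -expr2 -addrA lerDl.
by rewrite addr_ge0 //; do ?[apply: sumr_ge0 => ? _ //].
Qed.

Lemma fro_entry n p (A : 'M[R]_(p, n)) i j : `|A i j| <= fro A.
Proof.
rewrite -(@ler_pXn2r _ 2) ?nnegrE ?fro_ge0 // fro_sqr real_normK ?num_real //.
exact: fdot_entry.
Qed.

Lemma fdot_cols n p (A : 'M[R]_(p, n)) : fdot A A = \sum_j fdot (col j A) (col j A).
Proof.
rewrite fdot_sum exchange_big /=; apply: eq_bigr => j _.
by rewrite fdot_sum; apply: eq_bigr => i _; rewrite big_ord1 !mxE.
Qed.

Lemma fdot_mulmxA n p q (A : 'M[R]_(p, q)) (B : 'M[R]_(q, n)) C :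
  fdot (A *m B) C = fdot B (A^T *m C).
Proof. by rewrite /fdot trmx_mul trmxK -mulmxA mxtrace_mulC mulmxA. Qed.

Lemma fro_mulv q p (A : 'M[R]_(p, q)) (v : 'cV[R]_q) : fro (A *m v) <= fro A * fro v.
Proof.
apply: fro_le_sqr; first by rewrite mulr_ge0 ?fro_ge0.
rewrite exprMn !fro_sqr fdot_sum.
have -> : fdot A A = \sum_i fdot (row i A) (row i A).
  rewrite fdot_sum; apply: eq_bigr => i _; rewrite fdot_sum big_ord1.
  by apply: eq_bigr => j _; rewrite !mxE.
rewrite mulr_suml; apply: ler_sum => i _; rewrite big_ord1 -expr2.
have -> : (A *m v) i 0 = fdot (row i A) v^T.
  by rewrite /fdot trmxK -row_mul /mxtrace big_ord1 [RHS]mxE.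
have -> : fdot v v = fdot v^T v^T by rewrite -!fro_sqr fro_tr.
by rewrite !fdotE sdot_CS ?trmx1 //; exact: id_psd.
Qed.

End MatrixNorms.

(** * The spectral norm and its relation to the Frobenius norm *)

Section SpectralNorm.
Context {R : realType} {d : nat}.
Implicit Types (A B : 'M[R]_d) (v : 'cV[R]_d).

Lemma vnormE v : vnorm v = fro v.
Proof.
by rewrite /vnorm /fro fdot_sum; congr Num.sqrt; apply: eq_bigr => i _; rewrite big_ord1.
Qed.

Lemma fro_eq0 n p (A : 'M[R]_(p, n)) : fro A = 0 -> A = 0.
Proof.
move=> A0; apply/matrixP => i j; apply/eqP; rewrite mxE -normr_le0 -A0.
exact: fro_entry.
Qed.

Lemma spec_sup A :
  has_ubound [set vnorm (A *m v) | v in [set v : 'cV[R]_d | vnorm v = 1]].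
Proof.
exists (fro A) => _ [v /= v1 <-]; rewrite vnormE (le_trans (fro_mulv _ _)) //.
by rewrite -vnormE v1 mulr1.
Qed.

Lemma spec_mulv A v : fro (A *m v) <= spec_norm A * fro v.
Proof.
have [v0|vN0] := eqVneq (fro v) 0.
  by rewrite (fro_eq0 v0) mulmx0 -(scale0r (0 : 'cV[R]_d)) froZ normr0 mul0r mulr0.
have v_gt0 : 0 < fro v by rewrite lt_def vN0 fro_ge0.
rewrite -ler_pdivrMr //.
suff -> : fro (A *m v) / fro v = vnorm (A *m ((fro v)^-1 *: v)).
  apply: (ub_le_sup (spec_sup A)); exists ((fro v)^-1 *: v) => //=.
  by rewrite vnormE froZ ger0_norm ?invr_ge0 ?fro_ge0 // mulVf.
by rewrite vnormE -scalemxAr froZ ger0_norm ?invr_ge0 ?fro_ge0 // mulrC.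
Qed.

Lemma spec_ge0 A : 0 <= spec_norm A.
Proof.
rewrite /spec_norm.
(* For [d = 0] there are no unit vectors, and [sup] of the empty set is 0. *)
have [->|/set0P [x Ex]] := eqVneq [set vnorm (A *m v) | v in [set v : 'cV[R]_d | vnorm v = 1]] set0.
  by rewrite sup0.
apply: (le_trans _ (ub_le_sup (spec_sup A) Ex)).
by case: Ex => v _ <-; rewrite vnormE fro_ge0.
Qed.

Lemma spec_le A (c : R) : 0 <= c -> (forall v, fro (A *m v) <= c * fro v) ->
  spec_norm A <= c.
Proof.
move=> c0 Ac; rewrite /spec_norm.
have [->|/set0P ne] := eqVneq [set vnorm (A *m v) | v in [set v : 'cV[R]_d | vnorm v = 1]] set0.
  by rewrite sup0.
apply: ge_sup => // _ [v /= v1 <-].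
by rewrite vnormE (le_trans (Ac v)) // -vnormE v1 mulr1.
Qed.

Lemma spec_le_fro A : spec_norm A <= fro A.
Proof. by apply: spec_le; [exact: fro_ge0|move=> v; exact: fro_mulv]. Qed.

Lemma specD A B : spec_norm (A + B) <= spec_norm A + spec_norm B.
Proof.
apply: spec_le => [|v]; first by rewrite addr_ge0 ?spec_ge0.
by rewrite mulmxDl (le_trans (froD _ _)) // mulrDl lerD // spec_mulv.
Qed.

Lemma specZ a A : spec_norm (a *: A) <= `|a| * spec_norm A.
Proof.
apply: spec_le => [|v]; first by rewrite mulr_ge0 ?spec_ge0.
by rewrite -scalemxAl froZ -mulrA ler_wpM2l // spec_mulv.
Qed.

Lemma specN A : spec_norm (- A) = spec_norm A.
Proof.
have h B : spec_norm (- B) <= spec_norm B.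
  by rewrite -scaleN1r (le_trans (specZ _ _)) // normrN1 mul1r.
by apply/eqP; rewrite eq_le h -{1}(opprK A) h.
Qed.

Lemma specB A B : spec_norm (A - B) <= spec_norm A + spec_norm B.
Proof. by rewrite (le_trans (specD _ _)) // specN. Qed.

Lemma spec_distC A B : spec_norm (A - B) = spec_norm (B - A).
Proof. by rewrite -specN opprB. Qed.

Lemma spec_triangle A B C :
  spec_norm (A - C) <= spec_norm (A - B) + spec_norm (B - C).
Proof. by rewrite (le_trans _ (specD _ _)) // addrA subrK. Qed.

Lemma specM A B : spec_norm (A *m B) <= spec_norm A * spec_norm B.
Proof.
apply: spec_le => [|v]; first by rewrite mulr_ge0 ?spec_ge0.
rewrite -mulmxA (le_trans (spec_mulv _ _)) // -mulrA ler_wpM2l ?spec_ge0 //.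
exact: spec_mulv.
Qed.

Lemma spec0 : spec_norm (0 : 'M[R]_d) = 0.
Proof.
apply/eqP; rewrite eq_le spec_ge0 andbT -(scale0r (0 : 'M[R]_d)).
by rewrite (le_trans (specZ _ _)) // normr0 mul0r.
Qed.

Lemma spec1 : spec_norm (1%:M : 'M[R]_d) <= 1.
Proof. by apply: spec_le => // v; rewrite mul1mx mul1r. Qed.

(** [|A^T v|^2 = <v, A A^T v> <= |v| |A| |A^T v|]; dividing by [|A^T v|] gives one inequality, and
    transposing twice gives the other. *)
Lemma spec_tr A : spec_norm A^T = spec_norm A.
Proof.
have h B : spec_norm B^T <= spec_norm B.
  apply: spec_le => [|v]; first exact: spec_ge0.
  have [->|nz] := eqVneq (fro (B^T *m v)) 0.
    by rewrite mulr_ge0 ?spec_ge0 ?fro_ge0.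
  have gt : 0 < fro (B^T *m v) by rewrite lt_def nz fro_ge0.
  rewrite -(ler_pM2r gt) -expr2 fro_sqr fdot_mulmxA trmxK.
  rewrite (le_trans (fdot_le _ _)) // mulrAC mulrC ler_wpM2r ?fro_ge0 //.
  exact: spec_mulv.
by apply/eqP; rewrite eq_le h -{1}(trmxK A) h.
Qed.

Lemma fro_specl A (B : 'M[R]_d) : fro (A *m B) <= spec_norm A * fro B.
Proof.
apply: fro_le_sqr; first by rewrite mulr_ge0 ?spec_ge0 ?fro_ge0.
rewrite exprMn fro_sqr [fdot B B]fdot_cols fdot_cols mulr_sumr ler_sum // => j _.
rewrite -!fro_sqr -exprMn ler_pXn2r ?nnegrE ?mulr_ge0 ?spec_ge0 ?fro_ge0 //.
by rewrite colE -mulmxA -colE spec_mulv.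
Qed.

Lemma fro_specr A B : fro (A *m B) <= fro A * spec_norm B.
Proof. by rewrite -fro_tr trmx_mul (le_trans (fro_specl _ _)) // spec_tr fro_tr mulrC. Qed.

Lemma fro1_sqr : fdot (1%:M : 'M[R]_d) 1%:M = d%:R.
Proof. by rewrite /fdot trmx1 mulmx1 mxtrace1. Qed.

Lemma fro_le_spec A : fro A <= Num.sqrt d%:R * spec_norm A.
Proof. by rewrite -{1}(mulmx1 A) (le_trans (fro_specl _ _)) // /fro fro1_sqr mulrC. Qed.

Lemma spec_entry A i j : `|A i j| <= spec_norm A.
Proof.
have -> : A i j = (A *m delta_mx j 0 : 'cV[R]_d) i 0 by rewrite -colE mxE.
rewrite (le_trans (fro_entry _ _ _)) // (le_trans (spec_mulv _ _)) //.
rewrite -[leRHS]mulr1 ler_wpM2l ?spec_ge0 // fro_le_sqr // expr1n.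
rewrite fdot_sum (bigD1 j) //= big_ord1 !mxE !eqxx mulr1 big1 ?addr0 //.
by move=> k kj; rewrite big_ord1 !mxE (negbTE kj) mul0r.
Qed.

Lemma fro_le_entries (A : 'M[R]_d) : fro A <= \sum_i \sum_j `|A i j|.
Proof.
have s0 : 0 <= \sum_i \sum_j `|A i j|.
  by apply: sumr_ge0 => i _; apply: sumr_ge0.
apply: fro_le_sqr => //; rewrite fdot_sum expr2 mulr_suml ler_sum // => i _.
rewrite mulr_suml ler_sum // => j _.
rewrite (le_trans (ler_norm _)) // normrM ler_wpM2l //.
rewrite (bigD1 i) //= (bigD1 j) //= -addrA lerDl addr_ge0 //.
  by apply: sumr_ge0.
by apply: sumr_ge0 => k _; apply: sumr_ge0.
Qed.

End SpectralNorm.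

(** * Eigenvalue bounds turned into bounds on quadratic forms *)

Section Rayleigh.
Context {R : realType}.

Lemma sdot_bounded n (S : 'M[R]_n) :
  exists2 C : R, 0 < C & forall v : 'rV[R]_n, sdot S v v <= C * fdot v v.
Proof.
exists (fro S + 1) => [|v]; first by rewrite ltr_wpDl ?fro_ge0.
have -> : sdot S v v = fdot (v *m S) v by [].
rewrite (le_trans (fdot_le _ _)) // -[fdot v v]fro_sqr expr2 mulrA.
rewrite ler_wpM2r ?fro_ge0 // -fro_tr trmx_mul (le_trans (fro_mulv _ _)) //.
by rewrite !fro_tr ler_wpM2r ?fro_ge0 // lerDl.
Qed.

Lemma fdot_eq0 n p (A : 'M[R]_(p, n)) : fdot A A = 0 -> A = 0.
Proof. by move=> A0; apply: fro_eq0; rewrite /fro A0 sqrtr0. Qed.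

Lemma sdot_row n (S : 'M[R]_n) (v : 'rV[R]_n) : sdot S v v = (v *m S *m v^T) 0 0.
Proof. by rewrite /sdot trace_mx11. Qed.

(* The supremum of the Rayleigh quotient is an eigenvalue: otherwise
   [lam%:M - S] is invertible and positive semidefinite, hence bounded below
   by Cauchy-Schwarz, and the supremum could be lowered. *)
Lemma rayleigh_le n (S : 'M[R]_n) (M : R) : (0 < n)%N -> S^T = S ->
  (forall a, eigenvalue S a -> a <= M) ->
  forall v : 'rV[R]_n, sdot S v v <= M * fdot v v.
Proof.
move=> n0 Ssym Mub.
pose E := [set sdot S v v | v in [set v : 'rV[R]_n | fdot v v = 1]].
have [C C0 SC] := sdot_bounded S.
have Eub : has_ubound E by exists C => _ [v /= v1 <-]; rewrite -[C]mulr1 -v1.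
have En0 : E !=set0.
  pose i := Ordinal n0; pose w : 'rV[R]_n := delta_mx 0 i; exists (sdot S w w).
  exists w => //=; rewrite fdot_sum big_ord1 (bigD1 i) //= big1.
    by rewrite !mxE !eqxx mulr1 addr0.
  by move=> j ji; rewrite !mxE (negbTE ji) andbF mul0r.
pose lam := sup E.
have lamP (v : 'rV[R]_n) : sdot S v v <= lam * fdot v v.
  have [v0|vN0] := eqVneq (fdot v v) 0.
    by rewrite (fdot_eq0 v0) /sdot !mul0mx /fdot mul0mx linear0 mulr0.
  have v_gt0 : 0 < fdot v v by rewrite lt_def vN0 fdot_ge0.
  have f0 : 0 < fro v by rewrite sqrtr_gt0.
  rewrite -ler_pdivrMr //; apply: (ub_le_sup Eub).
  exists ((fro v)^-1 *: v) => /=.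
    by rewrite fdotZl fdotZr -fro_sqr; field; rewrite gt_eqF.
  by rewrite sdotZl sdotZr -fro_sqr; field; rewrite gt_eqF.
suff elam : eigenvalue S lam.
  by move=> v; rewrite (le_trans (lamP v)) // ler_wpM2r ?fdot_ge0 ?Mub.
have [//|nelam] := boolP (eigenvalue S lam); exfalso.
pose T := lam%:M - S.
have Tu : T \in unitmx.
  have -> : T = (-1) *: (S - lam%:M) by rewrite scaleN1r opprB.
  rewrite unitmxZ ?unitrN1 // -row_free_unit -kermx_eq0.
  by move: nelam; rewrite /eigenvalue negbK.
have TE (v : 'rV[R]_n) : sdot T v v = lam * fdot v v - sdot S v v.
  by rewrite /sdot /T mulmxBr mulmxBl raddfB /= mul_mx_scalar -scalemxAl linearZ.
have Tsym : T^T = T by rewrite /T linearB /= tr_scalar_mx Ssym.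
have Tpsd (v : 'rV[R]_n) : 0 <= (v *m T *m v^T) 0 0 by rewrite -sdot_row TE subr_ge0.
have [K K0 TK] := sdot_bounded (invmx T).
have low (v : 'rV[R]_n) : K^-1 * fdot v v <= sdot T v v.
  have [v0|vN0] := eqVneq (fdot v v) 0.
    by rewrite v0 mulr0 TE subr_ge0.
  have v_gt0 : 0 < fdot v v by rewrite lt_def vN0 fdot_ge0.
  have := sdot_CS Tsym Tpsd (v *m invmx T) v.
  have -> : sdot T (v *m invmx T) v = fdot v v by rewrite /sdot mulmxKV.
  have -> : sdot T (v *m invmx T) (v *m invmx T) = sdot (invmx T) v v.
    by rewrite /sdot mulmxKV // trmx_mul trmx_inv Tsym mulmxA.
  have Tv0 : 0 <= sdot T v v by rewrite TE subr_ge0.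
  move=> /le_trans /(_ (ler_wpM2r Tv0 (TK v))).
  rewrite expr2 mulrAC [K * _ * _]mulrC ler_pM2l // => h.
  by rewrite mulrC ler_pdivrMr // mulrC.
have : lam <= lam - K^-1.
  apply: ge_sup => // _ [v /= v1 <-]; have := low v; rewrite TE v1; lra.
by rewrite leNgt ltrBlDr ltrDl invr_gt0 K0.
Qed.

Lemma rayleigh_ge n (S : 'M[R]_n) (m : R) : (0 < n)%N -> S^T = S ->
  (forall a, eigenvalue S a -> m <= a) ->
  forall v : 'rV[R]_n, m * fdot v v <= sdot S v v.
Proof.
move=> n0 Ssym mlb v.
have : sdot (- S) v v <= - m * fdot v v.
  apply: rayleigh_le => //; first by rewrite linearN /= Ssym.
  move=> a /eigenvalueP [w wE wN0]; rewrite lerNr mlb //.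
  apply/eigenvalueP; exists w => //.
  by rewrite scaleNr -wE mulmxN opprK.
by rewrite /sdot mulmxN mulNmx linearN /= mulNr lerN2.
Qed.

Lemma rayleigh_le_mx n p (S : 'M[R]_n) (M : R) : (0 < n)%N -> S^T = S ->
  (forall a, eigenvalue S a -> a <= M) ->
  forall A : 'M[R]_(p, n), sdot S A A <= M * fdot A A.
Proof.
move=> n0 Ssym Mub A; rewrite fdotE !sdot_rows mulr_sumr ler_sum // => i _.
by rewrite -!sdot_row -fdotE rayleigh_le.
Qed.

Lemma rayleigh_ge_mx n p (S : 'M[R]_n) (m : R) : (0 < n)%N -> S^T = S ->
  (forall a, eigenvalue S a -> m <= a) ->
  forall A : 'M[R]_(p, n), m * fdot A A <= sdot S A A.
Proof.
move=> n0 Ssym mlb A; rewrite fdotE !sdot_rows mulr_sumr ler_sum // => i _.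
by rewrite -!sdot_row -fdotE rayleigh_ge.
Qed.

(** As [<A, A>_S = <A S, A>], Cauchy-Schwarz gives [<A, A>_S^2 <= |A S|^2 |A|^2 <= |A S|^2 <A, A>_S
    / m]. This is what bounds the gradient from below by the loss. *)
Lemma fdot_mulS_ge n p (S : 'M[R]_n) (m : R) (A : 'M[R]_(p, n)) : 0 < m ->
  m * fdot A A <= sdot S A A -> m * sdot S A A <= fdot (A *m S) (A *m S).
Proof.
move=> m0 mA.
have [Az|AN0] := eqVneq (fdot A A) 0.
  by rewrite (fdot_eq0 Az) /sdot /fdot !mul0mx linear0 mulr0.
have A_gt0 : 0 < fdot A A by rewrite lt_def AN0 fdot_ge0.
have SA : 0 < sdot S A A by apply: lt_le_trans mA; rewrite mulr_gt0.
have : sdot S A A ^+ 2 <= fdot (A *m S) (A *m S) * fdot A A.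
  have -> : sdot S A A = fdot (A *m S) A by [].
  by rewrite !fdotE sdot_CS ?trmx1 //; exact: id_psd.
have F0 := fdot_ge0 (A *m S).
move: mA SA F0; move: (sdot S A A) (fdot A A) (fdot (A *m S) _) A_gt0.
move=> a b c b0 mba a0 c0 acb.
rewrite -(ler_pM2r a0); apply: le_trans (_ : m * (c * b) <= _).
  by rewrite -mulrA -expr2 ler_pM2l.
by rewrite mulrCA ler_wpM2l.
Qed.

(** Cauchy-Schwarz for the [S]-form applied to [A] and [A S], whose [S]-product is [|A S|^2]; one
    factor [|A S|^2] then cancels. *)
Lemma fdot_mulS_le n p (S : 'M[R]_n) (M : R) (A : 'M[R]_(p, n)) : 0 < M -> S^T = S ->
  (forall v : 'rV[R]_n, 0 <= (v *m S *m v^T) 0 0) ->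
  (forall B : 'M[R]_(p, n), sdot S B B <= M * fdot B B) ->
  fdot (A *m S) (A *m S) <= M * sdot S A A.
Proof.
move=> M0 Ssym Spsd SM.
have [Az|AN0] := eqVneq (fdot (A *m S) (A *m S)) 0.
  by rewrite Az mulr_ge0 ?(ltW M0) ?sdot_ge0.
have A_gt0 : 0 < fdot (A *m S) (A *m S) by rewrite lt_def AN0 fdot_ge0.
have := sdot_CS Ssym Spsd A (A *m S).
have -> : sdot S A (A *m S) = fdot (A *m S) (A *m S) by [].
move=> /le_trans /(_ (ler_wpM2l (sdot_ge0 Spsd A) (SM (A *m S)))).
by rewrite mulrA expr2 ler_pM2r // mulrC.
Qed.

End Rayleigh.

(** * Differentiable matrix curves, Gronwall inequalities and the bootstrap principle *)

Section Calculus.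
Context {R : realType}.

(* Continuous on [D] and differentiable on [I] with derivative [g]; [D] and [I]
   stand for a closed interval and its interior. *)
Definition sdiff (D I : set R) (f g : R -> R) :=
  {within D, continuous f} /\ forall t, I t -> is_derive t 1 f (g t).

Definition mdiff (D I : set R) p n (F G : R -> 'M[R]_(p, n)) :=
  forall i j, sdiff D I (fun t => F t i j) (fun t => G t i j).

Section Domain.
Variables D I : set R.

Lemma sdiff_ext f f' g g' : f =1 f' -> (forall t, I t -> g t = g' t) ->
  sdiff D I f g -> sdiff D I f' g'.
Proof. by move=> /funext <- gg [cf df]; split=> // t It; rewrite -gg//; apply: df. Qed.

Lemma sdiff_cst c : sdiff D I (fun=> c) (fun=> 0).
Proof. by split=> [|t _]; [move=> x; exact: cvg_cst|exact: is_derive_cst]. Qed.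

Lemma sdiffD f f' g g' : sdiff D I f f' -> sdiff D I g g' ->
  sdiff D I (fun t => f t + g t) (fun t => f' t + g' t).
Proof.
move=> [cf df] [cg dg]; split=> [x|t It]; first by apply: cvgD; [exact: cf|exact: cg].
by apply: is_deriveD; [exact: df|exact: dg].
Qed.

Lemma sdiffM f f' g g' : sdiff D I f f' -> sdiff D I g g' ->
  sdiff D I (fun t => f t * g t) (fun t => f' t * g t + f t * g' t).
Proof.
move=> [cf df] [cg dg]; split=> [x|t It]; first by apply: cvgM; [exact: cf|exact: cg].
apply: is_derive_eq (is_deriveM (df t It) (dg t It)) _.
by rewrite /GRing.scale /= addrC mulrC.
Qed.

Lemma sdiffZ c f f' : sdiff D I f f' -> sdiff D I (fun t => c * f t) (fun t => c * f' t).
Proof.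
move=> df; apply: sdiff_ext (sdiffM (sdiff_cst c) df) => // t _.
by rewrite mul0r add0r.
Qed.

Lemma sdiff_sum n (f g : 'I_n -> R -> R) : (forall i, sdiff D I (f i) (g i)) ->
  sdiff D I (fun t => \sum_i f i t) (fun t => \sum_i g i t).
Proof.
elim: n f g => [|n IH] f g fg.
  by apply: sdiff_ext (sdiff_cst 0) => t; rewrite big_ord0.
have := sdiffD (IH (fun i => f (widen_ord (leqnSn n) i))
                  (fun i => g (widen_ord (leqnSn n) i)) (fun i => fg _)) (fg ord_max).
by apply: sdiff_ext => t; rewrite big_ord_recr.
Qed.

Lemma sdiff_expR f f' : sdiff D I f f' ->
  sdiff D I (fun t => expR (f t)) (fun t => f' t * expR (f t)).
Proof.
move=> [cf df]; split=> [x|t It].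
  apply: (@continuous_comp _ _ _ (from_subspace D f) expR x); first exact: cf.
  exact: continuous_expR.
rewrite mulrC; exact: (is_derive1_comp (is_derive_expR (f t)) (df t It)).
Qed.

Lemma sdiff_id : sdiff D I id (fun=> 1).
Proof.
split=> [|t _]; last exact: is_derive_id.
by apply: continuous_subspaceT => x; exact: cvg_id.
Qed.

Lemma sdiff_expRZ c : sdiff D I (fun t => expR (c * t)) (fun t => c * expR (c * t)).
Proof.
by apply: sdiff_ext (sdiff_expR (sdiffZ c sdiff_id)) => // t _; rewrite mulr1.
Qed.

Section Matrices.
Variables p n : nat.
Implicit Types F G : R -> 'M[R]_(p, n).

Lemma mdiff_ext F F' G G' : F =1 F' -> (forall t, I t -> G t = G' t) ->
  mdiff D I F G -> mdiff D I F' G'.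
Proof.
move=> FF GG FG i j.
by apply: sdiff_ext (FG i j) => [t|t It]; rewrite ?FF // GG.
Qed.

Lemma mdiff_cst (A : 'M[R]_(p, n)) : mdiff D I (fun=> A) (fun=> 0).
Proof. by move=> i j; apply: sdiff_ext (sdiff_cst (A i j)) => // t _; rewrite mxE. Qed.

Lemma mdiffD F F' G G' : mdiff D I F F' -> mdiff D I G G' ->
  mdiff D I (fun t => F t + G t) (fun t => F' t + G' t).
Proof.
by move=> dF dG i j; apply: sdiff_ext (sdiffD (dF i j) (dG i j)) => t *; rewrite mxE.
Qed.

Lemma mdiffZ c F F' : mdiff D I F F' -> mdiff D I (fun t => c *: F t) (fun t => c *: F' t).
Proof. by move=> dF i j; apply: sdiff_ext (sdiffZ c (dF i j)) => t *; rewrite mxE. Qed.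

Lemma mdiffN F F' : mdiff D I F F' -> mdiff D I (fun t => - F t) (fun t => - F' t).
Proof. by move=> dF; apply: mdiff_ext (mdiffZ (-1) dF) => t *; rewrite scaleN1r. Qed.

Lemma mdiffB F F' G G' : mdiff D I F F' -> mdiff D I G G' ->
  mdiff D I (fun t => F t - G t) (fun t => F' t - G' t).
Proof. by move=> dF dG; apply: mdiffD dF (mdiffN dG). Qed.

Lemma mdiff_tr F F' : mdiff D I F F' -> mdiff D I (fun t => (F t)^T) (fun t => (F' t)^T).
Proof. by move=> dF i j; apply: sdiff_ext (dF j i) => t *; rewrite mxE. Qed.

End Matrices.

Lemma mdiffM p q n (F F' : R -> 'M[R]_(p, q)) (G G' : R -> 'M[R]_(q, n)) :
  mdiff D I F F' -> mdiff D I G G' ->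
  mdiff D I (fun t => F t *m G t) (fun t => F' t *m G t + F t *m G' t).
Proof.
move=> dF dG i j.
apply: sdiff_ext (sdiff_sum (fun k => sdiffM (dF i k) (dG k j))) => t *.
  by rewrite mxE.
by rewrite !mxE -big_split.
Qed.

Lemma sdiff_trace n (F F' : R -> 'M[R]_n) : mdiff D I F F' ->
  sdiff D I (fun t => \tr (F t)) (fun t => \tr (F' t)).
Proof. by move=> dF; apply: sdiff_sum => i; apply: dF. Qed.

Lemma sdiff_sdot n p (S : 'M[R]_n) (F F' : R -> 'M[R]_(p, n)) : S^T = S ->
  mdiff D I F F' ->
  sdiff D I (fun t => sdot S (F t) (F t)) (fun t => 2 * sdot S (F' t) (F t)).
Proof.
move=> Ssym dF.
have := sdiff_trace (mdiffM (mdiffM dF (mdiff_cst S)) (mdiff_tr dF)).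
apply: sdiff_ext => // t _; rewrite mulmx0 addr0 raddfD /=.
rewrite -![\tr (_ *m _ *m _)]/(sdot S _ _) (sdotC Ssym (F t)); ring.
Qed.

Lemma sdiff_fdot n p (F F' : R -> 'M[R]_(p, n)) :
  mdiff D I F F' ->
  sdiff D I (fun t => fdot (F t) (F t)) (fun t => 2 * fdot (F' t) (F t)).
Proof.
move=> dF; have := sdiff_sdot (trmx1 R n) dF.
by apply: sdiff_ext => [t|t _]; rewrite -fdotE.
Qed.

Variables a b : R.
Hypotheses (ab : a <= b) (subD : `[a, b] `<=` D) (subI : `]a, b[ `<=` I).

Lemma sdiff_noninc f g : sdiff D I f g -> (forall t, a < t < b -> g t <= 0) ->
  f b <= f a.
Proof.
move=> [cf df] g0; move: ab; rewrite le_eqVlt => /orP[/eqP -> //|altb].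
have [] := @MVT R f g a b altb.
- by move=> x xab; apply: df; apply: subI.
- exact: continuous_subspaceW subD cf.
move=> c cab e.
by rewrite -subr_le0 e mulr_le0_ge0 ?subr_ge0 // g0.
Qed.

Lemma sdiff_le f f' g g' : sdiff D I f f' -> sdiff D I g g' ->
  (forall t, a < t < b -> f' t <= g' t) -> f b - f a <= g b - g a.
Proof.
move=> df dg h.
have H t : a < t < b -> f' t + -1 * g' t <= 0 by move=> /h; rewrite mulN1r subr_le0.
have := sdiff_noninc (sdiffD df (sdiffZ (-1) dg)) H; lra.
Qed.

(** The spectral norm is not differentiable, so the increment is tested against itself: with
    [w = (F b - F a) v], the scalar function [<F t v, w>] grows at most like [|v| |w| h], and its
    total increment is [|w|^2]. *)
Lemma mdiff_spec_le d (F G : R -> 'M[R]_d) h k : mdiff D I F G -> sdiff D I h k ->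
  (forall t, a < t < b -> spec_norm (G t) <= k t) ->
  spec_norm (F b - F a) <= h b - h a.
Proof.
move=> dF dh Gk.
have hab : 0 <= h b - h a.
  have := sdiff_le (sdiff_cst 0) dh; rewrite subrr; apply => t /Gk.
  exact/le_trans/spec_ge0.
apply: spec_le => // v; set w := (F b - F a) *m v.
have [->|wN0] := eqVneq (fro w) 0; first by rewrite mulr_ge0 ?fro_ge0.
have w0 : 0 < fro w by rewrite lt_def wN0 fro_ge0.
have dphi : sdiff D I (fun t => fdot (F t *m v) w) (fun t => fdot (G t *m v) w).
  have := sdiff_trace (mdiffM (mdiffM dF (mdiff_cst v)) (mdiff_cst w^T)).
  by apply: sdiff_ext => // t _; rewrite !mulmx0 !addr0.
have := sdiff_le dphi (sdiffZ (fro v * fro w) dh).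
have -> : fdot (F b *m v) w - fdot (F a *m v) w = fro w * fro w.
  rewrite -expr2 fro_sqr {3}/w mulmxBl fdotDl; congr (_ + _).
  by rewrite -[- (F a *m v)]scaleN1r fdotZl mulN1r.
rewrite -mulrBr -mulrA [_ * (_ - _)]mulrC mulrA (ler_pM2r w0) [in X in _ -> X]mulrC.
apply => t /Gk GK; rewrite (le_trans (fdot_le _ _)) // mulrAC.
rewrite ler_wpM2r ?fro_ge0 // (le_trans (spec_mulv _ _)) // mulrC.
by rewrite ler_wpM2l ?fro_ge0.
Qed.

(** Used with both signs of [c]: negative for the decay of the loss, positive for uniqueness in the
    ODE. *)
Lemma gronwall_exp f g c : sdiff D I f g ->
  (forall t, a < t < b -> g t <= c * f t) -> f b <= f a * expR (c * (b - a)).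
Proof.
move=> df gf.
have := sdiff_noninc (sdiffM df (sdiff_expRZ (- c))).
rewrite /= => H.
have := H _; rewrite -ler_pdivlMr ?expR_gt0 // -expRN !mulNr opprK -mulrA -expRD.
rewrite mulrBr [c * b - _]addrC; apply => t /gf h.
rewrite mulrA -mulrDl pmulr_lle0 ?expR_gt0 //; lra.
Qed.

(** The integrating factor is [exp ((c / mu) e^(- mu t))], whose exponent has derivative
    [- c e^(- mu t)]. It stays between 1 and [exp (c / mu)], hence a bound that does not grow with
    [b]. *)
Lemma gronwall_decay f g c mu : sdiff D I f g -> 0 < mu -> 0 <= c -> 0 <= a ->
  0 <= f b -> 0 <= f a ->
  (forall t, a < t < b -> g t <= c * expR (- mu * t) * f t) ->
  f b <= f a * expR (c / mu).
Proof.
move=> df mu0 c0 a0 fb0 fa0 gf.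
have := sdiff_noninc (sdiffM df (sdiff_expR (sdiffZ (c / mu) (sdiff_expRZ (- mu))))).
rewrite /= => H.
have H1 : f b <= f b * expR (c / mu * expR (- mu * b)).
  by rewrite ler_peMr // -expR0 ler_expR mulr_ge0 ?expR_ge0 // divr_ge0 // ltW.
apply: (le_trans H1); apply: (le_trans (H _)) => [t /gf h|].
  rewrite !mulrA -mulrDl pmulr_lle0 ?expR_gt0 //.
  have -> : f t * c / mu * - mu * expR (- mu * t) = - (c * expR (- mu * t) * f t).
    by field; rewrite gt_eqF.
  by rewrite subr_le0.
rewrite ler_wpM2l // ler_expR ler_piMr ?divr_ge0 ?(ltW mu0) //.
by rewrite -expR0 ler_expR mulNr oppr_le0 mulr_ge0 // ltW.
Qed.

End Domain.

(** [P] is the bound assumed strictly before [t], [Q] the better bound that it implies at [t], and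
    [Q] leaves room for [P] a little longer. The times up to which [P] holds therefore cannot have a
    finite supremum. *)
Lemma continuous_induction (P Q : R -> Prop) :
  (forall t, 0 <= t -> (forall s, 0 <= s < t -> P s) -> Q t) ->
  (forall t, 0 <= t -> Q t -> exists2 e, 0 < e & forall s, t <= s < t + e -> P s) ->
  forall t, 0 <= t -> Q t.
Proof.
move=> PQ QP t0 t0ge0; apply: (PQ) => // s0 /andP[s00 s0t0].
pose S := [set t | 0 <= t /\ forall s, 0 <= s < t -> P s].
have S0 : S 0 by split=> // s; case: ltgtP.
have [hs|nhs] := pselect (has_ubound S); last first.
  have [//|nP] := pselect (P s0); exfalso.
  apply: nhs; exists s0 => t [t_ge0 tP]; rewrite leNgt; apply/negP => lt.
  by apply: nP; apply: tP; rewrite s00.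
pose T := sup S.
have T0 : 0 <= T by apply: ub_le_sup.
have TP s : 0 <= s < T -> P s.
  move=> /andP[s_ge0 sT].
  have [|t [t_ge0 tP] st] := @sup_gt _ S s _ sT; first by exists 0.
  by apply: tP; rewrite s_ge0.
have [e e0 eP] := QP T T0 (PQ T T0 TP).
have : S (T + e).
  split=> [|s /andP[s_ge0 sT]]; first by rewrite addr_ge0 // ltW.
  have [sT'|Ts] := ltP s T; first by apply: TP; rewrite s_ge0.
  by apply: eP; rewrite Ts.
by move=> /(ub_le_sup hs); rewrite leNgt ltrDl e0.
Qed.

End Calculus.

(** * Products of residual layers, their conditioning, and the gradient of the loss *)

Section Products.
Context {R : realType} {d : nat}.
Implicit Types (th : nat -> 'M[R]_d) (A B : 'M[R]_d).

Definition layer (N : nat) A : 'M[R]_d := 1%:M + (N%:R)^-1 *: A.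

(* The factors [n + 1, ..., k] of the product. *)
Definition segp (N : nat) th (n k : nat) : 'M[R]_d :=
  piprod N (fun i => th (n + i)%N) (k - n).

Lemma piprodS N th k : piprod N th k.+1 = layer N (th k.+1) *m piprod N th k.
Proof. by []. Qed.

Lemma eq_piprod N th th' k : (forall i, (1 <= i <= k)%N -> th i = th' i) ->
  piprod N th k = piprod N th' k.
Proof.
elim: k => // k IH e; rewrite !piprodS e ?leqnn // IH // => i /andP[i1 ik].
by rewrite e // i1 ltnW.
Qed.

Lemma segpp N th n : segp N th n n = 1%:M.
Proof. by rewrite /segp subnn. Qed.

Lemma segpS N th n k : (n <= k)%N -> segp N th n k.+1 = layer N (th k.+1) *m segp N th n k.
Proof. by move=> nk; rewrite /segp subSn // piprodS addnS subnKC. Qed.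

Lemma eq_segp N th th' n k : (n <= k)%N -> (forall i, (n < i <= k)%N -> th i = th' i) ->
  segp N th n k = segp N th' n k.
Proof. by move=> nk e; apply: eq_piprod => i ik; apply: e; lia. Qed.

Lemma segp_cat N th n k : (n <= k)%N -> segp N th n k *m piprod N th n = piprod N th k.
Proof.
elim: k => [|k IH]; first by rewrite leqn0 => /eqP->; rewrite segpp mulmx1.
rewrite leq_eqVlt => /orP[/eqP->|]; first by rewrite segpp mul1mx.
by move=> nk; rewrite segpS // -mulmxA IH.
Qed.

Lemma segp_recl N th n k : (n < k)%N -> segp N th n k = segp N th n.+1 k *m layer N (th n.+1).
Proof.
elim: k => // k IH; rewrite ltnS leq_eqVlt => /orP[/eqP->|nk].
  by rewrite segpS // !segpp mulmx1 mul1mx.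
by rewrite segpS ?(ltnW nk) // IH // mulmxA -segpS.
Qed.

(** Lower bounds on singular values, stated without inverses. The version for [A^T] is included
    because the gradient multiplies by transposes on both sides. *)
Definition bnd (c C : R) A :=
  [/\ spec_norm A <= C, forall v : 'cV[R]_d, c * fro v <= fro (A *m v)
    & forall v : 'cV[R]_d, c * fro v <= fro (A^T *m v)].

Lemma bnd1 : bnd 1 1 1%:M.
Proof. by split=> [|v|v]; rewrite ?spec1 // ?trmx1 mul1mx mul1r. Qed.

Lemma bndM c c' C C' A B : 0 <= c -> 0 <= c' -> bnd c C A -> bnd c' C' B ->
  bnd (c * c') (C * C') (A *m B).
Proof.
move=> c0 c0' [AC Ac At] [BC Bc Bt]; split=> [|v|v].
- by rewrite (le_trans (specM _ _)) // ler_pM ?spec_ge0.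
- by rewrite -mulmxA (le_trans _ (Ac _)) // -mulrA ler_wpM2l.
- by rewrite trmx_mul -mulmxA (le_trans _ (Bt _)) // mulrAC mulrC ler_wpM2l // mulrC.
Qed.

(** Lower and upper singular value bounds of one layer [I + A / N] with [|A| <= 1/2]. *)
Definition lo (N : nat) : R := 1 - (2 * N%:R)^-1.
Definition hi (N : nat) : R := 1 + (2 * N%:R)^-1.

Lemma natr_ge1 N : (1 <= N)%N -> 1 <= N%:R :> R.
Proof. by rewrite ler1n. Qed.

Lemma lo_ge N : (1 <= N)%N -> 2^-1 <= lo N.
Proof.
move=> N1; have n1 := natr_ge1 N1; rewrite /lo.
have : (2 * N%:R)^-1 <= 2^-1 :> R by rewrite lef_pV2 ?posrE; lra.
lra.
Qed.

Lemma lo_ge0 N : (1 <= N)%N -> 0 <= lo N.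
Proof. by move=> /lo_ge; lra. Qed.

Lemma lo_le1 N : lo N <= 1.
Proof. by rewrite /lo gerBl invr_ge0 mulr_ge0. Qed.

Lemma layer_bnd N A : (1 <= N)%N -> spec_norm A <= 2^-1 -> bnd (lo N) (hi N) (layer N A).
Proof.
move=> N1; have n1 := natr_ge1 N1.
have h (B : 'M[R]_d) : spec_norm B <= 2^-1 ->
    spec_norm ((N%:R)^-1 *: B) <= (2 * N%:R)^-1.
  move=> B2; rewrite (le_trans (specZ _ _)) // ger0_norm ?invr_ge0 //.
  by rewrite invfM mulrC ler_wpM2r // invr_ge0.
have l (B : 'M[R]_d) (v : 'cV[R]_d) : spec_norm B <= 2^-1 -> lo N * fro v <= fro (layer N B *m v).
  move=> /h B2; rewrite /lo mulrBl mul1r lerBlDr.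
  have {1}-> : v = layer N B *m v + (- ((N%:R)^-1 *: B)) *m v.
    by rewrite /layer mulmxDl mul1mx mulNmx addrK.
  rewrite (le_trans (froD _ _)) // lerD2l (le_trans (spec_mulv _ _)) // specN.
  by rewrite ler_wpM2r ?fro_ge0.
move=> A2; split=> [|v|v].
- by rewrite (le_trans (specD _ _)) // lerD ?spec1 ?h.
- exact: l.
- have -> : (layer N A)^T = layer N A^T by rewrite /layer linearD linearZ /= trmx1.
  by apply: l; rewrite spec_tr.
Qed.

Lemma piprod_bnd N th k : (1 <= N)%N ->
  (forall i, (1 <= i <= k)%N -> spec_norm (th i) <= 2^-1) ->
  bnd (lo N ^+ k) (hi N ^+ k) (piprod N th k).
Proof.
move=> N1; elim: k => [_|k IH h]; first exact: bnd1.
rewrite piprodS !exprS; apply: bndM; rewrite ?exprn_ge0 ?lo_ge0 //.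
  by apply: layer_bnd => //; apply: h; rewrite leqnn.
by apply: IH => i /andP[i1 ik]; apply: h; rewrite i1 ltnW.
Qed.

Lemma segp_bnd N th n k : (1 <= N)%N ->
  (forall i, (n < i <= k)%N -> spec_norm (th i) <= 2^-1) ->
  bnd (lo N ^+ (k - n)) (hi N ^+ (k - n)) (segp N th n k).
Proof. by move=> N1 h; apply: piprod_bnd => // i ik; apply: h; lia. Qed.

(** The limit of [hi N ^+ N], which bounds every product of at most [N] layers. *)
Definition gam : R := expR 2^-1.

Lemma gam_ge1 : 1 <= gam.
Proof. by rewrite -expR0 ler_expR invr_ge0. Qed.

Lemma hi_exp N k : (1 <= N)%N -> (k <= N)%N -> hi N ^+ k <= gam.
Proof.
move=> N1 kN; have n1 := natr_ge1 N1.
apply: (@le_trans _ _ (expR (2 * N%:R)^-1 ^+ k)).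
  by rewrite lerXn2r ?nnegrE ?expR_ge0 ?expR_ge1Dx // addr_ge0 // invr_ge0 mulr_ge0.
rewrite -expRM_natr ler_expR mulrC invfM mulrCA -[leRHS]mulr1.
rewrite ler_wpM2l ?invr_ge0 // ler_pdivrMr ?mul1r ?ler_nat //; lra.
Qed.

(** [1 / lo N = 1 + 1 / (2 N - 1) <= exp (1 / (2 N - 1))], and [(N - 1) / (2 N - 1) <= 1/2]. The
    exponent is [N - 1] because a gradient omits exactly one layer; for [lo N ^+ N] this bound would
    be false. *)
Lemma lo_exp N : (1 <= N)%N -> expR (- 2^-1) <= lo N ^+ N.-1.
Proof.
move=> N1; have n1 := natr_ge1 N1.
have [e1 n10] : N.-1%:R = N%:R - 1 :> R /\ 0 <= N.-1%:R :> R.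
  by case: N N1 {n1} => // n _; rewrite -natr1 addrK.
apply: (@le_trans _ _ (expR (- (2 * N%:R - 1)^-1) ^+ N.-1)).
  rewrite -expRM_natr ler_expR mulNr lerN2 mulrC ler_pdivrMr; last by lra.
  rewrite e1; lra.
rewrite lerXn2r ?nnegrE ?expR_ge0 ?lo_ge0 // expRN.
have l0 : 0 < lo N by have := lo_ge N1; lra.
rewrite -[lo N]invrK lef_pV2 ?posrE ?invr_gt0 ?expR_gt0 //.
apply: le_trans (expR_ge1Dx _).
rewrite le_eqVlt; apply/orP; left; apply/eqP.
rewrite /lo; field; do ?[apply/andP; split]; apply/eqP; lra.
Qed.

(** The factor 1/2 accounts for the one power of [lo N] that [lo_exp] leaves out. *)
Definition lowc : R := 2^-1 * expR (- 2^-1).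

Lemma lowc_gt0 : 0 < lowc. Proof. by rewrite mulr_gt0 ?expR_gt0. Qed.

Lemma lo_lowc N k : (1 <= N)%N -> (k <= N)%N -> lowc <= lo N ^+ k.
Proof.
move=> N1 kN; apply: (@le_trans _ _ (lo N ^+ N)).
  rewrite -(prednK N1) exprS ler_pM ?expR_ge0 //; rewrite ?prednK //.
  - exact: lo_ge.
  - exact: lo_exp.
by rewrite ler_wiXn2l ?lo_ge0 ?lo_le1.
Qed.

Lemma bnd_weak c C c' C' A : bnd c C A -> c' <= c -> C <= C' -> bnd c' C' A.
Proof.
move=> [A1 A2 A3] cc CC; split=> [|v|v]; first exact: le_trans CC.
- by rewrite (le_trans _ (A2 v)) // ler_wpM2r ?fro_ge0.
- by rewrite (le_trans _ (A3 v)) // ler_wpM2r ?fro_ge0.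
Qed.

Lemma fro_lbl c A (Y : 'M[R]_d) : 0 <= c ->
  (forall v : 'cV[R]_d, c * fro v <= fro (A *m v)) -> c * fro Y <= fro (A *m Y).
Proof.
move=> c0 h; rewrite -(@ler_pXn2r _ 2) ?nnegrE ?mulr_ge0 ?fro_ge0 //.
rewrite exprMn !fro_sqr [fdot Y Y]fdot_cols fdot_cols mulr_sumr ler_sum // => j _.
rewrite -!fro_sqr -exprMn ler_pXn2r ?nnegrE ?mulr_ge0 ?fro_ge0 //.
by rewrite [col j (A *m Y)]colE -mulmxA -colE h.
Qed.

(** Division by [A] on the right: an estimate of [Y *m A] becomes one of [Y]. *)
Lemma spec_lbr c A (Y : 'M[R]_d) : 0 < c ->
  (forall v : 'cV[R]_d, c * fro v <= fro (A^T *m v)) ->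
  spec_norm Y <= c^-1 * spec_norm (Y *m A).
Proof.
move=> c0 h; rewrite -(spec_tr Y) -(spec_tr (Y *m A)) trmx_mul.
apply: spec_le => [|v]; first by rewrite mulr_ge0 ?spec_ge0 // invr_ge0 ltW.
rewrite -mulrA mulrC ler_pdivlMr // mulrC (le_trans (h _)) // mulmxA.
exact: spec_mulv.
Qed.

(** For [Y = (PiN N th - B) *m Sigma] this is [N / 2] times the gradient in layer [i.+1], the layer
    that the two products leave out. *)
Definition sandwich N th i (Y : 'M[R]_d) : 'M[R]_d :=
  (segp N th i.+1 N)^T *m Y *m (piprod N th i)^T.

Section Bounded.
Variables (N : nat) (th : nat -> 'M[R]_d).
Hypothesis N1 : (1 <= N)%N.
Hypothesis th_le : forall i, (1 <= i <= N)%N -> spec_norm (th i) <= 2^-1.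

Lemma head_bnd k : (k <= N)%N -> bnd lowc gam (piprod N th k).
Proof.
move=> kN; apply: (bnd_weak (piprod_bnd N1 _)); last exact: hi_exp.
  by move=> i ik; apply: th_le; lia.
exact: lo_lowc.
Qed.

Lemma tail_bnd n : (n <= N)%N -> bnd lowc gam (segp N th n N).
Proof.
move=> nN; apply: (bnd_weak (segp_bnd N1 _)); last by apply: hi_exp => //; lia.
  by move=> i ik; apply: th_le; lia.
by apply: lo_lowc => //; lia.
Qed.

(** The two products have [N - 1] factors together, so the bound is [gam] and not [gam ^+ 2]. With
    the square, the resulting bound on the total drift of a layer would exceed 1/4. *)
Lemma sandwich_le i (Y : 'M[R]_d) : (i < N)%N ->
  fro (sandwich N th i Y) <= gam * fro Y.
Proof.
move=> iN; rewrite /sandwich.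
have [P _ _] := @segp_bnd N th i.+1 N N1 ltac:(by move=> j jN; apply: th_le; lia).
have [Q _ _] := @piprod_bnd N th i N1 ltac:(by move=> j jN; apply: th_le; lia).
rewrite (le_trans (fro_specr _ _)) // spec_tr.
have h0 k : 0 <= hi N ^+ k by rewrite exprn_ge0 // addr_ge0 // invr_ge0 mulr_ge0.
apply: (@le_trans _ _ (hi N ^+ (N - i.+1) * fro Y * hi N ^+ i)).
  apply: ler_pM; rewrite ?fro_ge0 ?spec_ge0 //.
  by rewrite (le_trans (fro_specl _ _)) // spec_tr ler_wpM2r ?fro_ge0.
rewrite mulrAC -exprD ler_wpM2r ?fro_ge0 // hi_exp //; lia.
Qed.

(** Again the [N - 1] factors are counted together: [lo_exp] gives [e^(-1/2)] for the norm, hence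
    [e^(-1)] for its square. *)
Lemma sandwich_ge i (Y : 'M[R]_d) : (i < N)%N ->
  expR (-1) * fdot Y Y <= fdot (sandwich N th i Y) (sandwich N th i Y).
Proof.
move=> iN; set F := sandwich N th i Y.
have [_ _ P] := @segp_bnd N th i.+1 N N1 ltac:(by move=> j jN; apply: th_le; lia).
have [_ Q _] := @piprod_bnd N th i N1 ltac:(by move=> j jN; apply: th_le; lia).
have l0 k : 0 <= lo N ^+ k by rewrite exprn_ge0 ?lo_ge0.
have h : expR (- 2^-1) * fro Y <= fro F.
  rewrite -(fro_tr F) trmx_mul trmxK; apply: le_trans (fro_lbl _ (l0 i) Q).
  rewrite fro_tr; apply: le_trans (ler_wpM2l (l0 i) (fro_lbl Y (l0 _) P)).
  rewrite mulrA -exprD ler_wpM2r ?fro_ge0 // (le_trans (lo_exp N1)) //.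
  by have -> : (i + (N - i.+1) = N.-1)%N by lia.
have -> : expR (-1) = expR (- 2^-1) ^+ 2 :> R.
  by rewrite -expRM_natr; congr expR; field.
by rewrite -!fro_sqr -exprMn ler_pXn2r ?nnegrE ?mulr_ge0 ?fro_ge0 ?expR_ge0.
Qed.

End Bounded.

Lemma PiN_update N th i (E : 'M[R]_d) : (i < N)%N ->
  PiN N (update th i.+1 E) =
  PiN N th + (N%:R)^-1 *: (segp N th i.+1 N *m E *m piprod N th i).
Proof.
move=> iN; rewrite /PiN -(segp_cat N _ iN) -(segp_cat N th iN) !piprodS.
have -> : segp N (update th i.+1 E) i.+1 N = segp N th i.+1 N.
  by apply: eq_segp => // j ij; rewrite /update ifN //; lia.
have -> : piprod N (update th i.+1 E) i = piprod N th i.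
  by apply: eq_piprod => j ij; rewrite /update ifN //; lia.
rewrite /layer /update eqxx scalerDr addrA mulmxDl mulmxDr; congr (_ + _).
by rewrite -!scalemxAl -scalemxAr mulmxA.
Qed.

Lemma trace_delta (A : 'M[R]_d) a b : \tr (delta_mx a b *m A) = A b a.
Proof.
rewrite -(mul_delta_mx (0 : 'I_1)) -mulmxA mxtrace_mulC -rowE -colE trace_mx11.
by rewrite !mxE.
Qed.

(** [PiN] is affine in each layer, so along a coordinate direction the residual is [X + e *: G] and
    the derivative at 0 is [2 <G, X>_Sigma]. Cyclicity of the trace then isolates [delta_mx a b]. *)
Lemma grad_entryE Sigma B N th i a b : Sigma^T = Sigma -> (i < N)%N ->
  grad_entry Sigma B N th i.+1 a b =
  (N%:R)^-1 * 2 *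
  sandwich N th i ((PiN N th - B) *m Sigma) a b.
Proof.
move=> Ssym iN; rewrite /grad_entry derive1E.
pose X := PiN N th - B.
pose G := (N%:R)^-1 *: (segp N th i.+1 N *m delta_mx a b *m piprod N th i).
have -> : (fun e : R => lossN Sigma B N (update th i.+1 (e *: delta_mx a b))) =
          (fun e => sdot Sigma (X + e *: G) (X + e *: G)).
  apply/funext => e; rewrite /lossN PiN_update // addrAC -/X.
  by rewrite -scalemxAr -scalemxAl scalerA mulrC -scalerA.
have dF : mdiff setT setT (fun e : R => X + e *: G) (fun=> G).
  move=> k l; have := sdiffD (sdiff_cst setT setT (X k l))
    (sdiffM (sdiff_id setT setT) (sdiff_cst setT setT (G k l))).
  by apply: sdiff_ext => [t|t _]; rewrite /= ?mxE ?mxE; ring.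
have [_ /(_ 0 Logic.I) D] := sdiff_sdot Ssym dF.
rewrite derive_val scale0r addr0 sdotZl [_^-1 * 2]mulrC -mulrA; congr (_ * (_ * _)).
rewrite /sdot -!mulmxA mxtrace_mulC -!mulmxA trace_delta.
have -> : sandwich N th i (X *m Sigma) a b = (sandwich N th i (X *m Sigma))^T b a.
  by rewrite [RHS]mxE.
by rewrite /sandwich !trmx_mul !trmxK Ssym !mulmxA.
Qed.

Lemma piprod_diff (D I : set R) N (th th' : nat -> R -> 'M[R]_d) k :
  (forall i, (1 <= i <= k)%N -> mdiff D I (th i) (th' i)) ->
  mdiff D I (fun t => piprod N (fun n => th n t) k)
   (fun t => \sum_(i < k) (N%:R)^-1 *:
     (segp N (fun n => th n t) i.+1 k *m th' i.+1 t *m piprod N (fun n => th n t) i)).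
Proof.
elim: k => [_|k IH dth].
  by apply: mdiff_ext (mdiff_cst D I 1%:M) => // t _; rewrite big_ord0.
have dk := IH (fun i ik => dth i ltac:(lia)).
have dl := mdiffD (mdiff_cst D I 1%:M) (mdiffZ (N%:R)^-1 (dth k.+1 ltac:(lia))).
apply: mdiff_ext (mdiffM dl dk) => // t _.
rewrite add0r big_ord_recr /= segpp mul1mx scalemxAl addrC; congr (_ + _).
rewrite mulmx_sumr; apply: eq_bigr => i _.
by rewrite segpS // -scalemxAr !mulmxA.
Qed.

End Products.

(** * Products at depth [N] against products at depth [N * k] *)

Section Compare.
Context {R : realType} {d : nat}.
Implicit Types th : nat -> 'M[R]_d.

Lemma specM_le (A B : 'M[R]_d) (a b : R) : spec_norm A <= a -> spec_norm B <= b ->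
  spec_norm (A *m B) <= a * b.
Proof. by move=> Aa Bb; rewrite (le_trans (specM _ _)) // ler_pM ?spec_ge0. Qed.

Lemma specD_le (A B : 'M[R]_d) (a b : R) : spec_norm A <= a -> spec_norm B <= b ->
  spec_norm (A + B) <= a + b.
Proof. by move=> Aa Bb; rewrite (le_trans (specD _ _)) // lerD. Qed.

Lemma specB_le (A B : 'M[R]_d) (a b : R) : spec_norm A <= a -> spec_norm B <= b ->
  spec_norm (A - B) <= a + b.
Proof. by move=> Aa Bb; rewrite (le_trans (specB _ _)) // lerD. Qed.

Lemma spec_triangle_le (A B C : 'M[R]_d) (a b : R) :
  spec_norm (A - B) <= a -> spec_norm (B - C) <= b -> spec_norm (A - C) <= a + b.
Proof. by move=> Aa Bb; rewrite (le_trans (spec_triangle _ B _)) // lerD. Qed.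

Lemma specZ_le (A : 'M[R]_d) (a b : R) : 0 <= b -> spec_norm A <= a ->
  spec_norm (b *: A) <= b * a.
Proof. by move=> b0 Aa; rewrite (le_trans (specZ _ _)) // ger0_norm // ler_wpM2l. Qed.

Lemma piprod_step N th n : (1 <= N)%N ->
  (forall i, (1 <= i <= N)%N -> spec_norm (th i) <= 2^-1) -> (n < N)%N ->
  spec_norm (piprod N th n.+1 - piprod N th n) <= gam / N%:R.
Proof.
move=> N1 th2 nN; rewrite piprodS /layer mulmxDl mul1mx addrAC subrr add0r -scalemxAl.
have [Q _ _] := head_bnd N1 th2 (ltnW nN).
rewrite mulrC; apply: specZ_le; first by rewrite invr_ge0.
have := specM_le (th2 n.+1 nN) Q.
have := @gam_ge1 R; lra.
Qed.

Section Refine.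
Variables (N k : nat) (th th' : nat -> 'M[R]_d).
Let L := (N * k)%N.
Hypotheses (N1 : (1 <= N)%N) (k1 : (1 <= k)%N).
Hypothesis th_le : forall i, (1 <= i <= N)%N -> spec_norm (th i) <= 2^-1.
Hypothesis th'_le : forall i, (1 <= i <= L)%N -> spec_norm (th' i) <= 2^-1.

(* The coarse products, interpolated affinely to the fine grid. *)
Let hat j : 'M[R]_d :=
  1%:M + (L%:R)^-1 *: \sum_(i < j) th (i %/ k).+1 *m piprod N th (i %/ k).

Let hatS j : hat j.+1 = hat j + (L%:R)^-1 *: (th (j %/ k).+1 *m piprod N th (j %/ k)).
Proof. by rewrite /hat big_ord_recr /= scalerDr addrA. Qed.

Let hat_in n r : (r <= k)%N ->
  hat (n * k + r)%N = hat (n * k)%N + (r%:R / L%:R) *: (th n.+1 *m piprod N th n).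
Proof.
elim: r => [_|r IH rk]; first by rewrite addn0 mul0r scale0r addr0.
rewrite addnS hatS IH ?(ltnW rk) // divnMDl // divn_small // addn0.
by rewrite -addrA -scalerDl -natr1 mulrDl mul1r.
Qed.

Let k0 : k%:R != 0 :> R. Proof. by rewrite pnatr_eq0; lia. Qed.
Let N0 : N%:R != 0 :> R. Proof. by rewrite pnatr_eq0; lia. Qed.

Let hat_block n : hat (n * k)%N = piprod N th n.
Proof.
elim: n => [|n IH]; first by rewrite mul0n /hat big_ord0 scaler0 addr0.
rewrite mulSnr hat_in // IH piprodS /layer mulmxDl mul1mx -scalemxAl.
have -> // : k%:R / L%:R = (N%:R)^-1 :> R.
by rewrite /L natrM; field; rewrite ?k0 ?N0.
Qed.

Let hat_close j : (j < L)%N -> spec_norm (hat j - piprod N th (j %/ k)) <= gam / N%:R.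
Proof.
move=> jL; have nN : (j %/ k < N)%N by rewrite ltn_divLR.
rewrite {1}(divn_eq j k) hat_in ?(ltnW (ltn_pmod _ _)) // hat_block addrAC subrr add0r.
have [Q _ _] := head_bnd N1 th_le (ltnW nN).
have h := specM_le (th_le (_ : (1 <= (j %/ k).+1 <= N)%N)) Q.
have g1 := @gam_ge1 R.
have c0 : 0 <= (j %% k)%:R / L%:R :> R by rewrite divr_ge0.
apply: le_trans (specZ_le c0 (h nN)) _.
apply: (@le_trans _ _ ((N%:R)^-1 * (2^-1 * gam))).
  rewrite ler_wpM2r ?mulr_ge0 ?(le_trans _ g1) //.
  rewrite /L natrM invfM mulrCA -[leRHS]mulr1 ler_wpM2l ?invr_ge0 //.
  by rewrite ler_pdivrMr ?mul1r ?ler_nat ?ltr0n // ltnW ?ltn_pmod.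
rewrite mulrC ler_wpM2r ?invr_ge0 //; lra.
Qed.

(** A mean rather than a maximum, since it is what the quadratic energy controls by
    Cauchy-Schwarz. *)
Definition mean_dist : R :=
  (L%:R)^-1 * \sum_(i < L) spec_norm (th' i.+1 - th (i %/ k).+1).

Let eta := mean_dist + (N%:R)^-1.

Lemma mean_dist_ge0 : 0 <= mean_dist.
Proof. by rewrite mulr_ge0 ?invr_ge0 // sumr_ge0 // => i _; exact: spec_ge0. Qed.

Let N1_eta : (N%:R)^-1 <= eta.
Proof. by rewrite /eta lerDr mean_dist_ge0. Qed.

Let eta_ge0 : 0 <= eta.
Proof. by rewrite (le_trans _ N1_eta) // invr_ge0. Qed.

Let L1 : (1 <= L)%N. Proof. by rewrite muln_gt0 N1. Qed.

(** A discrete Gronwall argument. Step [j] adds the layer difference times the fine product, the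
    interpolation error [hat_close], and [th / L] times the error accumulated so far; the last term
    produces the growth factor [1 + 1 / (2 L) = hi L]. *)
Let hat_compare j : (j <= L)%N ->
  spec_norm (piprod L th' j - hat j) <=
  hi L ^+ j * (\sum_(i < j) (L%:R)^-1 * (gam * (spec_norm (th' i.+1 - th (i %/ k).+1) + (N%:R)^-1))).
Proof.
have g1 := @gam_ge1 R.
elim: j => [_|j IH jL].
  by rewrite /hat !big_ord0 scaler0 addr0 subrr spec0 mulr0.
have hj := IH (ltnW jL).
rewrite big_ord_recr /=.
set s := \sum_(i < j) _ in hj *.
set a := spec_norm (th' _ - _).
have a0 : 0 <= a := spec_ge0 _.
have -> : piprod L th' j.+1 - hat j.+1 = (piprod L th' j - hat j) + (L%:R)^-1 *:
   ((th' j.+1 - th (j %/ k).+1) *m piprod L th' j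
     + th (j %/ k).+1 *m ((piprod L th' j - hat j) + (hat j - piprod N th (j %/ k)))).
  rewrite addrA subrK mulmxBl mulmxBr addrA subrK hatS piprodS /layer mulmxDl mul1mx.
  by rewrite -scalemxAl scalerBr opprD addrACA.
have nN : (j %/ k < N)%N by rewrite ltn_divLR.
have [Q _ _] := head_bnd L1 th'_le (ltnW jL).
have t1 := specM_le (lexx a) Q.
have t2 := specM_le (th_le (nN : (1 <= (j %/ k).+1 <= N)%N)) (specD_le hj (hat_close jL)).
have Li : 0 <= (L%:R)^-1 :> R by rewrite invr_ge0.
have := specD_le hj (specZ_le Li (specD_le t1 t2)).
move/le_trans; apply.
have -> : hi L ^+ j.+1 * (s + (L%:R)^-1 * (gam * (a + N%:R^-1))) =
  hi L ^+ j * s + (L%:R)^-1 * (2^-1 * (hi L ^+ j * s)) +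
  (hi L ^+ j.+1) * ((L%:R)^-1 * (gam * (a + N%:R^-1))).
  have -> : hi L ^+ j.+1 = (1 + 2^-1 * (L%:R)^-1) * hi L ^+ j :> R.
    by rewrite exprS {1}/hi invfM.
  by move: (hi L ^+ j) (L%:R)^-1 (N%:R)^-1 gam => *; ring.
rewrite -addrA lerD2l -subr_ge0.
have h1 : 1 <= hi L ^+ j.+1 :> R.
  by rewrite exprn_ege1 // /hi lerDl invr_ge0 mulr_ge0.
have Ni : 0 <= (N%:R)^-1 :> R by rewrite invr_ge0.
set x := (L%:R)^-1 in Li *; set y := hi L ^+ j.+1 in h1 *; set z := (N%:R)^-1 in Ni *.
set w := hi L ^+ j * s.
have -> : x * (2^-1 * w) + y * (x * (gam * (a + z))) - x * (a * gam + 2^-1 * (w + gam / N%:R))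
  = x * ((y - 1) * (gam * (a + z)) + 2^-1 * gam * z).
  by rewrite -/z; move: x y z w a gam {Li h1 Ni a0 t1 t2 g1} => *; field.
have g0 : 0 <= gam :> R by lra.
by rewrite mulr_ge0 // addr_ge0 // ?mulr_ge0 ?subr_ge0 ?addr_ge0.
Qed.

Lemma head_compare j : (j <= L)%N ->
  spec_norm (piprod L th' j - piprod N th (j %/ k)) <= 2 * gam ^+ 2 * eta.
Proof.
move=> jL; have g1 := @gam_ge1 R.
have h1 : spec_norm (piprod L th' j - hat j) <= gam ^+ 2 * eta.
  apply: le_trans (hat_compare jL) _; rewrite expr2 -mulrA.
  have s0 i : 0 <= (L%:R)^-1 * (gam * (spec_norm (th' i.+1 - th (i %/ k).+1) + (N%:R)^-1)).
    by rewrite !mulr_ge0 ?invr_ge0 // ?addr_ge0 ?spec_ge0 ?invr_ge0 // (le_trans _ g1).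
  apply: ler_pM.
  - by rewrite exprn_ge0 // addr_ge0 // invr_ge0 mulr_ge0.
  - by apply: sumr_ge0.
  - exact: hi_exp.
  apply: (@le_trans _ _ (\sum_(i < L) (L%:R)^-1 * (gam * (spec_norm (th' i.+1 - th (i %/ k).+1) + (N%:R)^-1)))).
    rewrite (big_ord_widen L (fun i => (L%:R)^-1 * (gam * (spec_norm (th' i.+1 - th (i %/ k).+1) + (N%:R)^-1)))) //.
    rewrite [leRHS](bigID (fun i : 'I_L => (i < j)%N)) /= lerDl.
    by apply: sumr_ge0 => i _.
  rewrite -mulr_sumr -mulr_sumr big_split /= sumr_const card_ord mulrCA.
  have L0 : L%:R != 0 :> R by rewrite pnatr_eq0; lia.
  by rewrite mulrDr -/mean_dist -[_^-1 *+ L]mulr_natl mulKf.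
have h2 : spec_norm (hat j - piprod N th (j %/ k)) <= gam / N%:R.
  move: jL; rewrite leq_eqVlt => /orP[/eqP ->|]; last exact: hat_close.
  rewrite mulnK // hat_block subrr spec0 divr_ge0 //; lra.
apply: le_trans (spec_triangle_le h1 h2) _.
have : gam / N%:R <= gam ^+ 2 * eta.
  rewrite ler_pM ?invr_ge0 //; first lra.
  by rewrite expr2 ler_peMl //; lra.
lra.
Qed.

(** With tails [S], [S'], heads [Q], [Q'] and full products [Pi], [Pi'], one has
    [(S' - S) Q' = (Pi' - Pi) - S (Q' - Q)]. Both terms on the right are differences of heads, and
    [Q'] is divided out by [spec_lbr]. *)
Lemma tail_compare j : (j < L)%N ->
  spec_norm (segp L th' j.+1 L - segp N th (j %/ k).+1 N) <=
  lowc^-1 * (5 * gam ^+ 3) * eta.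
Proof.
move=> jL; have g1 := @gam_ge1 R.
have nN : (j %/ k < N)%N by rewrite ltn_divLR.
have [_ _ Q] := head_bnd L1 th'_le jL.
have [P _ _] := tail_bnd N1 th_le nN.
apply: le_trans (spec_lbr _ (@lowc_gt0 R) Q) _.
rewrite -mulrA ler_wpM2l ?invr_ge0 ?(ltW lowc_gt0) //.
have -> : (segp L th' j.+1 L - segp N th (j %/ k).+1 N) *m piprod L th' j.+1 =
  (piprod L th' L - piprod N th (L %/ k)) -
  segp N th (j %/ k).+1 N *m
    (piprod L th' j.+1 - piprod N th (j %/ k).+1).
  rewrite mulmxBl (segp_cat L th' jL) mulmxBr (segp_cat N th nN) /L mulnK //.
  by rewrite opprB addrA subrK.
have h1 := head_compare (leqnn L).
(* The tail after fine layer [j.+1] is matched with the tail after its whole coarse block. Unless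
   the block ends there, the coarse head is one factor off. *)
have h2 : spec_norm (piprod N th (j.+1 %/ k) - piprod N th (j %/ k).+1) <= gam / N%:R.
  have [->|->] : (j.+1 %/ k = (j %/ k).+1 \/ j.+1 %/ k = j %/ k)%N.
  - rewrite divnS //; case: (k %| j.+1)%N; [left|right]; by rewrite ?add1n ?add0n.
  - by rewrite subrr spec0 divr_ge0 //; lra.
  - by rewrite spec_distC; exact: piprod_step.
have h3 := spec_triangle_le (head_compare jL) h2.
apply: le_trans (specB_le h1 (specM_le P h3)) _.
have g0 : 0 <= gam :> R by lra.
have : gam * (gam / N%:R) <= gam ^+ 3 * eta.
  rewrite mulrA -expr2 ler_pM ?invr_ge0 ?exprn_ge0 //.
  by rewrite ler_weXn2l.
have : gam ^+ 2 * eta <= gam ^+ 3 * eta by rewrite ler_wpM2r // ler_weXn2l.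
have -> : gam * (2 * gam ^+ 2 * eta + gam / N%:R) = 2 * (gam ^+ 3 * eta) + gam * (gam / N%:R).
  by ring.
lra.
Qed.

End Refine.

End Compare.

(** * Integrated estimates on the half-line of times *)

Section HalfLine.
Context {R : realType}.

Definition T0 : set R := [set t | 0 <= t].
Definition I0 : set R := [set t | 0 < t].

Lemma subT0 (a b : R) : 0 <= a -> `[a, b] `<=` T0.
Proof. by move=> a0 x /=; rewrite in_itv /= => /andP[/(le_trans a0)]. Qed.

Lemma subI0 (a b : R) : 0 <= a -> `]a, b[ `<=` I0.
Proof. by move=> a0 x /=; rewrite in_itv /= => /andP[/(le_lt_trans a0)]. Qed.

Lemma mdiff_spec_exp d (F G : R -> 'M[R]_d) (c mu t : R) : mdiff T0 I0 F G ->
  0 <= t -> 0 < mu -> 0 <= c ->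
  (forall s, 0 < s < t -> spec_norm (G s) <= c * expR (- mu * s)) ->
  spec_norm (F t - F 0) <= c / mu.
Proof.
move=> FG t0 mu0 c0 Gc.
have dh := sdiffZ (- (c / mu)) (sdiff_expRZ T0 I0 (- mu)).
apply: le_trans (mdiff_spec_le t0 (subT0 (lexx 0)) (subI0 (lexx 0)) FG dh _) _.
  move=> s /Gc /le_trans; apply; rewrite le_eqVlt; apply/orP; left; apply/eqP.
  by field; rewrite gt_eqF.
rewrite mulr0 expR0 mulr1 opprK mulNr addrC gerBl.
by rewrite mulr_ge0 ?expR_ge0 // divr_ge0 // ltW.
Qed.

Lemma mdiff_spec_lip d (F G : R -> 'M[R]_d) (c a b : R) : mdiff T0 I0 F G ->
  0 <= a -> 0 <= b -> (forall s, 0 < s -> spec_norm (G s) <= c) ->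
  spec_norm (F a - F b) <= c * `|a - b|.
Proof.
move=> FG; wlog ab : a b / b <= a => [H|] a0 b0 Gc.
  have [/H|/ltW/H] := leP b a; first exact.
  by rewrite spec_distC distrC; exact.
have := mdiff_spec_le ab (subT0 b0) (subI0 b0) FG (sdiffZ c (sdiff_id T0 I0)).
rewrite ger0_norm ?subr_ge0 // mulrBr; apply => t /andP[bt _].
by rewrite mulr1 Gc // (le_lt_trans b0 bt).
Qed.

Lemma within_continuous_right (f : R -> R) (t e : R) : {within T0, continuous f} ->
  0 <= t -> 0 < e -> exists2 h, 0 < h & forall s, t <= s < t + h -> `|f s - f t| < e.
Proof.
move=> /subspace_continuousP /(_ t) cf t0 e0.
move/cvgrPdist_lt: (cf t0) => /(_ e e0) [h /= h0 H]; exists h => // s /andP[ts sh].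
rewrite distrC; apply: H; last exact: le_trans ts.
by rewrite /ball_ /= distrC ger0_norm ?subr_ge0 // ltrBlDl.
Qed.

End HalfLine.

(** * A single depth: decay of the residual and bounds global in time *)

Section Flow.
Context {R : realType} {d : nat}.
Variables (Sigma B : 'M[R]_d) (M m : R).
Hypotheses (d0 : (0 < d)%N) (Ssym : Sigma^T = Sigma) (M0 : 0 < M) (m0 : 0 < m).
Hypothesis Mub : forall a, eigenvalue Sigma a -> a <= M.
Hypothesis mlb : forall a, eigenvalue Sigma a -> m <= a.

Lemma Sigma_ge (A : 'M[R]_d) : m * fdot A A <= sdot Sigma A A.
Proof. exact: rayleigh_ge_mx. Qed.

Lemma Sigma_le (A : 'M[R]_d) : sdot Sigma A A <= M * fdot A A.
Proof. exact: rayleigh_le_mx. Qed.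

Lemma Sigma_psd (v : 'rV[R]_d) : 0 <= (v *m Sigma *m v^T) 0 0.
Proof.
rewrite -sdot_row (le_trans _ (rayleigh_ge d0 Ssym mlb v)) //.
by rewrite mulr_ge0 ?fdot_ge0 // ltW.
Qed.

Lemma mulSigma_ge (A : 'M[R]_d) : m * sdot Sigma A A <= fdot (A *m Sigma) (A *m Sigma).
Proof. exact/fdot_mulS_ge/Sigma_ge. Qed.

Lemma mulSigma_le (A : 'M[R]_d) : fdot (A *m Sigma) (A *m Sigma) <= M * sdot Sigma A A.
Proof. exact: fdot_mulS_le Sigma_psd Sigma_le. Qed.

(** The tangent kernel in matrix form: along the flow the residual satisfies [X' = - 2 *: Kop X]. *)
Definition Kop N (th : nat -> 'M[R]_d) (Y : 'M[R]_d) : 'M[R]_d :=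
  (N%:R)^-1 *: \sum_(i < N)
    segp N th i.+1 N *m sandwich N th i (Y *m Sigma) *m piprod N th i.

(** In the [Sigma]-product each summand becomes a square: [<P F Q, Y>_Sigma = <F, P^T Y Sigma Q^T> =
    |F|^2], where [F] is the sandwich of [Y Sigma]. Then [sandwich_ge] gives [e^(-1)] and
    [mulSigma_ge] gives [m]. *)
Lemma Kop_coercive N th Y : (1 <= N)%N ->
  (forall i, (1 <= i <= N)%N -> spec_norm (th i) <= 2^-1) ->
  expR (-1) * m * sdot Sigma Y Y <= sdot Sigma (Kop N th Y) Y.
Proof.
move=> N1 th2.
have e (i : 'I_N) : sdot Sigma (segp N th i.+1 N *m sandwich N th i (Y *m Sigma)
    *m piprod N th i) Y =
    fdot (sandwich N th i (Y *m Sigma)) (sandwich N th i (Y *m Sigma)).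
  rewrite /sdot /fdot {2}/sandwich !trmx_mul !trmxK Ssym.
  by rewrite -!mulmxA mxtrace_mulC -!mulmxA.
have -> : sdot Sigma (Kop N th Y) Y = (N%:R)^-1 * \sum_(i < N)
    fdot (sandwich N th i (Y *m Sigma)) (sandwich N th i (Y *m Sigma)).
  rewrite sdotZl; congr (_ * _).
  rewrite /sdot mulmx_suml mulmx_suml raddf_sum; apply: eq_bigr => i _.
  by rewrite -e.
have N0 : 0 < N%:R :> R by rewrite ltr0n.
rewrite [leRHS]mulrC ler_pdivlMr // mulr_natr -[X in _ *+ X]card_ord -sumr_const.
apply: ler_sum => i _; apply: le_trans (sandwich_ge N1 th2 _ (ltn_ord i)).
by rewrite -mulrA ler_wpM2l ?expR_ge0 // mulSigma_ge.
Qed.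

(** The decay rate of the residual, half that of the loss: 2 comes from the residual equation,
    [m / e] from coercivity. *)
Definition mu : R := 2 * m * expR (-1).
(* [5 < sqrt 32] leaves room in the total drift: [2 * gam * Dm / mu = 1 / 5 < 1 / 4]. *)
Definition Dm : R := m / (5 * gam ^+ 3).

Lemma gam_gt0 : 0 < gam :> R. Proof. exact: expR_gt0. Qed.

Lemma mu_gt0 : 0 < mu. Proof. by rewrite !mulr_gt0 ?expR_gt0. Qed.

Lemma Dm_gt0 : 0 < Dm.
Proof. by rewrite divr_gt0 // mulr_gt0 // exprn_gt0 // gam_gt0. Qed.

Lemma gam_expR n : gam ^+ n = expR (n%:R / 2) :> R.
Proof. by rewrite /gam -expRM_natr mulrC. Qed.

Lemma drift_eq : 2 * gam * Dm / mu = 5^-1 :> R.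
Proof.
have -> : mu = 2 * m / gam ^+ 2.
  by rewrite gam_expR /mu -expRN; congr (_ * expR _); field.
by rewrite /Dm; field; rewrite !gt_eqF ?gam_gt0.
Qed.

(** [M] times the loss bounds [|X Sigma|^2], so this makes [Dm] a bound of [|X Sigma|] at time 0. As
    [gam ^+ 6 = e^3] and [4^2 * 2 = 32], the claim comes down to [1/32 <= 1/25]. *)
Lemma loss_init (l : R) : 0 <= l ->
  Num.sqrt l < m / (4 * Num.sqrt (2 * M * expR 3)) -> M * l <= Dm ^+ 2.
Proof.
move=> l0 h.
have e0 : 0 < 2 * M * expR 3 by rewrite !mulr_gt0 ?expR_gt0.
have : Num.sqrt l ^+ 2 <= (m / (4 * Num.sqrt (2 * M * expR 3))) ^+ 2.
  have hs := le_trans (sqrtr_ge0 l) (ltW h).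
  by rewrite lerXn2r ?nnegrE ?sqrtr_ge0 //; exact: ltW.
move=> h2; rewrite sqr_sqrtr // !expr_div_n !exprMn sqr_sqrtr ?(ltW e0) // in h2.
have g6 : expR 3 = gam ^+ 6 :> R by rewrite gam_expR; congr expR; field.
apply: le_trans (ler_wpM2l (ltW M0) h2) _.
rewrite /Dm g6 -subr_ge0.
have -> : (m / (5 * gam ^+ 3)) ^+ 2 - M * (m ^+ 2 / (4 ^+ 2 * (2 * M * gam ^+ 6))) =
  (25^-1 - 32^-1) * (m ^+ 2 / gam ^+ 6).
  by field; rewrite !gt_eqF ?gam_gt0.
rewrite mulr_ge0 ?divr_ge0 ?exprn_ge0 ?(ltW gam_gt0) ?(ltW m0) //; lra.
Qed.

Section OneDepth.
Variables (N : nat) (theta : nat -> R -> 'M[R]_d).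
Hypothesis N1 : (1 <= N)%N.
Hypothesis flow : is_rescaled_grad_flow Sigma B N theta.

Let th t := fun k => theta k t.
Definition Xres (th : nat -> R -> 'M[R]_d) t : 'M[R]_d := PiN N (fun k => th k t) - B.
Let X := Xres theta.

(** The rescaling by [N] cancels the [1 / N] of the gradient, so layer velocities are of order one
    at every depth. *)
Lemma theta_diff i : (i < N)%N -> mdiff T0 I0 (theta i.+1)
  (fun t => - 2 *: sandwich N (th t) i (X t *m Sigma)).
Proof.
move=> iN a b; split; first by apply: flow.1.
move=> t t0; apply: is_derive_eq (flow.2 t t0 i.+1 iN a b) _.
rewrite grad_entryE // [RHS]mxE !mulrA; congr (_ * _).
have n1 := @natr_ge1 R N N1; field; apply/eqP; lra.
Qed.

Lemma Xres_diff : mdiff T0 I0 X (fun t => - 2 *: Kop N (th t) (X t)).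
Proof.
have dth i : (1 <= i <= N)%N ->
    mdiff T0 I0 (theta i) (fun t => - 2 *: sandwich N (th t) i.-1 (X t *m Sigma)).
  by case: i => // i iN; exact: theta_diff.
have := mdiffB (piprod_diff N dth) (mdiff_cst T0 I0 B); apply: mdiff_ext => // t _.
rewrite subr0 /Kop scalerA mulrC -scalerA scaler_sumr scaler_sumr.
by apply: eq_bigr => i _; rewrite /= -scalemxAr -scalemxAl scalerA mulrC -scalerA.
Qed.

Let loss t := sdot Sigma (X t) (X t).

Hypothesis loss0 : Num.sqrt (lossN Sigma B N (th 0)) < m / (4 * Num.sqrt (2 * M * expR 3)).

(** The layer bound is assumed only strictly before [t], which is the form that
    [continuous_induction] supplies. *)
Lemma fro_XS_decay t : 0 <= t ->
  (forall s, 0 <= s < t -> forall i, (1 <= i <= N)%N -> spec_norm (theta i s) <= 2^-1) ->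
  fro (X t *m Sigma) <= Dm * expR (- mu * t).
Proof.
move=> t0 th2.
have dl := sdiff_sdot Ssym Xres_diff.
have := gronwall_exp t0 (subT0 (lexx 0)) (subI0 (lexx 0)) (c := - 2 * mu) dl.
rewrite subr0 => H.
have /H : forall s, 0 < s < t -> 2 * sdot Sigma (- 2 *: Kop N (th s) (X s)) (X s) <=
   - 2 * mu * sdot Sigma (X s) (X s).
  move=> s /andP[s0 st]; rewrite sdotZl.
  have := @Kop_coercive N (th s) (X s) N1 (th2 s _).
  rewrite (ltW s0) st => /(_ isT); rewrite /mu; lra.
rewrite -!/(loss _) => h.
apply: fro_le_sqr; first by rewrite mulr_ge0 ?expR_ge0 // ltW // Dm_gt0.
apply: (le_trans (mulSigma_le _)); rewrite exprMn -expRM_natr.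
apply: (le_trans (ler_wpM2l (ltW M0) h)); rewrite mulrA.
have -> : - mu * t * 2 = - 2 * mu * t by ring.
rewrite ler_wpM2r ?expR_ge0 // loss_init //.
exact: sdot_ge0 Sigma_psd _.
Qed.

Lemma theta_drift t i : 0 <= t ->
  (forall s, 0 <= s < t -> forall i, (1 <= i <= N)%N -> spec_norm (theta i s) <= 2^-1) ->
  (1 <= i <= N)%N -> spec_norm (theta i t - theta i 0) <= 5^-1.
Proof.
case: i => // i t0 th2 iN; rewrite -drift_eq.
have g0 := gam_gt0; have D0 := Dm_gt0.
apply: (mdiff_spec_exp (theta_diff iN) t0 mu_gt0).
  exact/ltW/(mulr_gt0 (mulr_gt0 _ g0) D0).
move=> s /andP[s0 st].
apply: le_trans (specZ _ _) _; rewrite normrN ger0_norm //.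
rewrite -[2 * gam * Dm]mulrA -[2 * _ * expR _]mulrA -[gam * Dm * _]mulrA ler_wpM2l //.
apply: le_trans (spec_le_fro _) _.
apply: le_trans (sandwich_le N1 (th2 s _) _ iN) _; first by rewrite (ltW s0).
rewrite ler_wpM2l ?(ltW g0) //; apply: fro_XS_decay; first exact: ltW.
by move=> r /andP[r0 rs]; apply: th2; rewrite r0 (lt_trans rs).
Qed.

Hypothesis theta0 : forall n, (1 <= n <= N)%N -> spec_norm (theta n 0) <= 4^-1.

Lemma theta_le_half t : 0 <= t -> forall i, (1 <= i <= N)%N -> spec_norm (theta i t) <= 2^-1.
Proof.
move=> t0 i iN.
suff h : forall i, (1 <= i <= N)%N -> spec_norm (theta i t) <= 4^-1 + 5^-1.
  by apply: le_trans (h i iN) _; lra.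
move: t t0 {i iN}; apply: (@continuous_induction _
  (fun s => forall i, (1 <= i <= N)%N -> spec_norm (theta i s) <= 2^-1)).
  move=> t t0 th2 i iN; rewrite -[theta i t](subrK (theta i 0)) addrC.
  by apply: specD_le; [exact: theta0|exact: theta_drift].
move=> t t0 Qt.
(* One continuous function controls all layers at once, so a single time step works for them all.
   The margin [20^-1] is [1/2 - (1/4 + 1/5)]. *)
pose f s := \sum_(i < N) fdot (theta i.+1 s - theta i.+1 t) (theta i.+1 s - theta i.+1 t).
have [cf _] : sdiff T0 I0 f (fun s => \sum_(i < N) 2 *
    fdot (- 2 *: sandwich N (th s) i (X s *m Sigma) - 0) (theta i.+1 s - theta i.+1 t)).
  apply: sdiff_sum => i; apply: sdiff_fdot; apply: mdiffB; last exact: mdiff_cst.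
  exact: theta_diff.
have e0 : 0 < 20^-1 ^+ 2 :> R by rewrite exprn_gt0.
have [h h0 H] := within_continuous_right cf t0 e0.
exists h => // s /H fs [//|i] iN.
have ft : f t = 0 by apply: big1 => i' _; rewrite subrr /fdot mul0mx linear0.
rewrite ft subr0 in fs.
have c : spec_norm (theta i.+1 s - theta i.+1 t) <= 20^-1.
  apply: le_trans (spec_le_fro _) _; apply: fro_le_sqr; first by rewrite invr_ge0.
  apply: le_trans (ltW (le_lt_trans (ler_norm _) fs)).
  rewrite /f (bigD1 (Ordinal iN)) //= lerDl.
  by apply: sumr_ge0 => j _; exact: fdot_ge0.
have := specD_le c (Qt i.+1 iN); rewrite subrK; lra.
Qed.

Lemma fro_XS_le t : 0 <= t -> fro (X t *m Sigma) <= Dm * expR (- mu * t).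
Proof.
by move=> t0; apply: fro_XS_decay => // s /andP[s0 _]; exact: theta_le_half.
Qed.

Lemma theta_deriv_le t i : 0 <= t -> (i < N)%N ->
  spec_norm (- 2 *: sandwich N (th t) i (X t *m Sigma)) <= 2 * gam * Dm * expR (- mu * t).
Proof.
move=> t0 iN.
apply: le_trans (specZ _ _) _; rewrite normrN ger0_norm //.
rewrite -[2 * gam * Dm]mulrA -[2 * _ * expR _]mulrA -[gam * Dm * _]mulrA ler_wpM2l //.
apply: le_trans (spec_le_fro _) _.
apply: le_trans (sandwich_le N1 (theta_le_half t0) _ iN) _.
by rewrite ler_wpM2l ?(ltW gam_gt0) // fro_XS_le.
Qed.

Lemma theta_lip t t' i : 0 <= t -> 0 <= t' -> (1 <= i <= N)%N ->
  spec_norm (theta i t - theta i t') <= 2 * gam * Dm * `|t - t'|.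
Proof.
case: i => // i t0 t0' iN; apply: (mdiff_spec_lip (theta_diff iN)) => // s s0.
apply: le_trans (theta_deriv_le (ltW s0) iN) _.
apply: ler_piMr; first exact/ltW/(mulr_gt0 (mulr_gt0 _ gam_gt0) Dm_gt0).
by rewrite -expR0 ler_expR mulNr oppr_le0 mulr_ge0 ?(ltW s0) // ltW // mu_gt0.
Qed.

(** The gradients of two neighbouring layers share the outer products [P] and [Q], and each has one
    extra layer [I + O(1/N)], on opposite sides. The identity parts cancel and leave [1 / N] times
    two terms bounded by the decaying residual. *)
Lemma neighbor_le t i C0 : 0 <= t -> (1 <= i < N)%N ->
  spec_norm (theta i.+1 0 - theta i 0) <= C0 / N%:R ->
  spec_norm (theta i.+1 t - theta i t) <= (C0 + 2 * gam ^+ 2 * Dm / mu) / N%:R.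
Proof.
case: i => // i t0 iN h0.
have dd := mdiffB (@theta_diff i.+1 iN) (@theta_diff i (ltnW iN)).
have g0 := gam_gt0; have D0 := Dm_gt0.
have Ni : 0 <= (N%:R)^-1 :> R by rewrite invr_ge0.
have c0 : 0 <= 2 * gam ^+ 2 * Dm / N%:R.
  apply: (mulr_ge0 _ Ni); apply/ltW/(mulr_gt0 _ D0).
  by rewrite mulr_gt0 // exprn_gt0.
rewrite mulrDl -[_ - theta i.+1 t](subrK (theta i.+2 0 - theta i.+1 0)) addrC.
apply: specD_le => //; rewrite mulrAC.
apply: (mdiff_spec_exp dd t0 mu_gt0 c0) => s /andP[s0 st].
have th2 := theta_le_half (ltW s0).
rewrite -scalerBr /sandwich.
set Y := X s *m Sigma; set P := segp N (th s) i.+2 N; set Q := piprod N (th s) i.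
rewrite (segp_recl N (th s) iN) piprodS -/P -/Q !trmx_mul.
have lt (A : 'M[R]_d) : (layer N A)^T = 1%:M + (N%:R)^-1 *: A^T.
  by rewrite /layer linearD linearZ /= trmx1.
have -> : P^T *m Y *m (Q^T *m (layer N (th s i.+1))^T) -
   (layer N (th s i.+2))^T *m P^T *m Y *m Q^T =
   (N%:R)^-1 *: (P^T *m Y *m Q^T *m (th s i.+1)^T - (th s i.+2)^T *m (P^T *m Y *m Q^T)).
  rewrite !lt !(mulmxDl, mulmxDr) !mul1mx !mulmx1 -!mulmxA -!scalemxAl -!scalemxAr.
  rewrite scalerBr opprD addrACA subrr add0r -scalerN.
  by rewrite scalerN.
have [Pb _ _] := tail_bnd N1 th2 iN.
have [Qb _ _] := head_bnd N1 th2 (ltnW (ltnW iN)).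
have Zb : spec_norm (P^T *m Y *m Q^T) <= gam * (Dm * expR (- mu * s)) * gam.
  apply: specM_le; last by rewrite spec_tr.
  apply: specM_le; first by rewrite spec_tr.
  exact: le_trans (spec_le_fro _) (fro_XS_le (ltW s0)).
have h1 : spec_norm (th s i.+1)^T <= 2^-1 by rewrite spec_tr; exact: (th2 i.+1 (ltnW iN)).
have h2 : spec_norm (th s i.+2)^T <= 2^-1 by rewrite spec_tr; exact: (th2 i.+2 iN).
apply: le_trans (specZ _ _) _; rewrite normrN ger0_norm //.
have := specZ_le Ni (specB_le (specM_le Zb h1) (specM_le h2 Zb)).
lra.
Qed.

End OneDepth.
End Flow.

(** * Averages over layers and the coupled energy inequality *)

Section Coupled.
Context {R : realType}.

Lemma sum_divn (V : nmodType) N k (f : nat -> V) : (0 < k)%N ->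
  \sum_(j < N * k) f (j %/ k)%N = (\sum_(n < N) f n) *+ k.
Proof.
move=> k0; elim: N => [|n IH]; first by rewrite mul0n !big_ord0 mul0rn.
rewrite mulSnr big_split_ord /= IH big_ord_recr mulrnDl; congr (_ + _).
rewrite (eq_bigr (fun=> f n)) ?sumr_const ?card_ord // => i _.
by rewrite divnMDl // divn_small // addn0.
Qed.

Lemma mean_le_sqrt n (x : nat -> R) : (0 < n)%N ->
  (n%:R)^-1 * \sum_(j < n) x j <= Num.sqrt ((n%:R)^-1 * \sum_(j < n) x j ^+ 2).
Proof.
move=> n0; have p : 0 < n%:R :> R by rewrite ltr0n.
have := fdot_le (\row_(j < n) x j) (const_mx 1 : 'rV[R]_n).
have -> : fdot (\row_(j < n) x j) (const_mx 1) = \sum_(j < n) x j.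
  by rewrite fdot_sum big_ord1; apply: eq_bigr => j _; rewrite !mxE mulr1.
have -> : fro (\row_(j < n) x j) = Num.sqrt (\sum_(j < n) x j ^+ 2).
  by rewrite /fro fdot_sum big_ord1; congr Num.sqrt; apply: eq_bigr => j _; rewrite !mxE.
have -> : fro (const_mx 1 : 'rV[R]_n) = Num.sqrt n%:R.
  rewrite /fro fdot_sum big_ord1; congr Num.sqrt.
  rewrite (eq_bigr (fun=> 1)) ?sumr_const ?card_ord // => j _; by rewrite !mxE mulr1.
move=> h; rewrite sqrtrM ?invr_ge0 ?(ltW p) // sqrtrV ?(ltW p) //.
apply: le_trans (ler_wpM2l (_ : 0 <= (n%:R)^-1) h) _; first by rewrite invr_ge0 ltW.
have s0 : Num.sqrt n%:R != 0 :> R by rewrite gt_eqF // sqrtr_gt0.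
rewrite -{1}(sqr_sqrtr (ltW p)) le_eqVlt; apply/orP; left; apply/eqP.
by field.
Qed.

(* With [z = y * e^(mu t)], both energies satisfy a Gronwall inequality with the
   integrable rate [e^(- mu t / 2)]. *)
Lemma coupled_decay (K mu eps : R) (E E' y y' eta : R -> R) :
  0 <= K -> 0 < mu -> 0 <= eps ->
  sdiff T0 I0 E E' -> sdiff T0 I0 y y' ->
  (forall t, 0 <= t -> 0 <= E t) -> (forall t, 0 <= t -> 0 <= y t) ->
  (forall t, 0 <= t -> 0 <= eta t <= Num.sqrt (E t) + eps) ->
  (forall t, 0 < t ->
     y' t <= - 2 * mu * y t + K * expR (- mu * t) * eta t * Num.sqrt (y t)) ->
  (forall t, 0 < t ->
     E' t <= K * (expR (- mu * t) * eta t + Num.sqrt (y t)) * Num.sqrt (E t)) ->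
  forall t, 0 <= t ->
  E t + expR (mu * t) * y t <=
  (E 0 + y 0 + eps ^+ 2) * expR ((K ^+ 2 / (2 * mu) + 2 * K) / (mu / 2)).
Proof.
move=> K0 mu0 eps0 dE dy E0 y0 eta0 hy hE t t0.
pose W s := E s + expR (mu * s) * y s + eps ^+ 2.
have dW : sdiff T0 I0 W (fun s => E' s + (mu * expR (mu * s) * y s + expR (mu * s) * y' s)).
  have := sdiffD (sdiffD dE (sdiffM (sdiff_expRZ T0 I0 mu) dy)) (sdiff_cst T0 I0 (eps ^+ 2)).
  by apply: sdiff_ext => // s _; rewrite addr0.
have W0 s : 0 <= s -> 0 <= W s.
  by move=> s0; rewrite /W !addr_ge0 ?mulr_ge0 ?expR_ge0 ?sqr_ge0 ?E0 ?y0.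
have mu2 : 0 < mu / 2 by lra.
have c0 : 0 <= K ^+ 2 / (2 * mu) + 2 * K.
  by rewrite addr_ge0 ?divr_ge0 ?sqr_ge0 // ?mulr_ge0 // ltW.
have -> : E 0 + y 0 + eps ^+ 2 = W 0 by rewrite /W mulr0 expR0 mul1r.
apply: (@le_trans _ _ (W t)); first by rewrite /W lerDl sqr_ge0.
apply: (gronwall_decay t0 (subT0 (lexx 0)) (subI0 (lexx 0)) dW) => //;
  rewrite ?W0 // => s /andP[s0 _].
have s0' := ltW s0.
have {}hy := hy s s0; have {}hE := hE s s0.
have /andP[e1 e2] := eta0 s s0'.
have Es := sqr_sqrtr (E0 s s0'); have ys := sqr_sqrtr (y0 s s0').
have Ep := sqrtr_ge0 (E s); have yp := sqrtr_ge0 (y s).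
rewrite /W -ys -Es; rewrite -{1}ys in hy.
(* With [b] as a variable, [e^(- mu s) = b ^+ 2]; writing [sqrt y = b q], so that
   [q ^+ 2 = e^(mu s) y], leaves a purely algebraic inequality. *)
set b := expR (- (mu / 2) * s).
have b0 : 0 < b by exact: expR_gt0.
have b1 : b <= 1 by rewrite -expR0 ler_expR mulNr oppr_le0 mulr_ge0 ?(ltW mu2).
have ea : expR (- mu * s) = b ^+ 2 by rewrite -expRM_natr; congr expR; field.
have eb : expR (mu * s) = (b ^+ 2)^-1 by rewrite -ea -expRN mulNr opprK.
rewrite ea in hy hE; rewrite eb; clear ea eb Es ys; clearbody b.
move: (Num.sqrt (E s)) (Num.sqrt (y s)) (eta s) (E' s) (y' s) b b0 b1 Ep yp e1 e2 hy hE.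
clear -K0 mu0 eps0 => e r eta E' y' b b0 b1 e0 r0 eta0 eta_le hy hE.
pose q := r / b.
have q0 : 0 <= q by rewrite divr_ge0 // ltW.
have rE : r = b * q by rewrite /q; field; rewrite gt_eqF.
have bb : b ^+ 2 <= b by rewrite expr2 ler_piMl // ltW.
have b20 : 0 < b ^+ 2 by rewrite exprn_gt0.
pose w := e ^+ 2 + q ^+ 2 + eps ^+ 2.
have w0 : 0 <= w by rewrite /w !addr_ge0 ?sqr_ge0.
have eta2 : eta ^+ 2 <= 2 * (e ^+ 2 + eps ^+ 2).
  apply: (@le_trans _ _ ((e + eps) ^+ 2)).
    by rewrite lerXn2r ?nnegrE ?addr_ge0.
  have := sqr_ge0 (e - eps); rewrite sqrrB sqrrD; lra.
(* Of the damping [- 2 mu], one [mu] pays for the weight [e^(mu t)] and the other absorbs the cross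
   term by completing the square. The remainder carries [b ^+ 2 <= b]. *)
have hz : mu * q ^+ 2 + (b ^+ 2)^-1 * y' <= K ^+ 2 / (2 * mu) * (b * w).
  have h1 : (b ^+ 2)^-1 * y' <= - 2 * mu * q ^+ 2 + K * eta * (b * q).
    rewrite mulrC ler_pdivrMr //; apply: (le_trans hy); rewrite rE.
    by rewrite le_eqVlt; apply/orP; left; apply/eqP; ring.
  have h2 : K * eta * (b * q) <= mu * q ^+ 2 + K ^+ 2 / (4 * mu) * (b ^+ 2 * eta ^+ 2).
    rewrite -subr_ge0.
    have -> : mu * q ^+ 2 + K ^+ 2 / (4 * mu) * (b ^+ 2 * eta ^+ 2) - K * eta * (b * q) =
      (mu * q - K * eta * b / 2) ^+ 2 / mu by field; rewrite gt_eqF.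
    by rewrite divr_ge0 ?sqr_ge0 // ltW.
  have h3 : K ^+ 2 / (4 * mu) * (b ^+ 2 * eta ^+ 2) <= K ^+ 2 / (2 * mu) * (b * w).
    have -> : K ^+ 2 / (2 * mu) * (b * w) = K ^+ 2 / (4 * mu) * (b * (2 * w)).
      by field; rewrite gt_eqF.
    apply: ler_wpM2l; first by rewrite divr_ge0 ?sqr_ge0 // mulr_ge0 // ltW.
    apply: ler_pM; rewrite ?sqr_ge0 //.
    apply: (le_trans eta2); rewrite /w; have := sqr_ge0 q; lra.
  apply: le_trans (_ : mu * q ^+ 2 + (- 2 * mu * q ^+ 2 + K * eta * (b * q)) <= _); first by rewrite lerD2l.
  lra.
have hE2 : E' <= 2 * K * (b * w).
  apply: (le_trans hE); rewrite rE.
  have -> : K * (b ^+ 2 * eta + b * q) * e = K * (b ^+ 2 * (eta * e) + b * (q * e)) by ring.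
  have -> : 2 * K * (b * w) = K * (2 * (b * w)) by ring.
  apply: ler_wpM2l => //.
  have h1 : eta * e <= 3 / 2 * w.
    apply: (@le_trans _ _ ((e + eps) * e)); first by rewrite ler_wpM2r.
    have := sqr_ge0 (e - eps); have := sqr_ge0 q; rewrite /w sqrrB; nra.
  have h2 : q * e <= w / 2.
    have := sqr_ge0 (q - e); have := sqr_ge0 eps; rewrite /w sqrrB; lra.
  have h3 : b ^+ 2 * (eta * e) <= b * (3 / 2 * w).
    by apply: ler_pM => //; rewrite ?mulr_ge0 // ltW.
  have h4 := ler_wpM2l (ltW b0) h2.
  lra.
have -> : mu / b ^+ 2 * r ^+ 2 = mu * q ^+ 2 by rewrite /q; field; rewrite gt_eqF.
have -> : (b ^+ 2)^-1 * r ^+ 2 = q ^+ 2 by rewrite /q expr_div_n mulrC.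
have := lerD hE2 hz; rewrite -/w; lra.
Qed.

End Coupled.

(** * Gradients and kernel operators under refinement, at a fixed time *)

Section StaticCompare.
Context {R : realType} {d : nat}.
Implicit Types (P Q Y : 'M[R]_d) (th : nat -> 'M[R]_d).

Lemma triple_compare P P' Q Q' Y Y' (g c : R) :
  spec_norm P <= g -> spec_norm Q <= g -> spec_norm P' <= g -> spec_norm Q' <= g ->
  spec_norm (P' - P) <= c -> spec_norm (Q' - Q) <= c ->
  spec_norm (P' *m Y' *m Q' - P *m Y *m Q) <=
  g ^+ 2 * spec_norm (Y' - Y) + 2 * g * c * spec_norm Y.
Proof.
move=> Pg Qg Pg' Qg' Pc Qc.
have -> : P' *m Y' *m Q' - P *m Y *m Q = P' *m (Y' - Y) *m Q' +
   ((P' - P) *m Y *m Q' + P *m Y *m (Q' - Q)).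
  by rewrite !(mulmxBl, mulmxBr) [X in _ = _ + X]addrA subrK addrA subrK.
have h1 := specM_le (specM_le Pg' (lexx (spec_norm (Y' - Y)))) Qg'.
have h2 := specM_le (specM_le Pc (lexx (spec_norm Y))) Qg'.
have h3 := specM_le (specM_le Pg (lexx (spec_norm Y))) Qc.
apply: le_trans (specD_le h1 (specD_le h2 h3)) _.
by rewrite le_eqVlt; apply/orP; left; apply/eqP; ring.
Qed.

(** The sum of the constants of [head_compare] and [tail_compare], so that one constant serves for
    both. *)
Definition cmpc : R := 2 * gam ^+ 2 + lowc^-1 * (5 * gam ^+ 3).

Lemma cmpc_ge0 : 0 <= cmpc.
Proof.
have g0 : 0 < gam :> R by exact: expR_gt0.
have l0 := @lowc_gt0 R.
by rewrite addr_ge0 ?mulr_ge0 ?invr_ge0 ?exprn_ge0 // ltW.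
Qed.

Variables (N k : nat) (th th' : nat -> 'M[R]_d).
Hypotheses (N1 : (1 <= N)%N) (k1 : (1 <= k)%N).
Hypothesis th_le : forall i, (1 <= i <= N)%N -> spec_norm (th i) <= 2^-1.
Hypothesis th'_le : forall i, (1 <= i <= N * k)%N -> spec_norm (th' i) <= 2^-1.

Let eta := mean_dist N k th th' + (N%:R)^-1.

Lemma eta_ge0 : 0 <= eta.
Proof. by rewrite addr_ge0 ?mean_dist_ge0 ?invr_ge0. Qed.

Let L1 : (1 <= N * k)%N. Proof. by rewrite muln_gt0 N1. Qed.

Lemma head_cmpc j : (j <= N * k)%N ->
  spec_norm (piprod (N * k) th' j - piprod N th (j %/ k)) <= cmpc * eta.
Proof.
move=> jL; apply: le_trans (head_compare N1 k1 th_le th'_le jL) _.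
rewrite -/eta ler_wpM2r ?eta_ge0 // lerDl.
have g0 : 0 < gam :> R by exact: expR_gt0.
have l0 := @lowc_gt0 R.
by rewrite ?mulr_ge0 ?invr_ge0 ?exprn_ge0 // ltW.
Qed.

Lemma tail_cmpc j : (j < N * k)%N ->
  spec_norm (segp (N * k) th' j.+1 (N * k) - segp N th (j %/ k).+1 N) <= cmpc * eta.
Proof.
move=> jL; apply: le_trans (tail_compare N1 k1 th_le th'_le jL) _.
rewrite -/eta ler_wpM2r ?eta_ge0 // lerDr.
have g0 : 0 < gam :> R by exact: expR_gt0.
by rewrite ?mulr_ge0 ?invr_ge0 ?exprn_ge0 // ltW.
Qed.

Lemma sandwich_compare j Y Y' : (j < N * k)%N ->
  spec_norm (sandwich (N * k) th' j Y' - sandwich N th (j %/ k) Y) <=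
  gam ^+ 2 * spec_norm (Y' - Y) + 2 * gam * (cmpc * eta) * spec_norm Y.
Proof.
move=> jL; have nN : (j %/ k < N)%N by rewrite ltn_divLR.
have [P _ _] := tail_bnd N1 th_le nN.
have [Q _ _] := head_bnd N1 th_le (ltnW nN).
have [P' _ _] := tail_bnd L1 th'_le jL.
have [Q' _ _] := head_bnd L1 th'_le (ltnW jL).
rewrite /sandwich; apply: triple_compare; rewrite ?spec_tr //.
  by rewrite -linearB /= spec_tr tail_cmpc.
by rewrite -linearB /= spec_tr head_cmpc // ltnW.
Qed.

(** Repeating each coarse summand [k] times turns both operators into means over the fine index. The
    error is proportional to [Y *m Sigma]; for [Y] the coarse residual it decays in time and becomes
    the source in the equation for the residual difference. *)
Lemma Kop_compare Sigma Y :
  spec_norm (Kop Sigma (N * k) th' Y - Kop Sigma N th Y) <=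
  4 * gam ^+ 3 * (cmpc * eta) * spec_norm (Y *m Sigma).
Proof.
have L0 : 0 < (N * k)%:R :> R by rewrite ltr0n.
have -> : Kop Sigma N th Y = ((N * k)%:R)^-1 *: \sum_(j < N * k)
    (fun n => segp N th n.+1 N *m sandwich N th n (Y *m Sigma) *m piprod N th n) (j %/ k)%N.
  rewrite (@sum_divn _ N k (fun n => segp N th n.+1 N *m sandwich N th n (Y *m Sigma)
     *m piprod N th n)) // -[(\sum_(n < N) _) *+ k]scaler_nat scalerA /Kop natrM.
  congr (_ *: _); field; rewrite !pnatr_eq0; lia.
rewrite /Kop -scalerBr -sumrB.
apply: le_trans (specZ _ _) _; rewrite ger0_norm ?invr_ge0 ?(ltW L0) //.
rewrite mulrC ler_pdivrMr //.
apply: (@le_trans _ _ (\sum_(j < N * k) (4 * gam ^+ 3 * (cmpc * eta) * spec_norm (Y *m Sigma)))).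
  elim/big_ind2: _ => [|A a A' b|j _]; [by rewrite spec0|exact: specD_le|].
  have jL := ltn_ord j; have nN : (j %/ k < N)%N by rewrite ltn_divLR.
  have [P _ _] := tail_bnd N1 th_le nN.
  have [Q _ _] := head_bnd N1 th_le (ltnW nN).
  have [P' _ _] := tail_bnd L1 th'_le jL.
  have [Q' _ _] := head_bnd L1 th'_le (ltnW jL).
  apply: le_trans (triple_compare _ _ P Q P' Q' (tail_cmpc jL) (head_cmpc (ltnW jL))) _.
  have := @sandwich_compare j (Y *m Sigma) (Y *m Sigma) jL.
  rewrite subrr spec0 mulr0 add0r => h1.
  have h2 : spec_norm (sandwich N th (j %/ k) (Y *m Sigma)) <= gam * spec_norm (Y *m Sigma) * gam.
    by rewrite /sandwich; apply: specM_le; [apply: specM_le => //|]; rewrite spec_tr.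
  have g0 : 0 <= gam :> R by exact: expR_ge0.
  have ce : 0 <= cmpc * eta by rewrite mulr_ge0 ?cmpc_ge0 ?eta_ge0.
  have p2 : 0 <= gam ^+ 2 :> R by rewrite exprn_ge0.
  have p3 : 0 <= 2 * gam * (cmpc * eta) by exact: mulr_ge0 (mulr_ge0 _ g0) ce.
  apply: le_trans (lerD (ler_wpM2l p2 h1) (ler_wpM2l p3 h2)) _.
  rewrite le_eqVlt; apply/orP; left; apply/eqP.
  by move: gam cmpc eta (spec_norm _) {h1 h2 g0 ce p2 p3 P Q P' Q'} => g c e s; ring.
by rewrite sumr_const card_ord mulr_natr.
Qed.

End StaticCompare.

(** The product [(b + a) * (q + r)] contains [a * r + b * q]; all its other terms, and those with
    [c], are nonnegative slack. *)
Lemma mix_rate (R : realType) (c a b q r s : R) : 0 <= c -> 0 <= a -> 0 <= b ->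
  0 <= q -> 0 <= r -> 0 <= s ->
  2 * s * (2 * (a * r + b * q)) <= (c + 4 * s * (b + a)) * (q + r).
Proof.
move=> c0 a0 b0 q0 r0 s0; rewrite -subr_ge0.
have -> : (c + 4 * s * (b + a)) * (q + r) - 2 * s * (2 * (a * r + b * q)) =
  c * (q + r) + 4 * (s * b * r) + 4 * (s * a * q) by ring.
have h1 : 0 <= c * (q + r) by rewrite mulr_ge0 // addr_ge0.
have h2 : 0 <= s * b * r by rewrite !mulr_ge0.
have h3 : 0 <= s * a * q by rewrite !mulr_ge0.
lra.
Qed.

Lemma combine_rate (R : realType) (a b e m s s' z : R) :
  e * m * z <= s -> - s' <= a -> 0 <= b ->
  2 * (- 2 * s + - 2 * s') <= - 2 * (2 * m * e) * z + (4 * a + b).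
Proof. lra. Qed.

(** * The flows at depths [N] and [N * k] compared for all times *)

Section Pair.
Context {R : realType} {d : nat}.
Variables (Sigma B : 'M[R]_d) (M m : R).
Hypotheses (d0 : (0 < d)%N) (Ssym : Sigma^T = Sigma) (M0 : 0 < M) (m0 : 0 < m).
Hypothesis Mub : forall a, eigenvalue Sigma a -> a <= M.
Hypothesis mlb : forall a, eigenvalue Sigma a -> m <= a.

Lemma fro_mulSigma (A : 'M[R]_d) :
  fro (A *m Sigma) <= Num.sqrt M * Num.sqrt (sdot Sigma A A).
Proof.
rewrite -sqrtrM ?(ltW M0) // ler_wsqrtr //.
exact: (mulSigma_le d0 Ssym M0 m0 Mub mlb).
Qed.

Lemma KopB N th (Y Y' : 'M[R]_d) : Kop Sigma N th (Y - Y') = Kop Sigma N th Y - Kop Sigma N th Y'.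
Proof.
rewrite /Kop -scalerBr -sumrB; congr (_ *: _); apply: eq_bigr => i _.
by rewrite /sandwich !(mulmxBl, mulmxBr).
Qed.

Let sd : R := Num.sqrt d%:R.
Let sM : R := Num.sqrt M.
Let mu := mu m.
Let Dm := Dm m.

(** The first summand is the rate that [y'_le] needs, the second the one that [E'_le] needs;
    [coupled_decay] takes a single [K]. *)
Definition Krate : R :=
  16 * sd * gam ^+ 3 * cmpc * Dm * sM + 4 * sd * (2 * gam * cmpc * Dm + gam ^+ 2 * sM).

Definition growth : R := expR ((Krate ^+ 2 / (2 * mu) + 2 * Krate) / (mu / 2)).

Variables (N k : nat) (th1 th2 : nat -> R -> 'M[R]_d).
Hypotheses (N1 : (1 <= N)%N) (k1 : (1 <= k)%N).
Hypothesis flow1 : is_rescaled_grad_flow Sigma B N th1.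
Hypothesis flow2 : is_rescaled_grad_flow Sigma B (N * k) th2.
Hypothesis loss1 : Num.sqrt (lossN Sigma B N (fun n => th1 n 0)) < m / (4 * Num.sqrt (2 * M * expR 3)).
Hypothesis loss2 : Num.sqrt (lossN Sigma B (N * k) (fun n => th2 n 0)) < m / (4 * Num.sqrt (2 * M * expR 3)).
Hypothesis init1 : forall n, (1 <= n <= N)%N -> spec_norm (th1 n 0) <= 4^-1.
Hypothesis init2 : forall n, (1 <= n <= N * k)%N -> spec_norm (th2 n 0) <= 4^-1.

Let L := (N * k)%N.
Let L1 : (1 <= L)%N. Proof. by rewrite muln_gt0 N1. Qed.

Let half1 t : 0 <= t -> forall i, (1 <= i <= N)%N -> spec_norm (th1 i t) <= 2^-1.
Proof. by move=> t0; apply: (theta_le_half d0 Ssym M0 m0 Mub mlb N1 flow1 loss1 init1 t0). Qed.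

Let half2 t : 0 <= t -> forall i, (1 <= i <= L)%N -> spec_norm (th2 i t) <= 2^-1.
Proof. by move=> t0; apply: (theta_le_half d0 Ssym M0 m0 Mub mlb L1 flow2 loss2 init2 t0). Qed.

Let X1 := Xres B N th1.
Let X2 := Xres B L th2.

Let X1le t : 0 <= t -> spec_norm (X1 t *m Sigma) <= Dm * expR (- mu * t).
Proof.
move=> t0; apply: le_trans (spec_le_fro _) _.
exact: (fro_XS_le d0 Ssym M0 m0 Mub mlb N1 flow1 loss1 init1 t0).
Qed.

Let del j t := th2 j.+1 t - th1 (j %/ k).+1 t.
Let xi t := X2 t - X1 t.
Let E t := (L%:R)^-1 * \sum_(j < L) fdot (del j t) (del j t).
Let y t := sdot Sigma (xi t) (xi t).
Let eta t := mean_dist N k (fun n => th1 n t) (fun n => th2 n t) + (N%:R)^-1.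

Let ddel j t : 'M[R]_d :=
  - 2 *: (sandwich L (fun n => th2 n t) j (X2 t *m Sigma) -
          sandwich N (fun n => th1 n t) (j %/ k) (X1 t *m Sigma)).

Let del_diff j : (j < L)%N -> mdiff T0 I0 (del j) (ddel j).
Proof.
move=> jL; have nN : (j %/ k < N)%N by rewrite ltn_divLR.
have := mdiffB (theta_diff Ssym L1 flow2 jL) (theta_diff Ssym N1 flow1 nN).
by apply: mdiff_ext => // t _; rewrite /ddel scalerBr.
Qed.

Let E_ge0 t : 0 <= E t.
Proof. by rewrite mulr_ge0 ?invr_ge0 // sumr_ge0 // => j _; exact: fdot_ge0. Qed.

Let y_ge0 t : 0 <= y t.
Proof. exact: (sdot_ge0 (Sigma_psd d0 Ssym m0 mlb)). Qed.

Let g0 : 0 <= gam :> R. Proof. exact: expR_ge0. Qed.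
Let D0 : 0 <= Dm. Proof. exact/ltW/Dm_gt0. Qed.
Let c0 : 0 <= cmpc :> R. Proof. exact: cmpc_ge0. Qed.
Let sd0 : 0 <= sd. Proof. exact: sqrtr_ge0. Qed.
Let sM0 : 0 <= sM. Proof. exact: sqrtr_ge0. Qed.
Let mu0 : 0 < mu. Proof. exact: mu_gt0. Qed.

Let eta0 t : 0 <= eta t. Proof. exact: eta_ge0. Qed.

Let mean_fro t : (L%:R)^-1 * \sum_(j < L) fro (del j t) <= Num.sqrt (E t).
Proof.
rewrite /E; under [in leRHS]eq_bigr do rewrite -fro_sqr.
exact: (mean_le_sqrt (fun j => fro (del j t))).
Qed.

Let eta_le t : eta t <= Num.sqrt (E t) + (N%:R)^-1.
Proof.
rewrite lerD2r (le_trans _ (mean_fro t)) // ler_wpM2l ?invr_ge0 //.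
by apply: ler_sum => j _; exact: spec_le_fro.
Qed.

Let ddel_le j t : 0 <= t -> (j < L)%N -> spec_norm (ddel j t) <=
  2 * (gam ^+ 2 * sM * Num.sqrt (y t) + 2 * gam * cmpc * Dm * (expR (- mu * t) * eta t)).
Proof.
move=> t0 jL; apply: le_trans (specZ _ _) _; rewrite normrN ger0_norm // ler_wpM2l //.
apply: le_trans (sandwich_compare N1 k1 (half1 t0) (half2 t0) _ _ jL) _.
rewrite -mulmxBl; apply: lerD.
  rewrite -mulrA ler_wpM2l ?exprn_ge0 //.
  exact: le_trans (spec_le_fro _) (fro_mulSigma _).
apply: le_trans (ler_wpM2l _ (X1le t0)) _; rewrite -/(eta t).
  by rewrite !mulr_ge0 ?c0 ?eta0.
rewrite le_eqVlt; apply/orP; left; apply/eqP.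
by move: (expR _) (eta t) Dm cmpc gam => *; ring.
Qed.

Let E_diff : sdiff T0 I0 E
  (fun t => (L%:R)^-1 * \sum_(j < L) 2 * fdot (ddel j t) (del j t)).
Proof. by apply/sdiffZ/sdiff_sum => j; apply: sdiff_fdot; apply: del_diff. Qed.

Let y_diff : sdiff T0 I0 y (fun t =>
  2 * sdot Sigma (- 2 *: Kop Sigma L (fun n => th2 n t) (X2 t) -
                  - 2 *: Kop Sigma N (fun n => th1 n t) (X1 t)) (xi t)).
Proof.
apply: (sdiff_sdot Ssym (mdiffB _ _)); first exact: (Xres_diff Ssym L1 flow2).
exact: (Xres_diff Ssym N1 flow1).
Qed.

Let E'_le t : 0 < t -> (L%:R)^-1 * \sum_(j < L) 2 * fdot (ddel j t) (del j t) <=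
  Krate * (expR (- mu * t) * eta t + Num.sqrt (y t)) * Num.sqrt (E t).
Proof.
move=> /ltW t0.
set U := 2 * (gam ^+ 2 * sM * Num.sqrt (y t) + 2 * gam * cmpc * Dm * (expR (- mu * t) * eta t)).
have p1 : 0 <= gam ^+ 2 * sM by rewrite mulr_ge0 ?exprn_ge0.
have p2 : 0 <= 2 * gam * cmpc * Dm by rewrite (mulr_ge0 _ D0) // !mulr_ge0.
have q1 : 0 <= expR (- mu * t) * eta t by rewrite mulr_ge0 ?expR_ge0.
have q2 := sqrtr_ge0 (y t).
have U0 : 0 <= U by rewrite mulr_ge0 // addr_ge0 ?(mulr_ge0 p1) ?(mulr_ge0 p2).
apply: (@le_trans _ _ ((L%:R)^-1 * \sum_(j < L) 2 * (sd * U * fro (del j t)))).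
  rewrite ler_wpM2l ?invr_ge0 // ler_sum // => j _; rewrite ler_wpM2l //.
  apply: le_trans (fdot_le _ _) _; rewrite ler_wpM2r ?fro_ge0 //.
  apply: le_trans (fro_le_spec _) _; rewrite ler_wpM2l //.
  exact: ddel_le.
rewrite -mulr_sumr -mulr_sumr.
have -> : (L%:R)^-1 * (2 * (sd * U * \sum_(j < L) fro (del j t))) =
  2 * sd * U * ((L%:R)^-1 * \sum_(j < L) fro (del j t)).
  by move: (\sum_(j < L) _) (L%:R)^-1 U {U0} => *; ring.
have sU0 : 0 <= 2 * sd * U by exact: mulr_ge0 (mulr_ge0 _ sd0) U0.
apply: le_trans (ler_wpM2l sU0 (mean_fro t)) _.
rewrite ler_wpM2r ?sqrtr_ge0 // /U /Krate.
have p3 : 0 <= 16 * sd * gam ^+ 3 * cmpc * Dm * sM.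
  apply: mulr_ge0 (mulr_ge0 _ D0) sM0.
  by apply: (mulr_ge0 _ c0); rewrite !mulr_ge0 ?exprn_ge0.
exact: mix_rate.
Qed.

(** With [K2], [K1] the fine and coarse operators, [K2 X2 - K1 X1 = K2 (X2 - X1) + (K2 - K1) X1].
    The first part is coercive; in the second the operator difference falls on a residual already
    known to decay. *)
Let y'_le t : 0 < t ->
  2 * sdot Sigma (- 2 *: Kop Sigma L (fun n => th2 n t) (X2 t) -
                  - 2 *: Kop Sigma N (fun n => th1 n t) (X1 t)) (xi t) <=
  - 2 * mu * y t + Krate * expR (- mu * t) * eta t * Num.sqrt (y t).
Proof.
move=> /ltW t0.
set K2 := Kop Sigma L _; set K1 := Kop Sigma N _.
have -> : - 2 *: K2 (X2 t) - - 2 *: K1 (X1 t) =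
   - 2 *: K2 (xi t) + - 2 *: (K2 (X1 t) - K1 (X1 t)).
  by rewrite /xi /K2 KopB -scalerDr -scalerBr addrA subrK.
rewrite sdotDl [sdot _ (_ *: K2 (xi t)) _]sdotZl [sdot _ (_ *: (_ - _)) _]sdotZl.
have h1 := @Kop_coercive R d Sigma m d0 Ssym m0 mlb L (fun n => th2 n t) (xi t) L1 (half2 t0).
have h2 : - sdot Sigma (K2 (X1 t) - K1 (X1 t)) (xi t) <=
   sd * (4 * gam ^+ 3 * (cmpc * eta t) * (Dm * expR (- mu * t))) * (sM * Num.sqrt (y t)).
  have -> : sdot Sigma (K2 (X1 t) - K1 (X1 t)) (xi t) =
      fdot (K2 (X1 t) - K1 (X1 t)) (xi t *m Sigma).
    by rewrite /sdot /fdot trmx_mul Ssym mulmxA.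
  apply: le_trans (ler_norm _) _; rewrite normrN; apply: le_trans (fdot_CS _ _) _.
  apply: ler_pM; rewrite ?fro_ge0 ?fro_mulSigma //.
  apply: le_trans (fro_le_spec _) _; rewrite ler_wpM2l //.
  apply: le_trans (Kop_compare N1 k1 (half1 t0) (half2 t0) Sigma (X1 t)) _.
  rewrite -/(eta t) ler_wpM2l ?X1le //.
  by rewrite mulr_ge0 // ?mulr_ge0 ?exprn_ge0 ?c0.
rewrite -/(y t) -/(K2 _) in h1.
have p2 : 0 <= 4 * sd * (2 * gam * cmpc * Dm + gam ^+ 2 * sM) * (expR (- mu * t) * eta t * Num.sqrt (y t)).
  apply: mulr_ge0; last exact: mulr_ge0 (mulr_ge0 (expR_ge0 _) (eta0 t)) (sqrtr_ge0 _).
  apply: mulr_ge0; first exact: mulr_ge0.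
  apply: addr_ge0; first exact: (mulr_ge0 (mulr_ge0 (mulr_ge0 _ g0) c0) D0).
  by apply: mulr_ge0; rewrite ?exprn_ge0.
have e1 : Krate * expR (- mu * t) * eta t * Num.sqrt (y t) =
   4 * (sd * (4 * gam ^+ 3 * (cmpc * eta t) * (Dm * expR (- mu * t))) * (sM * Num.sqrt (y t))) +
   4 * sd * (2 * gam * cmpc * Dm + gam ^+ 2 * sM) * (expR (- mu * t) * eta t * Num.sqrt (y t)).
  rewrite /Krate; move: (expR _) (eta t) (Num.sqrt _) sM Dm cmpc gam sd; clear => *; ring.
rewrite e1; exact: combine_rate h1 h2 p2.
Qed.

Lemma pair_energy t : 0 <= t ->
  E t + expR (mu * t) * y t <= (E 0 + y 0 + (N%:R)^-1 ^+ 2) * growth.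
Proof.
move=> t0.
have K0 : 0 <= Krate.
  apply: addr_ge0.
    apply: mulr_ge0 (mulr_ge0 _ D0) sM0.
    by apply: (mulr_ge0 _ c0); rewrite !mulr_ge0 ?exprn_ge0.
  apply: mulr_ge0; first exact: mulr_ge0.
  apply: addr_ge0; first exact: (mulr_ge0 (mulr_ge0 (mulr_ge0 _ g0) c0) D0).
  by apply: mulr_ge0; rewrite ?exprn_ge0.
apply: (@coupled_decay R Krate mu (N%:R)^-1 E _ y _ eta K0 mu0 _ E_diff y_diff) => //.
by move=> s _; rewrite eta0 eta_le.
Qed.

Variable Ci : R.
Hypothesis initd : forall j, (j < L)%N ->
  spec_norm (th2 j.+1 0 - th1 (j %/ k).+1 0) <= Ci / N%:R.

(** The three summands bound [E 0], [y 0] and [eps ^+ 2] in units of [1 / N^2]. *)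
Definition Cstart : R := d%:R * Ci ^+ 2 + M * (d%:R * (cmpc * (Ci + 1)) ^+ 2) + 1.
Definition Cenergy : R := Num.sqrt (Cstart * growth).
Definition Chead : R := cmpc * (Cenergy + 1).
Definition Ctheta : R :=
  Ci + 2 * (gam ^+ 2 * sM * Cenergy + 2 * gam * cmpc * Dm * (Cenergy + 1)) / (mu / 2).

Let eps : R := (N%:R)^-1.
Let eps0 : 0 <= eps. Proof. by rewrite invr_ge0. Qed.

Let L0 : 0 < L%:R :> R. Proof. by rewrite ltr0n. Qed.

Let fro_sqr_le (A : 'M[R]_d) (c : R) : spec_norm A <= c -> fdot A A <= d%:R * c ^+ 2.
Proof.
move=> Ac; have c_ge0 := le_trans (spec_ge0 A) Ac.
rewrite -fro_sqr -[d%:R]sqr_sqrtr // -exprMn.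
rewrite lerXn2r ?nnegrE ?fro_ge0 ?mulr_ge0 ?sqrtr_ge0 //.
by rewrite (le_trans (fro_le_spec A)) // ler_wpM2l ?sqrtr_ge0.
Qed.

Let mean_const (f : nat -> R) (c : R) : (forall j, (j < L)%N -> f j <= c) ->
  (L%:R)^-1 * \sum_(j < L) f j <= c.
Proof.
move=> fc; rewrite mulrC ler_pdivrMr // mulr_natr -[X in _ *+ X]card_ord -sumr_const.
by apply: ler_sum => j _; exact: fc.
Qed.

Let eta_init : eta 0 <= (Ci + 1) * eps.
Proof.
rewrite /eta mulrDl mul1r lerD2r; apply: (mean_const (f := fun j =>
  spec_norm (th2 j.+1 0 - th1 (j %/ k).+1 0))) => j jL.
exact: initd.
Qed.

Let start_le : E 0 + y 0 + eps ^+ 2 <= Cstart * eps ^+ 2.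
Proof.
rewrite /Cstart [leRHS]mulrDl [X in _ <= X + _]mulrDl mul1r lerD2r; apply: lerD.
  rewrite -mulrA -exprMn; apply: (mean_const (f := fun j => fdot (del j 0) (del j 0))) => j jL.
  by apply: fro_sqr_le; exact: initd.
apply: le_trans (Sigma_le d0 Ssym Mub _) _.
rewrite -[leRHS]mulrA -[d%:R * _ * _]mulrA -exprMn; apply: ler_wpM2l; first exact: ltW.
apply: fro_sqr_le.
have -> : xi 0 = piprod L (fun n => th2 n 0) L - piprod N (fun n => th1 n 0) (L %/ k).
  by rewrite /xi /X2 /X1 /Xres /PiN /L mulnK // opprB addrA subrK.
apply: le_trans (head_cmpc N1 k1 (half1 (lexx 0)) (half2 (lexx 0)) (leqnn L)) _.
by rewrite -/(eta 0) -mulrA ler_wpM2l.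
Qed.

Let growth0 : 0 <= growth. Proof. exact: expR_ge0. Qed.

Let CE t : 0 <= t -> E t + expR (mu * t) * y t <= Cenergy ^+ 2 * eps ^+ 2.
Proof.
move=> t0; apply: le_trans (pair_energy t0) _.
rewrite -/eps /Cenergy sqr_sqrtr; last first.
  apply: mulr_ge0 => //; apply: addr_ge0 => //; apply: addr_ge0.
    by rewrite mulr_ge0 ?sqr_ge0.
  by apply: mulr_ge0; [exact: ltW|rewrite mulr_ge0 ?sqr_ge0].
rewrite [leRHS]mulrAC ler_wpM2r //.
Qed.

Let Cen0 : 0 <= Cenergy. Proof. exact: sqrtr_ge0. Qed.

Let sqrtE_le t : 0 <= t -> Num.sqrt (E t) <= Cenergy * eps.
Proof.
move=> t0; rewrite -(@ler_pXn2r _ 2) ?nnegrE ?sqrtr_ge0 ?mulr_ge0 //.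
rewrite sqr_sqrtr // exprMn (le_trans _ (CE t0)) // lerDl.
by rewrite mulr_ge0 ?expR_ge0.
Qed.

Let sqrty_le t : 0 <= t -> Num.sqrt (y t) <= Cenergy * eps * expR (- (mu / 2) * t).
Proof.
move=> t0; rewrite -(@ler_pXn2r _ 2) ?nnegrE ?sqrtr_ge0 //; last first.
  by rewrite mulr_ge0 ?expR_ge0 // mulr_ge0.
rewrite sqr_sqrtr // exprMn -expRM_natr.
have -> : - (mu / 2) * t * 2 = - (mu * t) by move: mu => u; field.
rewrite expRN ler_pdivlMr ?expR_gt0 // exprMn mulrC (le_trans _ (CE t0)) //.
by rewrite lerDr.
Qed.

Let eta_t t : 0 <= t -> eta t <= (Cenergy + 1) * eps.
Proof.
by move=> t0; rewrite (le_trans (eta_le t)) // mulrDl mul1r lerD2r sqrtE_le.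
Qed.

Lemma pair_head t j : 0 <= t -> (j <= N * k)%N ->
  spec_norm (piprod (N * k) (fun n => th2 n t) j - piprod N (fun n => th1 n t) (j %/ k)) <=
  Chead / N%:R.
Proof.
move=> t0 jL; apply: le_trans (head_cmpc N1 k1 (half1 t0) (half2 t0) jL) _.
by rewrite -/(eta t) /Chead -mulrA ler_wpM2l // eta_t.
Qed.

(** The energy bounds the layers only in mean square, so the velocity difference of this one layer
    is integrated. Its rate is [mu / 2] because the energy yields
    [sqrt (y t) = O(e^(- mu t / 2) / N)]. *)
Lemma pair_theta t j : 0 <= t -> (j < N * k)%N ->
  spec_norm (th2 j.+1 t - th1 (j %/ k).+1 t) <= Ctheta / N%:R.
Proof.
move=> t0 jL.
pose c := 2 * (gam ^+ 2 * sM * Cenergy + 2 * gam * cmpc * Dm * (Cenergy + 1)).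
have p1 : 0 <= gam ^+ 2 * sM by rewrite mulr_ge0 ?exprn_ge0.
have p2 : 0 <= 2 * gam * cmpc * Dm by exact: (mulr_ge0 (mulr_ge0 (mulr_ge0 _ g0) c0) D0).
have Ce1 : 0 <= Cenergy + 1 by rewrite addr_ge0.
have c_ge0 : 0 <= c * eps.
  apply: mulr_ge0 => //; apply: mulr_ge0 => //.
  by apply: addr_ge0; [exact: mulr_ge0 p1 _|exact: mulr_ge0 p2 _].
have mu2 : 0 < mu / 2 by rewrite divr_gt0.
rewrite -[_ - th1 _ t](subrK (del j 0)) addrC /Ctheta mulrDl.
apply: specD_le; first exact: initd.
rewrite -/eps -/c mulrAC; apply: (mdiff_spec_exp (del_diff jL)) => // s /andP[/ltW s0 _].
apply: le_trans (ddel_le s0 jL) _.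
have -> : c * eps * expR (- (mu / 2) * s) =
  2 * (gam ^+ 2 * sM * (Cenergy * eps * expR (- (mu / 2) * s)) +
       2 * gam * cmpc * Dm * ((Cenergy + 1) * eps * expR (- (mu / 2) * s))).
  rewrite /c; move: (expR _) (gam ^+ 2 * sM) (2 * gam * cmpc * Dm) Cenergy eps; clear.
  by move=> *; ring.
apply: ler_wpM2l => //; apply: lerD.
  by apply: (ler_wpM2l p1); exact: sqrty_le.
apply: (ler_wpM2l p2); rewrite mulrC; apply: ler_pM; rewrite ?expR_ge0 ?eta0 ?eta_t //.
by rewrite ler_expR ler_wpM2r // lerN2; move: mu0; lra.
Qed.

End Pair.

(** * Limits with a rate, and the rounding of indices *)

Section Limits.
Context {R : realType}.

Lemma divn_lt_eps (C e : R) : 0 < e ->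
  exists N0 : nat, forall N, (N0 <= N)%N -> (1 <= N)%N -> C / N%:R < e.
Proof.
move=> e0; exists (Num.truncn (`|C| / e)).+1 => N N0N N1.
have n0 : 0 < N%:R :> R by rewrite ltr0n.
rewrite ltr_pdivrMr // -ltr_pdivrMl // mulrC.
apply: (@le_lt_trans _ _ (`|C| / e)); first by rewrite ler_pM2r ?invr_gt0 ?ler_norm.
have c0 : 0 <= `|C| / e by rewrite divr_ge0 // ltW.
have /andP[_ h] := truncn_itv c0.
by apply: lt_le_trans h _; rewrite ler_nat.
Qed.

(** The way finite-depth estimates reach the limit functions: every error of order [1 / N] may be
    dropped. *)
Lemma le_of_divn (x a b : R) (N0 : nat) :
  (forall N, (N0 <= N)%N -> (1 <= N)%N -> x <= a + b / N%:R) -> x <= a.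
Proof.
move=> h; apply/ler_addgt0Pr => e e0.
have [N1 H] := divn_lt_eps b e0.
have p1 : (N0 <= maxn (maxn N0 N1) 1)%N by rewrite !leq_max leqnn.
have p2 : (N1 <= maxn (maxn N0 N1) 1)%N by rewrite !leq_max leqnn orbT.
have p3 : (1 <= maxn (maxn N0 N1) 1)%N by rewrite !leq_max leqnn orbT.
by apply: le_trans (h _ p1 p3) _; rewrite lerD2l ltW // H.
Qed.

Lemma spec_cauchy_lim d (u : nat -> 'M[R]_d) (C : R) (N0 : nat) :
  (forall N N', (N0 <= N)%N -> (1 <= N)%N -> (N0 <= N')%N -> (1 <= N')%N ->
    spec_norm (u N - u N') <= C / N%:R + C / N'%:R) ->
  exists l : 'M[R]_d, forall N, (N0 <= N)%N -> (1 <= N)%N ->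
    spec_norm (l - u N) <= C / N%:R.
Proof.
move=> uC.
have cv i j : cvg ((fun n => u n i j) @ \oo).
  apply: cauchy_cvg; apply: cauchy_exP => e e0.
  have e2 : 0 < e / 2 by rewrite divr_gt0.
  have [N1 H] := divn_lt_eps C e2.
  pose N := maxn (maxn N0 N1) 1.
  exists (u N i j); exists N => // n /= Nn.
  have [p1 p2 p3] : [/\ (N0 <= N)%N, (N1 <= N)%N & (1 <= N)%N].
    by rewrite !leq_max !leqnn !orbT.
  rewrite /ball /= (le_lt_trans _ (_ : C / N%:R + C / n%:R < e)) //.
    have := uC N n p1 p3 (leq_trans p1 Nn) (leq_trans p3 Nn).
    by apply: le_trans; rewrite (le_trans _ (spec_entry _ i j)) // !mxE.
  rewrite [e]splitr ltrD // H //; first exact: leq_trans Nn.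
  exact: leq_trans Nn.
exists (\matrix_(i, j) lim ((fun n => u n i j) @ \oo)); set l := (\matrix_(i, j) _).
move=> N N0N N1.
have lcv i j : (fun n => u n i j) @ \oo --> l i j by rewrite mxE; exact: cv.
apply/ler_addgt0Pr => e e0.
(* There are [d * d] entries, and [e'] makes their sum at most [e / 2]; the successor keeps the
   denominator positive for [d = 0]. *)
pose e' := e / 2 / (d * d).+1%:R.
have e'0 : 0 < e' by rewrite !divr_gt0.
have e2 : 0 < e / 2 by rewrite divr_gt0.
have [N2 H] := divn_lt_eps C e2.
have near1 : \forall n \near \oo, forall ij : 'I_d * 'I_d, `|l ij.1 ij.2 - u n ij.1 ij.2| < e'.
  apply: filter_forall => -[i j] /=.
  by move/cvgrPdist_lt: (lcv i j); exact.
have [K _ HK] := near1.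
pose n := maxn (maxn K N2) (maxn N0 1).
have [p1 p2 p3 p4] : [/\ (K <= n)%N, (N2 <= n)%N, (N0 <= n)%N & (1 <= n)%N].
  by rewrite !leq_max !leqnn !orbT.
apply: le_trans (spec_triangle _ (u n) _) _.
have a1 : spec_norm (l - u n) <= e / 2.
  apply: le_trans (spec_le_fro _) _; apply: le_trans (fro_le_entries _) _.
  apply: (@le_trans _ _ (\sum_(i < d) \sum_(j < d) e')).
    apply: ler_sum => i _; apply: ler_sum => j _.
    by rewrite [(l - u n) i j]mxE [(- u n) i j]mxE ltW // (HK n p1 (i, j)).
  rewrite !sumr_const !card_ord -mulrnA -[e' *+ _]mulr_natr /e' -[_ / _ * _]mulrA.
  by rewrite ler_piMr ?(ltW e2) // mulrC ler_pdivrMr ?ltr0n // mul1r ler_nat.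
have a2 := uC n N p3 p4 N0N N1.
have a3 := H n p2 p4.
lra.
Qed.

Lemma is_derive_quadratic (f : R -> R) (a b s l C : R) : a < s < b ->
  (forall s', a <= s' <= b -> `|f s' - f s - (s' - s) * l| <= C * (s' - s) ^+ 2) ->
  is_derive s 1 f l.
Proof.
move=> /andP[as_ sb] H.
have cv : (fun h => h^-1 *: ((f \o shift s) (h *: 1) - f s)) @ 0^' --> l.
  apply/cvgrPdist_lt => e e0.
  pose c := `|C| + 1.
  have c0 : 0 < c by rewrite ltr_wpDl.
  pose r := Num.min (Num.min (s - a) (b - s)) (e / c).
  have r0 : 0 < r by rewrite !lt_min !subr_gt0 as_ sb divr_gt0.
  exists r => //= h; rewrite /ball_ /= sub0r normrN => hr hN0.
  have := hr; rewrite !lt_min => /andP[/andP[h1 h2] h3].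
  have hs : a <= h + s <= b.
    by move: h1 h2; rewrite !ltr_norml => /andP[? ?] /andP[? ?]; apply/andP; split; lra.
  have := H _ hs; rewrite addrK => Hh.
  have hn : 0 < `|h| by rewrite normr_gt0.
  change (`|l - h^-1 * (f (h * 1 + s) - f s)| < e).
  rewrite mulr1 distrC -(ltr_pM2r hn) -normrM mulrBl mulrAC mulVf // mul1r.
  rewrite [l * h]mulrC (le_lt_trans Hh) //.
  apply: (@le_lt_trans _ _ (c * `|h| * `|h|)).
    rewrite -mulrA -expr2 real_normK ?num_real // ler_wpM2r ?sqr_ge0 //.
    by rewrite /c (le_trans (ler_norm _)) // lerDl.
  by rewrite ltr_pM2r // mulrC -ltr_pdivlMr.
apply: DeriveDef; first by apply/cvg_ex; exists l.
exact: cvg_lim.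
Qed.

Lemma lipschitz_continuous01 (f : R -> R) (C : R) :
  (forall s s', 0 <= s <= 1 -> 0 <= s' <= 1 -> `|f s - f s'| <= C * `|s - s'|) ->
  {within `[0, 1], continuous f}.
Proof.
move=> H; apply/subspace_continuousP => s /=; rewrite in_itv /= => s01.
apply/cvgrPdist_lt => e e0.
pose c := `|C| + 1.
have c0 : 0 < c by rewrite ltr_wpDl.
exists (e / c); first by rewrite /= divr_gt0.
move=> s' /= ss' /=; rewrite in_itv /= => s'01.
apply: le_lt_trans (H _ _ s01 s'01) _.
apply: (@le_lt_trans _ _ (c * `|s - s'|)).
  by rewrite ler_wpM2r // /c (le_trans (ler_norm _)) // lerDl.
by rewrite mulrC -ltr_pdivlMr.
Qed.

(** This makes the refinement of partial products exact: at equal [s] the fine number of factors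
    divides down to the coarse one, with no index shift to pay for. *)
Lemma truncn_divn (N k : nat) (s : R) : (0 < k)%N -> 0 <= s ->
  (Num.truncn ((N * k)%:R * s) %/ k)%N = Num.truncn (N%:R * s).
Proof.
move=> k0 s0; apply/esym/eqP; rewrite truncn_eq; last by rewrite mulr_ge0.
have p : 0 < k%:R :> R by rewrite ltr0n.
have /andP[h1 h2] := @truncn_itv _ ((N * k)%:R * s) ltac:(by rewrite mulr_ge0).
set u := Num.truncn _ in h1 h2 *.
have e : (N * k)%:R * s = N%:R * s * k%:R by rewrite natrM mulrAC.
apply/andP; split.
  rewrite -(ler_pM2r p) -natrM -e (le_trans _ h1) // ler_nat leq_trunc_div //.
rewrite -(ltr_pM2r p) -natrM -e (lt_le_trans h2) // ler_nat.
by rewrite -ltn_divLR.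
Qed.

(** The layer that [psiN] reads, with index 0 replaced by 1; [psiN] is convertible to a form that
    uses it. *)
Definition nidx (N : nat) (s : R) : nat :=
  let k := Num.truncn (N%:R * s) in if k == 0%N then 1%N else k.

Lemma truncn_unit_le (N : nat) (s : R) : 0 <= s <= 1 -> (Num.truncn (N%:R * s) <= N)%N.
Proof.
move=> /andP[s0 s1].
have /andP[h1 _] := @truncn_itv _ (N%:R * s) ltac:(by rewrite mulr_ge0).
by rewrite -(ler_nat R) (le_trans h1) // ler_piMr.
Qed.

Lemma nidx_range (N : nat) (s : R) : (1 <= N)%N -> 0 <= s <= 1 -> (1 <= nidx N s <= N)%N.
Proof.
move=> N1 s01; have := truncn_unit_le N s01; rewrite /nidx.
by case: eqVneq => [_ _|]; [rewrite N1|lia].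
Qed.

Lemma nidx_diff (N : nat) (s s' : R) :
  (Num.truncn (N%:R * s) <= Num.truncn (N%:R * s'))%N ->
  (nidx N s <= nidx N s')%N /\
  (nidx N s' - nidx N s <= Num.truncn (N%:R * s') - Num.truncn (N%:R * s))%N.
Proof.
by rewrite /nidx; case: (Num.truncn _) => [|u]; case: (Num.truncn _) => [|v] //= uv; lia.
Qed.

Lemma nidx_grid (N j : nat) : (j < N)%N -> nidx N (j.+1%:R / N%:R) = j.+1.
Proof.
move=> jN; have n0 : N%:R != 0 :> R by rewrite pnatr_eq0; lia.
by rewrite /nidx mulrC divfK // natrK.
Qed.

(** Layers are numbered from 1, so a fine layer [j.+1] lies in block [(j %/ k).+1], a rounding up,
    whereas [psiN] rounds [N s] down. The two differ by at most one, which costs one neighbour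
    distance. *)
Lemma nidx_refine (N k : nat) (s : R) : (0 < k)%N -> 0 <= s ->
  nidx N s = ((nidx (N * k) s).-1 %/ k).+1 \/
  (nidx N s).+1 = ((nidx (N * k) s).-1 %/ k).+1.
Proof.
move=> k0 s0; have := @truncn_divn N k s k0 s0; rewrite /nidx.
set u := Num.truncn _; set v := Num.truncn _.
case: u => [|u] /=; first by rewrite div0n => <-; left.
rewrite divnS //; case: (k %| u.+1)%N; rewrite ?add1n ?add0n => <- /=; first by left.
by case: (u %/ k)%N => [|w] /=; [left|right].
Qed.

Lemma truncn_dist (N : nat) (s s' : R) : 0 <= s -> s <= s' ->
  (Num.truncn (N%:R * s) <= Num.truncn (N%:R * s'))%N /\
  `|(Num.truncn (N%:R * s') - Num.truncn (N%:R * s))%:R - N%:R * (s' - s)| <= 1 :> R.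
Proof.
move=> s0 ss'; have s'0 := le_trans s0 ss'.
have /andP[a1 a2] := @truncn_itv _ (N%:R * s) ltac:(by rewrite mulr_ge0).
have /andP[b1 b2] := @truncn_itv _ (N%:R * s') ltac:(by rewrite mulr_ge0).
have h : N%:R * s <= N%:R * s' by rewrite ler_wpM2l.
have le : (Num.truncn (N%:R * s) <= Num.truncn (N%:R * s'))%N.
  by rewrite -ltnS -(ltr_nat R) (le_lt_trans a1) // (le_lt_trans h).
split=> //; rewrite natrB // mulrBr.
move: a2 b2; rewrite -!natr1 => a2 b2.
by rewrite ler_norml; apply/andP; split; lra.
Qed.

End Limits.

(** * Partial products as Euler steps with quadratic local error *)

Section EulerProducts.
Context {R : realType} {d : nat}.
Variables (N : nat) (th : nat -> 'M[R]_d) (Cn : R).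
Hypotheses (N1 : (1 <= N)%N) (Cn0 : 0 <= Cn).
Hypothesis th_le : forall i, (1 <= i <= N)%N -> spec_norm (th i) <= 2^-1.
Hypothesis nbr : forall i, (1 <= i < N)%N -> spec_norm (th i.+1 - th i) <= Cn / N%:R.

Lemma layer_dist a r : (1 <= a)%N -> (a + r <= N)%N ->
  spec_norm (th (a + r)%N - th a) <= Cn * (r%:R / N%:R).
Proof.
move=> a1; elim: r => [_|r IH arN]; first by rewrite addn0 subrr spec0 mul0r mulr0.
rewrite addnS in arN *.
have h : (1 <= a + r < N)%N by rewrite arN addn_gt0 a1.
apply: le_trans (spec_triangle_le (nbr h) (IH (ltnW arN))) _.
by rewrite -natr1 mulrDl mul1r mulrDr addrC.
Qed.

Lemma head_dist a r : (a + r <= N)%N ->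
  spec_norm (piprod N th (a + r)%N - piprod N th a) <= gam * (r%:R / N%:R).
Proof.
elim: r => [_|r IH arN]; first by rewrite addn0 subrr spec0 mul0r mulr0.
rewrite addnS in arN *.
apply: le_trans (spec_triangle_le (piprod_step N1 th_le arN) (IH (ltnW arN))) _.
by rewrite -natr1 mulrDl mul1r mulrDr addrC.
Qed.

Lemma head_expand a r : (a + r <= N)%N ->
  spec_norm (piprod N th (a + r)%N - piprod N th a -
    (r%:R / N%:R) *: (th (if a == 0%N then 1%N else a) *m piprod N th a)) <=
  gam * (Cn + 1) * (r%:R / N%:R) ^+ 2.
Proof.
set a' := (if _ then _ else _).
have g1 := @gam_ge1 R.
have g0 : 0 <= gam :> R by exact: expR_ge0.
elim: r => [_|r IH arN].
  by rewrite addn0 subrr mul0r scale0r subr0 spec0 expr0n mulr0.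
rewrite addnS in arN *.
have aN : (1 <= a' <= N)%N by rewrite /a'; case: (a) arN => /=; lia.
have n0 : 0 < N%:R :> R by rewrite ltr0n.
have Ni : 0 <= (N%:R)^-1 :> R by rewrite invr_ge0 ltW.
have r0 : 0 <= r%:R / N%:R :> R by rewrite divr_ge0.
have td : spec_norm (th (a + r).+1 - th a') <= Cn * (r.+1%:R / N%:R).
  rewrite /a'; case: (a) arN => [|b] arN /=.
    apply: le_trans (@layer_dist 1 r isT arN) _.
    by rewrite ler_wpM2l // ler_wpM2r // ler_nat.
  by have := @layer_dist b.+1 r.+1 isT; rewrite addnS; apply.
have -> : piprod N th (a + r).+1 - piprod N th a - (r.+1%:R / N%:R) *: (th a' *m piprod N th a)
  = (piprod N th (a + r) - piprod N th a - (r%:R / N%:R) *: (th a' *m piprod N th a)) +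
    (N%:R)^-1 *: ((th (a + r).+1 - th a') *m piprod N th (a + r) +
                 th a' *m (piprod N th (a + r) - piprod N th a)).
  rewrite piprodS /layer mulmxDl mul1mx -scalemxAl mulmxBl mulmxBr addrA subrK.
  rewrite -natr1 mulrDl mul1r scalerDl scalerBr.
  move: (piprod N th (a + r)) (piprod N th a) (_ *: _) (_ *: _) (_ *: _) => u v w x z.
  by apply/matrixP => i j; rewrite !mxE; ring.
have [Q _ _] := head_bnd N1 th_le (ltnW arN).
have h1 := specM_le td Q.
have h2 := specM_le (th_le aN) (head_dist (ltnW arN)).
apply: le_trans (specD_le (IH (ltnW arN)) (specZ_le Ni (specD_le h1 h2))) _.
rewrite -[r.+1%:R]natr1 [(r%:R + 1) / _]mulrDl mul1r -subr_ge0.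
move: (N%:R)^-1 (r%:R / N%:R) r0 Ni => e x x0 e0.
have -> : gam * (Cn + 1) * (x + e) ^+ 2 -
   (gam * (Cn + 1) * x ^+ 2 + e * (Cn * (x + e) * gam + 2^-1 * (gam * x))) =
   gam * (Cn * (e * x) + 3 / 2 * (e * x) + e ^+ 2).
  by move: gam => g; field.
have ex0 : 0 <= e * x by rewrite mulr_ge0.
rewrite mulr_ge0 // !addr_ge0 ?sqr_ge0 // mulr_ge0 //; lra.
Qed.

End EulerProducts.

(** Here [e] stands for [1 / N], [h] for the exact step in [s], [r] for its rounding to the grid. As
    [e] and [h] are at most 1, [r ^+ 2 <= h ^+ 2 + 3 e], and everything but [G * h ^+ 2] is a
    multiple of [e] that vanishes in the limit. *)
Lemma expansion_error (R : realType) (G g c p e h r : R) :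
  0 <= G -> 0 <= g -> 0 <= r -> 0 <= e <= 1 -> 0 <= h <= 1 -> `|r - h| <= e ->
  0 <= p * e -> 0 <= c * e ->
  c * e + c * e + (G * r ^+ 2 + (e * (2^-1 * g) + h * (p * e * g + 2^-1 * (c * e)))) <=
  G * h ^+ 2 + (2 * c + 3 * G + 2^-1 * g + (p * g + 2^-1 * c)) * e.
Proof.
move=> G0 g0 r0 /andP[e0 e1] /andP[h0 h1]; rewrite ler_norml => /andP[_ rh] pe ce.
have hr : r <= h + e by lra.
have x1 : G * r ^+ 2 <= G * (h ^+ 2 + 3 * e).
  rewrite ler_wpM2l //; apply: (@le_trans _ _ ((h + e) ^+ 2)).
    by rewrite lerXn2r ?nnegrE ?addr_ge0.
  rewrite sqrrD -addrA lerD2l.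
  have : h * e <= e by rewrite ler_piMl.
  have : e ^+ 2 <= e by rewrite expr2 ler_piMl.
  lra.
have x2 : h * (p * e * g + 2^-1 * (c * e)) <= p * e * g + 2^-1 * (c * e).
  by rewrite ler_piMl // addr_ge0 // mulr_ge0.
rewrite [leRHS](_ : _ = G * (h ^+ 2 + 3 * e) +
  (2 * (c * e) + e * (2^-1 * g) + (p * e * g + 2^-1 * (c * e)))); last by ring.
lra.
Qed.

(** * The limits of [psiN] and of the partial products, and the neural ODE *)

Section Family.
Context {R : realType} {d : nat}.
Variables (Sigma B : 'M[R]_d) (M m : R).
Hypotheses (d0 : (0 < d)%N) (Ssym : Sigma^T = Sigma) (M0 : 0 < M) (m0 : 0 < m).
Hypothesis Mub : forall a, eigenvalue Sigma a -> a <= M.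
Hypothesis mlb : forall a, eigenvalue Sigma a -> m <= a.
Variable theta : nat -> nat -> R -> 'M[R]_d.
Hypothesis flow : forall N, (1 <= N)%N -> is_rescaled_grad_flow Sigma B N (theta N).
Hypothesis loss0 : forall N, (1 <= N)%N ->
  Num.sqrt (lossN Sigma B N (fun k => theta N k 0)) < m / (4 * Num.sqrt (2 * M * expR 3)).
Hypothesis init : forall N n, (1 <= N)%N -> (1 <= n <= N)%N -> spec_norm (theta N n 0) <= 4^-1.
Variable C0 : R.
Hypothesis C00 : 0 < C0.
Hypothesis nbr0 : forall N n, (1 <= N)%N -> (1 <= n < N)%N ->
  spec_norm (theta N n.+1 0 - theta N n 0) <= C0 / N%:R.
Variables (psi_init : R -> 'M[R]_d) (C : R) (N0 : nat).
Hypothesis init_lim : forall N, (N0 <= N)%N -> (1 <= N)%N -> forall s, 0 <= s <= 1 ->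
  spec_norm (psiN theta N s 0 - psi_init s) <= C / N%:R.

Definition nbr_const : R := C0 + 2 * gam ^+ 2 * Dm m / mu m.
(** Two comparisons with [psi_init], at depths [N] and [N * k], and one index shift. The absolute
    value lets [C / (N * k)] be bounded by a multiple of [1 / N] whatever the sign of [C]. *)
Definition init_const : R := 2 * `|C| + nbr_const.
Definition psi_const : R := Ctheta (d := d) M m init_const + nbr_const.
Definition head_const : R := Chead (d := d) M m init_const.

Let half N t : (1 <= N)%N -> 0 <= t -> forall i, (1 <= i <= N)%N ->
  spec_norm (theta N i t) <= 2^-1.
Proof.
move=> N1 t0; apply: (theta_le_half d0 Ssym M0 m0 Mub mlb N1 (flow N1) (loss0 N1) _ t0).
by move=> n; exact: init.
Qed.

Let nbr N t i : (1 <= N)%N -> 0 <= t -> (1 <= i < N)%N ->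
  spec_norm (theta N i.+1 t - theta N i t) <= nbr_const / N%:R.
Proof.
move=> N1 t0 iN; apply: (neighbor_le d0 Ssym M0 m0 Mub mlb N1 (flow N1) (loss0 N1) _ t0 iN).
  by move=> n; exact: init.
exact: nbr0.
Qed.

Let Cn0 : 0 <= nbr_const.
Proof.
apply: addr_ge0; first exact: ltW.
apply: divr_ge0; last exact/ltW/mu_gt0.
by apply: mulr_ge0; [rewrite mulr_ge0 ?exprn_ge0 ?expR_ge0|exact/ltW/Dm_gt0].
Qed.

Let index_close N k s t : (1 <= N)%N -> (1 <= k)%N -> 0 <= s <= 1 -> 0 <= t ->
  spec_norm (psiN theta N s t - theta N ((nidx (N * k) s).-1 %/ k).+1 t) <= nbr_const / N%:R.
Proof.
move=> N1 k1 s01 t0.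
have L1 : (1 <= N * k)%N by rewrite muln_gt0 N1.
rewrite -[psiN theta N s t]/(theta N (nidx N s) t).
have cn : 0 <= nbr_const / N%:R by rewrite divr_ge0.
have /andP[s0 _] := s01.
have [->|e] := nidx_refine N k1 s0; first by rewrite subrr spec0.
have /andP[n1 nN] := nidx_range N1 s01.
rewrite -e spec_distC; apply: nbr => //; rewrite n1 e /= ltn_divLR //.
by have /andP[l1 lL] := nidx_range L1 s01; rewrite prednK.
Qed.

Let init_pair N k j : (N0 <= N)%N -> (1 <= N)%N -> (1 <= k)%N -> (j < N * k)%N ->
  spec_norm (theta (N * k) j.+1 0 - theta N (j %/ k).+1 0) <= init_const / N%:R.
Proof.
move=> N0N N1 k1 jL; have L1 : (1 <= N * k)%N by rewrite muln_gt0 N1.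
(* The grid point at which the fine [psiN] reads layer [j.+1]. *)
pose s : R := j.+1%:R / (N * k)%:R.
have Lp : 0 < (N * k)%:R :> R by rewrite ltr0n.
have Np : 0 < N%:R :> R by rewrite ltr0n.
have s01 : 0 <= s <= 1 by rewrite divr_ge0 //= ler_pdivrMr // mul1r ler_nat.
have ns : nidx (N * k) s = j.+1 by exact: nidx_grid.
have h0 := index_close N1 k1 s01 (lexx 0); rewrite ns /= in h0.
have N0L : (N0 <= N * k)%N by rewrite (leq_trans N0N) // leq_pmulr.
have h1 := init_lim N0L L1 s01.
have h2 := init_lim N0N N1 s01.
rewrite -[psiN theta (N * k) s 0]/(theta (N * k) (nidx (N * k) s) 0) ns in h1.
rewrite spec_distC in h2.
apply: le_trans (spec_triangle_le h1 (spec_triangle_le h2 h0)) _.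
have -> : init_const / N%:R = `|C| / N%:R + (`|C| / N%:R + nbr_const / N%:R).
  by rewrite /init_const; move: nbr_const => ?; ring.
apply: lerD; last by rewrite lerD2r ler_pM2r ?invr_gt0 ?ler_norm.
apply: (@le_trans _ _ (`|C| / (N * k)%:R)); first by rewrite ler_pM2r ?invr_gt0 ?ler_norm.
by rewrite ler_wpM2l // lef_pV2 ?posrE // ler_nat leq_pmulr.
Qed.

Definition headN (N : nat) (s t : R) : 'M[R]_d :=
  piprod N (fun n => theta N n t) (Num.truncn (N%:R * s)).

Let psi_refine N k s t : (N0 <= N)%N -> (1 <= N)%N -> (1 <= k)%N -> 0 <= s <= 1 -> 0 <= t ->
  spec_norm (psiN theta (N * k) s t - psiN theta N s t) <= psi_const / N%:R.
Proof.
move=> N0N N1 k1 s01 t0; have L1 : (1 <= N * k)%N by rewrite muln_gt0 N1.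
have /andP[j1 jL] := nidx_range L1 s01.
have jL' : ((nidx (N * k) s).-1 < N * k)%N by rewrite prednK.
have h1 := pair_theta d0 Ssym M0 m0 Mub mlb N1 k1 (flow N1) (flow L1) (loss0 N1) (loss0 L1)
  (fun n => init N1) (fun n => init L1) (fun j => init_pair N0N N1 k1) t0 jL'.
rewrite prednK // in h1.
have h2 := index_close N1 k1 s01 t0; rewrite spec_distC in h2.
by rewrite /psi_const mulrDl; exact: spec_triangle_le h1 h2.
Qed.

Let head_refine N k s t : (N0 <= N)%N -> (1 <= N)%N -> (1 <= k)%N -> 0 <= s <= 1 -> 0 <= t ->
  spec_norm (headN (N * k) s t - headN N s t) <= head_const / N%:R.
Proof.
move=> N0N N1 k1 s01 t0; have L1 : (1 <= N * k)%N by rewrite muln_gt0 N1.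
have /andP[s0 _] := s01.
rewrite /headN -(truncn_divn N k1 s0).
have := pair_head d0 Ssym M0 m0 Mub mlb N1 k1 (flow N1) (flow L1) (loss0 N1) (loss0 L1)
  (fun n => init N1) (fun n => init L1) (fun j => init_pair N0N N1 k1) t0
  (truncn_unit_le (N * k) s01).
exact.
Qed.

Let cauchy_of_refine (u : nat -> 'M[R]_d) (c : R) :
  (forall N k, (N0 <= N)%N -> (1 <= N)%N -> (1 <= k)%N ->
    spec_norm (u (N * k)%N - u N) <= c / N%:R) ->
  exists l : 'M[R]_d, forall N, (N0 <= N)%N -> (1 <= N)%N -> spec_norm (l - u N) <= c / N%:R.
Proof.
move=> uc; apply: spec_cauchy_lim => N N' a b a' b'.
apply: (@spec_triangle_le _ _ _ (u (N * N')%N)); first by rewrite spec_distC uc.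
by rewrite mulnC uc.
Qed.

Lemma limit_pair : exists psi q : R -> R -> 'M[R]_d,
  forall s t N, 0 <= s <= 1 -> 0 <= t -> (N0 <= N)%N -> (1 <= N)%N ->
  spec_norm (psi s t - psiN theta N s t) <= psi_const / N%:R /\
  spec_norm (q s t - headN N s t) <= head_const / N%:R.
Proof.
have ex (u : R -> R -> nat -> 'M[R]_d) (c : R) :
  (forall s t N k, 0 <= s <= 1 -> 0 <= t -> (N0 <= N)%N -> (1 <= N)%N -> (1 <= k)%N ->
    spec_norm (u s t (N * k)%N - u s t N) <= c / N%:R) ->
  exists v : R -> R -> 'M[R]_d, forall s t N, 0 <= s <= 1 -> 0 <= t ->
     (N0 <= N)%N -> (1 <= N)%N -> spec_norm (v s t - u s t N) <= c / N%:R.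
  move=> uc.
  have [v vP] : {v : R * R -> 'M[R]_d & forall st : R * R, 0 <= st.1 <= 1 -> 0 <= st.2 ->
     forall N, (N0 <= N)%N -> (1 <= N)%N -> spec_norm (v st - u st.1 st.2 N) <= c / N%:R}.
    apply: (choice (P := fun (st : R * R) v => 0 <= st.1 <= 1 -> 0 <= st.2 ->
     forall N, (N0 <= N)%N -> (1 <= N)%N -> spec_norm (v - u st.1 st.2 N) <= c / N%:R)).
    move=> [s t] /=.
    (* Choice needs a value at every pair; outside the domain it is 0. *)
    have [[s01 t0]|n] := pselect (0 <= s <= 1 /\ 0 <= t); last first.
      by exists 0 => s01 t0; case: n.
    have [l lP] := @cauchy_of_refine (u s t) c (fun N k => uc s t N k s01 t0).
    by exists l.
  by exists (fun s t => v (s, t)) => s t N s01 t0; exact: (vP (s, t) s01 t0).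
have [psi psiP] := ex (fun s t N => psiN theta N s t) psi_const
  (fun s t N k s01 t0 a b c => psi_refine a b c s01 t0).
have [q qP] := ex (fun s t N => headN N s t) head_const
  (fun s t N k s01 t0 a b c => head_refine a b c s01 t0).
by exists psi, q => s t N s01 t0 a b; split; [exact: psiP|exact: qP].
Qed.

Variables psi q : R -> R -> 'M[R]_d.
Hypothesis psiP : forall s t N, 0 <= s <= 1 -> 0 <= t -> (N0 <= N)%N -> (1 <= N)%N ->
  spec_norm (psi s t - psiN theta N s t) <= psi_const / N%:R.
Hypothesis qP : forall s t N, 0 <= s <= 1 -> 0 <= t -> (N0 <= N)%N -> (1 <= N)%N ->
  spec_norm (q s t - headN N s t) <= head_const / N%:R.

Let psi_sp N s t : (1 <= N)%N -> 0 <= s <= 1 -> 0 <= t -> spec_norm (psiN theta N s t) <= 2^-1.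
Proof. by move=> N1 s01 t0; exact: half (nidx_range N1 s01). Qed.

Let head_sp N s t : (1 <= N)%N -> 0 <= s <= 1 -> 0 <= t -> spec_norm (headN N s t) <= gam.
Proof. by move=> N1 s01 t0; have [] := head_bnd N1 (half N1 t0) (truncn_unit_le N s01). Qed.

Lemma psi_le_half s t : 0 <= s <= 1 -> 0 <= t -> spec_norm (psi s t) <= 2^-1.
Proof.
move=> s01 t0; apply: (@le_of_divn _ _ _ psi_const N0) => N a b.
rewrite -[psi s t](subrK (psiN theta N s t)) addrC.
by apply: specD_le; [exact: psi_sp|exact: psiP].
Qed.

Lemma q_le s t : 0 <= s <= 1 -> 0 <= t -> spec_norm (q s t) <= gam.
Proof.
move=> s01 t0; apply: (@le_of_divn _ _ _ head_const N0) => N a b.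
rewrite -[q s t](subrK (headN N s t)) addrC.
by apply: specD_le; [exact: head_sp|exact: qP].
Qed.

(** At finite depth [psiN] is a step function in [s], Lipschitz only up to a jump of order [1 / N];
    [le_of_divn] removes the jump. *)
Let psi_lip_s s s' t : 0 <= s <= 1 -> 0 <= s' <= 1 -> 0 <= t -> s <= s' ->
  spec_norm (psi s' t - psi s t) <= nbr_const * (s' - s).
Proof.
move=> s01 s01' t0 ss.
apply: (@le_of_divn _ _ _ (2 * psi_const + nbr_const) N0) => N a b.
have n0 : 0 < N%:R :> R by rewrite ltr0n.
have /andP[s0 _] := s01.
have [le dist] := truncn_dist N s0 ss.
have h : spec_norm (psiN theta N s' t - psiN theta N s t) <= nbr_const * ((s' - s) + (N%:R)^-1).
  rewrite -[psiN theta N s' t]/(theta N (nidx N s') t) -[psiN theta N s t]/(theta N (nidx N s) t).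
  have /andP[i1 iN] := nidx_range b s01; have /andP[i1' iN'] := nidx_range b s01'.
  have [nn dn] := nidx_diff le.
  have := @layer_dist R d N (fun n => theta N n t) nbr_const (fun i => nbr b t0)
     (nidx N s) (nidx N s' - nidx N s) i1.
  rewrite subnKC // => /(_ iN') /le_trans; apply; rewrite ler_wpM2l //.
  rewrite ler_pdivrMr // mulrDl mulVf ?gt_eqF // mulrC.
  apply: (@le_trans _ _ (Num.truncn (N%:R * s') - Num.truncn (N%:R * s))%:R).
    by rewrite ler_nat.
  by move: dist; rewrite ler_norml => /andP[_]; lra.
have h1 := psiP s01' t0 a b; have h2 := psiP s01 t0 a b; rewrite spec_distC in h2.
apply: le_trans (spec_triangle_le (spec_triangle_le h1 h) h2) _.
by rewrite le_eqVlt; apply/orP; left; apply/eqP; move: psi_const nbr_const {h h1 h2} (N%:R)^-1 => *; ring.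
Qed.

Lemma psi_lip : exists K : R, forall s s' t t', 0 <= s <= 1 -> 0 <= s' <= 1 ->
  0 <= t -> 0 <= t' ->
  spec_norm (psi s t - psi s' t') <= K * (`|s - s'| + `|t - t'|).
Proof.
have D0 : 0 <= 2 * gam * Dm m.
  by apply: mulr_ge0; [rewrite mulr_ge0 ?expR_ge0|exact/ltW/Dm_gt0].
exists (nbr_const + 2 * gam * Dm m) => s s' t t' s01 s01' t0 t0'.
have h1 : spec_norm (psi s t - psi s' t) <= nbr_const * `|s - s'|.
  have [ss|/ltW ss] := leP s s'.
    by rewrite spec_distC distrC ger0_norm ?subr_ge0 // psi_lip_s.
  by rewrite ger0_norm ?subr_ge0 // psi_lip_s.
have h2 : spec_norm (psi s' t - psi s' t') <= 2 * gam * Dm m * `|t - t'|.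
  apply: (@le_of_divn _ _ _ (2 * psi_const) N0) => N a b.
  have h := theta_lip d0 Ssym M0 m0 Mub mlb b (flow b) (loss0 b) (fun n => init b) t0 t0'
    (nidx_range b s01').
  have e1 := psiP s01' t0 a b; have e2 := psiP s01' t0' a b; rewrite spec_distC in e2.
  apply: le_trans (spec_triangle_le (spec_triangle_le e1 h) e2) _.
  by rewrite le_eqVlt; apply/orP; left; apply/eqP; move: psi_const gam (Dm m) `|t - t'| {h e1 e2 D0 h1} (N%:R)^-1 => *; ring.
apply: le_trans (spec_triangle_le h1 h2) _.
have a0 := mulr_ge0 Cn0 (normr_ge0 (t - t')); have b0 := mulr_ge0 D0 (normr_ge0 (s - s')).
rewrite -subr_ge0; move: (addr_ge0 a0 b0).
move: nbr_const (2 * gam * Dm m) `|t - t'| `|s - s'| => n D x z h.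
by have -> : (n + D) * (z + x) - (n * z + D * x) = n * x + D * z by ring.
Qed.

Lemma q0 t : 0 <= t -> q 0 t = 1%:M.
Proof.
move=> t0; have s01 : 0 <= (0 : R) <= 1 by rewrite lexx ler01.
apply: subr0_eq; apply: fro_eq0; apply/eqP; rewrite eq_le fro_ge0 andbT.
apply: le_trans (fro_le_spec _) _; rewrite -[leRHS](mulr0 (Num.sqrt d%:R)).
rewrite ler_wpM2l ?sqrtr_ge0 //.
apply: (@le_of_divn _ _ _ head_const N0) => N a b.
have := qP s01 t0 a b; rewrite /headN mulr0.
have -> : Num.truncn (0 : R) = 0%N by apply/eqP; rewrite truncn_eq // lexx ltr01.
by rewrite add0r.
Qed.

Lemma headN1 N t : headN N 1 t = PiN N (fun n => theta N n t).
Proof. by rewrite /headN mulr1 natrK. Qed.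

Let q_lip_le s s' t : 0 <= s <= 1 -> 0 <= s' <= 1 -> 0 <= t -> s <= s' ->
  spec_norm (q s' t - q s t) <= gam * (s' - s).
Proof.
move=> s01 s01' t0 ss.
apply: (@le_of_divn _ _ _ (2 * head_const + gam) N0) => N a b.
have n0 : 0 < N%:R :> R by rewrite ltr0n.
have /andP[s0 _] := s01.
have [le dist] := truncn_dist N s0 ss.
have h : spec_norm (headN N s' t - headN N s t) <= gam * ((s' - s) + (N%:R)^-1).
  have := @head_dist R d N (fun n => theta N n t) b (half b t0)
     (Num.truncn (N%:R * s)) (Num.truncn (N%:R * s') - Num.truncn (N%:R * s)).
  rewrite subnKC // => /(_ (truncn_unit_le _ s01')) /le_trans; apply; rewrite ler_wpM2l ?expR_ge0 //.
  rewrite ler_pdivrMr // mulrDl mulVf ?gt_eqF //.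
  by move: dist; rewrite ler_norml => /andP[_]; lra.
have h1 := qP s01' t0 a b; have h2 := qP s01 t0 a b; rewrite spec_distC in h2.
apply: le_trans (spec_triangle_le (spec_triangle_le h1 h) h2) _.
by rewrite le_eqVlt; apply/orP; left; apply/eqP; move: head_const gam {h h1 h2} (N%:R)^-1 => *; ring.
Qed.

Lemma q_lip s s' t : 0 <= s <= 1 -> 0 <= s' <= 1 -> 0 <= t ->
  spec_norm (q s t - q s' t) <= gam * `|s - s'|.
Proof.
move=> s01 s01' t0; have [ss|/ltW ss] := leP s s'.
  by rewrite spec_distC distrC ger0_norm ?subr_ge0 // q_lip_le.
by rewrite ger0_norm ?subr_ge0 // q_lip_le.
Qed.

Let q_expand_right s s' t : 0 <= s <= 1 -> 0 <= s' <= 1 -> 0 <= t -> s <= s' ->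
  spec_norm (q s' t - q s t - (s' - s) *: (psi s t *m q s t)) <=
  gam * (nbr_const + 1) * (s' - s) ^+ 2.
Proof.
move=> s01 s01' t0 ss.
pose G := gam * (nbr_const + 1).
have g0 : 0 <= gam :> R by exact: expR_ge0.
have G0 : 0 <= G by rewrite mulr_ge0 // addr_ge0.
apply: (@le_of_divn _ _ _ (2 * head_const + 3 * G + 2^-1 * gam +
   (psi_const * gam + 2^-1 * head_const)) N0) => N a b.
have n0 : 0 < N%:R :> R by rewrite ltr0n.
have /andP[s0 s1] := s01; have /andP[s0' s1'] := s01'.
have [le dist] := truncn_dist N s0 ss.
pose r : R := (Num.truncn (N%:R * s') - Num.truncn (N%:R * s))%:R / N%:R.
set e := (N%:R)^-1.
have e0 : 0 <= e by rewrite invr_ge0 ltW.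
have e1 : e <= 1 by rewrite invf_le1 // ler1n.
have rh : `|r - (s' - s)| <= e.
  have -> : r - (s' - s) = ((Num.truncn (N%:R * s') - Num.truncn (N%:R * s))%:R - N%:R * (s' - s)) / N%:R.
    by rewrite mulrBl [N%:R * _ / _]mulrAC divff ?gt_eqF // mul1r.
  by rewrite normrM [`|_^-1|]ger0_norm // ler_piMl.
have r0 : 0 <= r by rewrite divr_ge0 // ltW.
have := @head_expand R d N (fun n => theta N n t) nbr_const b Cn0 (half b t0) (fun i => nbr b t0)
   (Num.truncn (N%:R * s)) (Num.truncn (N%:R * s') - Num.truncn (N%:R * s)).
rewrite subnKC // => /(_ (truncn_unit_le _ s01')).
rewrite -/r -/(headN N s' t) -/(headN N s t) -/(nidx N s) -/(psiN theta N s t) -/G => hR.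
have h1 := qP s01' t0 a b; have h2 := qP s01 t0 a b.
have hp := psiP s01 t0 a b.
(* The four sources of error: the limits of the two products, the Euler expansion at depth [N], the
   rounding of the step, and the replacement of [psiN] and [headN] by their limits in the linear
   term. *)
have -> : q s' t - q s t - (s' - s) *: (psi s t *m q s t) =
  ((q s' t - headN N s' t) - (q s t - headN N s t)) +
  ((headN N s' t - headN N s t - r *: (psiN theta N s t *m headN N s t)) +
  ((r - (s' - s)) *: (psiN theta N s t *m headN N s t) -
   (s' - s) *: ((psi s t - psiN theta N s t) *m headN N s t + psi s t *m (q s t - headN N s t)))).
  rewrite mulmxBl mulmxBr.
  move: (psi s t *m q s t) (psiN theta N s t *m headN N s t) (psi s t *m headN N s t) => u v w.
  by apply/matrixP => i j; rewrite !mxE; ring.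
have Th := specM_le (psi_sp b s01 t0) (head_sp b s01 t0).
have p1 := specZ_le (normr_ge0 (r - (s' - s))) Th.
have hh0 : 0 <= s' - s by rewrite subr_ge0.
have hh1 : s' - s <= 1 by rewrite lerBlDr (le_trans s1') // lerDl.
have p2 := specZ_le hh0 (specD_le (specM_le hp (head_sp b s01 t0)) (specM_le (psi_le_half s01 t0) h2)).
have p1' : spec_norm ((r - (s' - s)) *: (psiN theta N s t *m headN N s t)) <= e * (2^-1 * gam).
  apply: le_trans (specZ _ _) _; apply: ler_pM => //; exact: spec_ge0.
apply: le_trans (specD_le (specB_le h1 h2) (specD_le hR (specB_le p1' p2))) _.
apply: expansion_error => //.
- by rewrite e0.
- by rewrite hh0.
- exact: le_trans (spec_ge0 _) hp.
- exact: le_trans (spec_ge0 _) h2.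
Qed.

(** A two-sided derivative also needs [s' < s]. The forward expansion at [s'] is read backwards, and
    moving its base point to [s] costs another quadratic term by the Lipschitz bounds on [psi] and
    [q]. *)
Lemma q_expand s s' t : 0 <= s <= 1 -> 0 <= s' <= 1 -> 0 <= t ->
  spec_norm (q s' t - q s t - (s' - s) *: (psi s t *m q s t)) <=
  gam * (2 * nbr_const + 2) * (s' - s) ^+ 2.
Proof.
move=> s01 s01' t0.
have g0 : 0 <= gam :> R by exact: expR_ge0.
have sq := sqr_ge0 (s' - s).
have [ss|/ltW ss] := leP s s'.
  apply: le_trans (q_expand_right s01 s01' t0 ss) _.
  by rewrite ler_wpM2r // ler_wpM2l //; move: Cn0; lra.
have h1 := q_expand_right s01' s01 t0 ss.
have hh : 0 <= s - s' by rewrite subr_ge0.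
have h2 := specM_le (psi_lip_s s01' s01 t0 ss) (q_le s01 t0).
have h3 := specM_le (psi_le_half s01' t0) (q_lip_le s01' s01 t0 ss).
have -> : q s' t - q s t - (s' - s) *: (psi s t *m q s t) =
   (s - s') *: ((psi s t - psi s' t) *m q s t + psi s' t *m (q s t - q s' t)) -
   (q s t - q s' t - (s - s') *: (psi s' t *m q s' t)).
  rewrite mulmxBl mulmxBr addrA subrK scalerBr opprB.
  by apply/matrixP => i j; rewrite !mxE; ring.
apply: le_trans (specB_le (specZ_le hh (specD_le h2 h3)) h1) _.
have -> : (s' - s) ^+ 2 = (s - s') ^+ 2 by ring.
move: (s - s') gam nbr_const hh g0 Cn0 => x g c x0 g0' c0.
rewrite -subr_ge0.
have -> : g * (2 * c + 2) * x ^+ 2 - (x * (c * x * g + 2^-1 * (g * x)) + g * (c + 1) * x ^+ 2) =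
  2^-1 * (g * x ^+ 2) by field.
by rewrite mulr_ge0 // mulr_ge0 // sqr_ge0.
Qed.

Lemma q_solves t x0 : 0 <= t -> solves_linear_ode (fun s => psi s t) x0 (fun s => q s t *m x0).
Proof.
move=> t0; split; first by rewrite q0 // mul1mx.
have vb (A : 'M[R]_d) c i : spec_norm A <= c -> `|(A *m x0) i 0| <= c * fro x0.
  move=> Ac; apply: le_trans (fro_entry _ _ _) _; apply: le_trans (spec_mulv _ _) _.
  by rewrite ler_wpM2r ?fro_ge0.
have entryB (u v : 'cV[R]_d) i : (u - v) i 0 = u i 0 - v i 0 by rewrite !mxE.
have entryZ a (u : 'cV[R]_d) i : (a *: u) i 0 = a * u i 0 by rewrite mxE.
split=> [i|s /andP[s0 s1] i].
  apply: (@lipschitz_continuous01 _ _ (gam * fro x0)) => s s' s01 s01'.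
  have := vb _ _ i (q_lip s01 s01' t0); rewrite mulrAC mulmxBl.
  by rewrite entryB.
have s01 : 0 <= s <= 1 by rewrite !ltW.
apply: (@is_derive_quadratic _ _ 0 1 s _ (gam * (2 * nbr_const + 2) * fro x0)).
  by rewrite s0 s1.
move=> s' s01'; have := vb _ _ i (q_expand s01 s01' t0).
rewrite mulrAC !mulmxBl -scalemxAl -mulmxA.
by rewrite !entryB entryZ.
Qed.

(** The convergence claim concerns every solution [x], not only the one built from [q]. The squared
    distance of two solutions starts at 0 and grows at rate at most 1, since
    [2 <psi y, y> <= 2 * 2^-1 * |y|^2]. *)
Lemma ode_unique t x0 (x : R -> 'cV[R]_d) : 0 <= t ->
  solves_linear_ode (fun s => psi s t) x0 x -> x 1 = q 1 t *m x0.
Proof.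
move=> t0 xs; have qs := q_solves x0 t0.
pose D : set R := [set` `[0, 1]]; pose I : set R := [set` `]0, 1[].
have md (z : R -> 'cV[R]_d) : solves_linear_ode (fun s => psi s t) x0 z ->
    mdiff D I z (fun s => psi s t *m z s).
  move=> [_ [zc zd]] i j; rewrite (ord1 j); split; first exact: zc.
  by move=> s; rewrite /I /= in_itv /= => s01; exact: zd.
have dy := mdiffB (md _ xs) (md _ qs).
pose y s := x s - q s t *m x0.
have := gronwall_exp ler01 (@subset_refl _ D) (@subset_refl _ I) (c := 1) (sdiff_fdot dy).
rewrite /= -/(y _).
have -> : x 0 - q 0 t *m x0 = 0 by rewrite xs.1 qs.1 subrr.
rewrite /fdot mul0mx linear0 mul0r -/(fdot _ _) => H.
suff : fdot (y 1) (y 1) = 0 by move=> /fdot_eq0 /eqP; rewrite subr_eq0 => /eqP.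
apply/eqP; rewrite eq_le fdot_ge0 andbT; apply: H => s /andP[s0 s1].
have s01 : 0 <= s <= 1 by rewrite !ltW.
rewrite -mulmxBr -/(y s) -!/(fdot _ _) mul1r.
have : fdot (psi s t *m y s) (y s) <= 2^-1 * fro (y s) * fro (y s).
  apply: le_trans (fdot_le _ _) _; rewrite ler_wpM2r ?fro_ge0 //.
  by apply: le_trans (spec_mulv _ _) _; rewrite ler_wpM2r ?fro_ge0 // psi_le_half.
rewrite -mulrA -expr2 fro_sqr; lra.
Qed.

End Family.

Theorem theorem1 (R : realType) (d : nat) (Sigma B : 'M[R]_d) (M m : R)
  (theta : nat -> nat -> R -> 'M[R]_d) :
  (0 < d)%N ->
  Sigma^T = Sigma ->
  (forall v : 'cV[R]_d, v != 0 -> 0 < (v^T *m Sigma *m v) 0 0) ->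
  0 < M -> eigenvalue Sigma M -> (forall a, eigenvalue Sigma a -> a <= M) ->
  0 < m -> eigenvalue Sigma m -> (forall a, eigenvalue Sigma a -> m <= a) ->
  (forall N, (1 <= N)%N -> is_rescaled_grad_flow Sigma B N (theta N)) ->
  (* (i) *)
  (forall N, (1 <= N)%N ->
     Num.sqrt (lossN Sigma B N (fun k => theta N k 0)) <
       m / (4 * Num.sqrt (2 * M * expR 3))) ->
  (forall N n, (1 <= N)%N -> (1 <= n <= N)%N -> spec_norm (theta N n 0) <= 4^-1) ->
  (* (ii) *)
  (exists C0 : R, 0 < C0 /\ forall N n, (1 <= N)%N -> (1 <= n < N)%N ->
     spec_norm (theta N n.+1 0 - theta N n 0) <= C0 / N%:R) ->
  (* (iii) *)
  (exists psi_init : R -> 'M[R]_d, exists C : R, exists N0 : nat,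
     forall N, (N0 <= N)%N -> (1 <= N)%N -> forall s, 0 <= s <= 1 ->
       spec_norm (psiN theta N s 0 - psi_init s) <= C / N%:R) ->
  exists psi : R -> R -> 'M[R]_d,
    (* Lipschitz continuity in (s,t) on [0,1] x R_+ *)
    (exists K : R, forall s s' t t', 0 <= s <= 1 -> 0 <= s' <= 1 -> 0 <= t -> 0 <= t' ->
        spec_norm (psi s t - psi s' t') <= K * (`|s - s'| + `|t - t'|)) /\
    (* uniform convergence of psi_N to psi on [0,1] x R_+ *)
    (forall eps : R, 0 < eps -> exists N0 : nat, forall N, (N0 <= N)%N -> (1 <= N)%N ->
        forall s t, 0 <= s <= 1 -> 0 <= t -> spec_norm (psi s t - psiN theta N s t) < eps) /\
    (* with rate O(1/N) *)
    (exists C : R, exists N0 : nat, forall N, (N0 <= N)%N -> (1 <= N)%N ->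
        forall s t, 0 <= s <= 1 -> 0 <= t -> spec_norm (psi s t - psiN theta N s t) <= C / N%:R) /\
    (* the Neural ODE dx/ds = psi(s,t) x(s), x(0) = x0 has solutions on [0,1] *)
    (forall t, 0 <= t -> forall x0 : 'cV[R]_d, exists x : R -> 'cV[R]_d,
        solves_linear_ode (fun s => psi s t) x0 x) /\
    (* and Pi^N(t) converges, uniformly in t >= 0, to the map x0 |-> x(1)
       (in operator norm: |Pi^N(t) x0 - x(1)| <= eps |x0|) *)
    (forall eps : R, 0 < eps -> exists N0 : nat, forall N, (N0 <= N)%N -> (1 <= N)%N ->
        forall t, 0 <= t -> forall (x0 : 'cV[R]_d) (x : R -> 'cV[R]_d),
          solves_linear_ode (fun s => psi s t) x0 x ->
          vnorm (PiN N (fun k => theta N k t) *m x0 - x 1) <= eps * vnorm x0).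
Proof.
move=> d0 Ssym _ M0 _ Mub m0 _ mlb flow loss0 init [C0 [C00 nbr0]] [psi_init [C [N0 init_lim]]].
have [psi [q lim]] := limit_pair d0 Ssym M0 m0 Mub mlb flow loss0 init C00 nbr0 init_lim.
have psiP s t N a b c e := (lim s t N a b c e).1.
have qP s t N a b c e := (lim s t N a b c e).2.
exists psi; split.
  exact: (psi_lip d0 Ssym M0 m0 Mub mlb flow loss0 init C00 nbr0 psiP).
split.
  move=> eps eps0; have [N1 small] := divn_lt_eps (psi_const (d := d) M m C0 C) eps0.
  exists (maxn N0 N1) => N; rewrite geq_max => /andP[N0N N1N] N_ge1 s t s01 t0.
  exact: le_lt_trans (psiP s t N s01 t0 N0N N_ge1) (small N N1N N_ge1).
split.
  exists (psi_const (d := d) M m C0 C), N0 => N N0N N_ge1 s t s01 t0; exact: psiP.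
split.
  move=> t t0 x0; exists (fun s => q s t *m x0).
  exact: (q_solves d0 Ssym M0 m0 Mub mlb flow loss0 init C00 nbr0 psiP qP).
move=> eps eps0; have [N1 small] := divn_lt_eps (head_const (d := d) M m C0 C) eps0.
exists (maxn N0 N1) => N; rewrite geq_max => /andP[N0N N1N] N_ge1 t t0 x0 x xs.
rewrite (ode_unique d0 Ssym M0 m0 Mub mlb flow loss0 init C00 nbr0 psiP qP t0 xs).
have s01 : 0 <= (1 : R) <= 1 by rewrite ler01 lexx.
rewrite -headN1 -mulmxBl vnormE; apply: le_trans (spec_mulv _ _) _.
rewrite -vnormE; apply: ler_wpM2r; first exact: sqrtr_ge0.
rewrite spec_distC; apply: le_trans (qP 1 t N s01 t0 N0N N_ge1) _.
exact/ltW/small.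
Qed.
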